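(* Let $d\ge1$, let $\beta=(\beta_1,\dots,\beta_d)\in(1,\infty)^d$ with $\beta_1\ge\beta_2\ge\dots\ge\beta_d$, and let $(p,q)\in[1,\infty]^2$. Consider the conditions: (i) $q>p$ and $\frac q{p'}\ge1+\frac1{J_n+\frac{d-n}2}$ for all $0\le n\le d$; (ii) $q\le p$ and $\frac{1+J_n+d-n}q<\frac{J_n}{p'}+\frac{d-n}2$ for all $0\le n\le d$; (iii) $q=p$, $\frac{1+J_d}q=\frac{J_d}{p'}$, and $\frac{1+J_n+d-n}q<\frac{J_n}{p'}+\frac{d-n}2$ for all $0\le n<d$; (iv) $q\le p\le\infty$, $\frac{1+J_d}q=\frac{J_d}{p'}$, and $\frac{1+J_n+d-n}q<\frac{J_n}{p'}+\frac{d-n}2$ for all $0\le n<d$. If $(p,q)$ does not satisfy any of conditions (i)--(iii), then $\mathcal E_\beta$ is not of strong type $(p,q)$ (i.e. does not extend as a bounded operator from $L^p$ to $L^q$). If $(p,q)$ does not satisfy any of conditions (i)--(iv), then $\mathcal E_\beta$ is not of restricted weak type $(p,q)$.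
   Context: $Q^{\mathbf 1}:=(-1,1)^d$, $p'$ is the dual exponent of $p$, and $$\mathcal E_\beta f(t,x)=\int_{Q^{\mathbf 1}}e^{i(tg_\beta(\xi)+x\cdot\xi)}f(\xi)\,d\xi,\qquad g_\beta(\xi):=\sum_{j=1}^d|\xi_j|^{\beta_j},\quad(t,x)\in\mathbb R^{1+d}.$$ $J_n:=\frac1{\beta_1}+\dots+\frac1{\beta_n}$ for $0\le n\le d$, with $J_0=0$. The inequality $\frac q{p'}\ge c$ is read as $q\ge cp'$ (so it holds for $p=1$, $q=\infty$). A linear operator $T$, initially defined on $L^1$, is of restricted weak type $(p,q)$ if there is a constant $C<\infty$ with $|\langle Tf_E,g_F\rangle|\le C|E|^{\frac1p}|F|^{\frac1{q'}}$ for all measurable sets $E,F$ of finite measure and all measurable functions $|f_E|\le\chi_E$, $|g_F|\le\chi_F$ (for $\mathcal E_\beta$: $E\subseteq Q^{\mathbf 1}$, $F\subseteq\mathbb R^{1+d}$). *)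

(* Defs.v *)
From HB Require Import structures.
From mathcomp Require Import all_boot all_order all_algebra.
From mathcomp Require Import complex.
From mathcomp Require Import all_classical all_reals all_analysis.

Set Implicit Arguments.
Unset Strict Implicit.
Unset Printing Implicit Defensive.

Import Order.TTheory GRing.Theory Num.Theory.
Import numFieldNormedType.Exports.

Local Open Scope classical_set_scope.
Local Open Scope ring_scope.

(* R^n with the product Borel sigma-algebra.  [measurableTypeR R] is [R] with
   the Borel sigma-algebra on which [lebesgue_measure] is defined. *)
Notation Rn R n := (n.-tuple (measurableTypeR R)).

Section lebesgue_Rn.
Variable R : realType.
Local Notation RR := (measurableTypeR R).

Definition consRn (n : nat) (z : RR * Rn R n) : Rn R n.+1 :=
  [the n.+1.-tuple RR of z.1 :: z.2].

Lemma measurable_consRn (n : nat) : measurable_fun [set: RR * Rn R n] (@consRn n).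
Proof.
exact: (@measurable_cons _ _ (RR * Rn R n)%type RR fst n snd
  measurable_fst measurable_snd).
Qed.

Definition unconsRn (n : nat) (x : Rn R n.+1) : RR * Rn R n :=
  (thead x, [tuple of behead x]).

Lemma consRnK (n : nat) : cancel (@consRn n) (@unconsRn n).
Proof.
move=> [a x]; rewrite /unconsRn /consRn /= theadE; congr pair.
exact: val_inj.
Qed.

Lemma measurable_unconsRn (n : nat) :
  measurable_fun [set: Rn R n.+1] (@unconsRn n).
Proof.
apply/measurable_fun_pairP; split.
- exact: (@measurable_tnth _ RR n.+1 ord0).
- exact: (@measurable_behead _ RR n).
Qed.

Section step.
Variables (n : nat) (mu : {sigma_finite_measure set (Rn R n) -> \bar R}).

Definition lebesgue_step : set (Rn R n.+1) -> \bar R :=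
  pushforward (lebesgue_measure \x mu)%E (@consRn n).

Let step0 : lebesgue_step set0 = 0%E.
Proof. by rewrite /lebesgue_step /pushforward preimage_set0 measure0. Qed.

Let mpre (A : set (Rn R n.+1)) : measurable A -> measurable (@consRn n @^-1` A).
Proof.
by move=> mA; rewrite -[X in measurable X]setTI; exact: measurable_consRn.
Qed.

Let step_ge0 A : (0 <= lebesgue_step A)%E.
Proof. exact: (measure_ge0 (lebesgue_measure \x mu)%E). Qed.

Let step_sigma_additive : semi_sigma_additive lebesgue_step.
Proof.
move=> F mF tF mUF; rewrite /lebesgue_step /pushforward preimage_bigcup.
apply: measure_semi_sigma_additive.
- by move=> k; exact: mpre.
- apply/trivIsetP => /= i j _ _ ij; rewrite -preimage_setI.
  by move/trivIsetP : tF => /(_ _ _ _ _ ij) ->//; rewrite preimage_set0.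
- by rewrite -preimage_bigcup; exact: mpre.
Qed.

HB.instance Definition _ := isMeasure.Build _ _ _ lebesgue_step
  step0 step_ge0 step_sigma_additive.

Let step_sigma_finite : sigma_finite setT lebesgue_step.
Proof.
have [F TF mF] : sigma_finite setT (lebesgue_measure \x mu)%E.
  have /sigma_finiteP[F [TF ndF Foo]] := sigma_finiteT (@lebesgue_measure R).
  have /sigma_finiteP[G [TG ndG Goo]] := sigma_finiteT mu.
  exists (fun k => F k `*` G k).
    rewrite -setXTT TF TG predeqE => -[x y]; split.
      move=> [/= [i _ Fix] [j _ Gjy]]; exists (maxn i j) => //; split.
      - by move: x Fix; exact/subsetPset/ndF/leq_maxl.
      - by move: y Gjy; exact/subsetPset/ndG/leq_maxr.
    by move=> [i _ []/= ? ?]; split; exists i.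
  move=> k; have [? ?] := Foo k; have [? ?] := Goo k.
  split; first exact: measurableX.
  by rewrite product_measure1E// lte_mul_pinfty// ge0_fin_numE.
exists (fun k => @unconsRn n @^-1` F k).
  by rewrite -preimage_bigcup -TF preimage_setT.
move=> k; have [mFk Fk] := mF k; split.
  by rewrite -[X in measurable X]setTI; exact: measurable_unconsRn.
rewrite /lebesgue_step /pushforward -comp_preimage.
by rewrite (_ : _ \o _ = id) ?preimage_id//; apply/funext; exact: consRnK.
Qed.

HB.instance Definition _ := Measure_isSigmaFinite.Build _ _ _ lebesgue_step
  step_sigma_finite.

End step.

(* n-dimensional Lebesgue measure (on Borel sets): the unit mass for n = 0,
   and the product of [lebesgue_measure] and the (n-1)-dimensional measure,
   transported along R * R^(n-1) = R^n, for n > 0. *)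
Fixpoint lebesgueRn (n : nat) : {sigma_finite_measure set (Rn R n) -> \bar R} :=
  match n return {sigma_finite_measure set (Rn R n) -> \bar R} with
  | 0 => dirac ([tuple] : Rn R 0)
  | m.+1 => lebesgue_step (lebesgueRn m)
  end.

Lemma lebesgueRn_rect (n : nat) (A : 'I_n -> set RR) :
  (forall i, measurable (A i)) ->
  lebesgueRn n [set x | forall i, A i (tnth x i)] =
  (\prod_(i < n) lebesgue_measure (A i))%E.
Proof.
elim: n A => [|n IHn] A mA.
  rewrite big_ord0 /= diracE (_ : _ \in _) //.
  by apply/mem_set => -[].
rewrite big_ord_recl /= /lebesgue_step /pushforward.
rewrite (_ : _ @^-1` _ = A ord0 `*`
    [set x | forall i, A (lift ord0 i) (tnth x i)]); last first.
  apply/seteqP; split => [[a x] /= Ax|[a x] /= [Aa Ax] i].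
    split => [|i]; first by have := Ax ord0; rewrite tnth0.
    by have := Ax (lift ord0 i); rewrite tnthS.
  by case: (unliftP ord0 i) => [j|] ->; rewrite ?tnthS ?tnth0.
have mB : measurable [set x : Rn R n | forall i, A (lift ord0 i) (tnth x i)].
  rewrite (_ : [set x | _] = \bigcap_(i in [set: 'I_n])
      ((fun x : Rn R n => tnth x i) @^-1` A (lift ord0 i))).
    apply: fin_bigcap_measurable => // i _.
    by rewrite -[X in measurable X]setTI; exact: measurable_tnth.
  by apply/seteqP; split => [x /= Ax i _|x /= Ax i]; apply: Ax.
rewrite product_measure1E//; congr (_ * _)%E.
by apply: (IHn (fun i => A (lift ord0 i))) => i; exact: mA.
Qed.

End lebesgue_Rn.

Section complex_valued.
Variable R : realType.
Local Notation C := R[i].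

Definition cmeasurable_fun d (X : measurableType d) (D : set X) (f : X -> C) :=
  measurable_fun D (fun x => complex.Re (f x)) /\
  measurable_fun D (fun x => complex.Im (f x)).

Definition cintegral d (X : measurableType d)
    (mu : {measure set X -> \bar R}) (D : set X) (f : X -> C) : C :=
  Complex (\int[mu]_(x in D) complex.Re (f x))%R
          (\int[mu]_(x in D) complex.Im (f x))%R.

Definition cmod (z : C) : R := ComplexField.Normc.normc z.

(* The L^p(D) norm: [\_ D] extends by 0 outside D. *)
Definition cLnorm d (X : measurableType d)
    (mu : {measure set X -> \bar R}) (D : set X) (p : \bar R) (f : X -> C) :
    \bar R :=
  Lnorm mu p ((fun x => (cmod (f x))%:E) \_ D).

Definition inLp d (X : measurableType d)
    (mu : {measure set X -> \bar R}) (D : set X) (p : \bar R) (f : X -> C) :=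
  cmeasurable_fun D f /\ (cLnorm mu D p f < +oo)%E.

Section operators.
Context d d' (X : measurableType d) (Y : measurableType d').
Variables (mu : {measure set X -> \bar R}) (D : set X).
Variable nu : {measure set Y -> \bar R}.
Variable T : (X -> C) -> (Y -> C).

(* [T], initially defined on L^1(D), extends to a bounded linear operator [S]
   from L^p(D) to L^q(Y).  Functions are representatives of their almost
   everywhere classes; linearity and boundedness of [S] imply that it respects
   these classes. *)
Definition strong_type (p q : \bar R) : Prop :=
  exists (S : (X -> C) -> (Y -> C)) (K : R),
    [/\ forall (a : C) f g, inLp mu D p f -> inLp mu D p g ->
          {ae nu, forall y, S (fun x => a * f x + g x) y = a * S f y + S g y},
        forall f, inLp mu D p f ->
          cmeasurable_fun setT (S f) /\
          (cLnorm nu setT q (S f) <= K%:E * cLnorm mu D p f)%E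
      & forall f, inLp mu D 1%E f -> inLp mu D p f ->
          {ae nu, forall y, S f y = T f y}].

(* 1/p and 1/q' are read off with the conventions 1/oo = 0 and 1' = oo. *)
Definition restricted_weak_type (p q : \bar R) : Prop :=
  exists K : R, forall (E : set X) (F : set Y) (f : X -> C) (g : Y -> C),
    measurable E -> E `<=` D -> (mu E < +oo)%E ->
    measurable F -> (nu F < +oo)%E ->
    cmeasurable_fun setT f -> (forall x, cmod (f x) <= \1_E x) ->
    cmeasurable_fun setT g -> (forall y, cmod (g y) <= \1_F y) ->
    ((cmod (cintegral nu setT (fun y => T f y * (g y)^*%C)))%:E <=
     K%:E * mu E `^ fine (p^-1) * nu F `^ fine ((hoelder_conjugate q)^-1))%E.

End operators.
End complex_valued.

Section extension_operator.
Variables (R : realType) (d : nat).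
Local Notation RR := (measurableTypeR R).

Definition cube : set (Rn R d) :=
  [set xi | forall j, (-1 : R) < tnth xi j < 1].

Variable beta : 'I_d -> R.

Definition g_beta (xi : Rn R d) : R := \sum_(j < d) `|tnth xi j : R| `^ beta j.

Definition phase (y : RR * Rn R d) (xi : Rn R d) : R :=
  (y.1 : R) * g_beta xi + \sum_(j < d) (tnth y.2 j : R) * (tnth xi j : R).

Definition extension (f : Rn R d -> R[i]) (y : RR * Rn R d) : R[i] :=
  cintegral (lebesgueRn R d) cube
    (fun xi => Complex (cos (phase y xi)) (sin (phase y xi)) * f xi).

Definition extension_strong_type : \bar R -> \bar R -> Prop :=
  strong_type (lebesgueRn R d) cube
    (lebesgue_measure \x lebesgueRn R d)%E extension.

Definition extension_restricted_weak_type : \bar R -> \bar R -> Prop :=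
  restricted_weak_type (lebesgueRn R d) cube
    (lebesgue_measure \x lebesgueRn R d)%E extension.

Definition J (n : nat) : R := \sum_(j < d | (j < n)%N) (beta j)^-1.

Variables p q : \bar R.

Definition scaling_ineq (n : nat) : Prop :=
  (1 + J n + (d - n)%:R) * fine (q^-1)%E <
  J n * fine ((hoelder_conjugate p)^-1)%E + (d - n)%:R / 2.

Definition scaling_line : Prop :=
  (1 + J d) * fine (q^-1)%E = J d * fine ((hoelder_conjugate p)^-1)%E.

Definition cond_i : Prop :=
  (p < q)%E /\
  forall n, (n <= d)%N ->
    ((1 + (J n + (d - n)%:R / 2)^-1)%:E * hoelder_conjugate p <= q)%E.

Definition cond_ii : Prop :=
  (q <= p)%E /\ forall n, (n <= d)%N -> scaling_ineq n.

Definition cond_iii : Prop :=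
  [/\ q = p, scaling_line & forall n, (n < d)%N -> scaling_ineq n].

Definition cond_iv : Prop :=
  [/\ (q <= p <= +oo)%E, scaling_line & forall n, (n < d)%N -> scaling_ineq n].

End extension_operator.

(* Main.v *)
Require Import Defs.
From mathcomp Require Import all_boot all_order all_algebra.
From mathcomp Require Import complex.
From mathcomp Require Import all_classical all_reals all_analysis.
From mathcomp Require Import measurable_realfun ess_sup_inf ring lra zify.

Set Implicit Arguments.
Unset Strict Implicit.
Unset Printing Implicit Defensive.

Import Order.TTheory GRing.Theory Num.Theory.
Import numFieldNormedType.Exports.

Local Open Scope classical_set_scope.
Local Open Scope ring_scope.

(** Write s = 1/q, P = 1/p and a_n = J_n + (d - n)/2.  All the necessary
    conditions are obtained by testing the operator on sums of wave packets, that
    is, indicator functions of boxes times characters.  If the box has sides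
    z^(-1/beta_j) near the flat point 0 in the first n coordinates and z^(-1/2)
    away from 0 in the others, then for |t| <= z the phase is affine on the box up
    to a small error, so the extension of the packet has size comparable to the
    volume z^(-a_n) of the box on a tube of length z and dual cross-section
    ([packet_lower_bound], [packet_on_tube]).

    A single packet, tested on its own tube, gives (1 + a_n) s <= a_n (1 - P) for
    all n <= d ([knapp]).  This is the whole story when p < q, and it settles
    n = d, up to equality, when q <= p.

    For n < d the strict inequality is needed.  All the z^((d-n)/2) packets with
    different directions in the last d - n coordinates are added with random
    signs, so that by Khintchine's inequality the sum is as large as its square
    function ([indicator_bound_level]).  A restricted weak type bound then says
    that at least m tubes meet only on a set of measure O(m^(-q/2)), relative to
    the critical power of z.  For q > 2 this is summable in m, and the union of
    the tubes cannot be much smaller than their total mass ([sum_measure_le]).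
    But modulations translate the tubes freely, and they can be arranged like the
    lines of a Besicovitch set: the k-th binary digit of the direction is made
    harmless at the time k z / N by a suitable translation, and the union shrinks
    by the factor N, the logarithm of the number of directions
    ([nu_besicovitch_set]).  Letting N grow excludes even the critical line
    ([kakeya_necessity]).  If q <= 2, interpolation with the trivial bound leads
    to the critical line of the case n = 0, just excluded
    ([indicator_bound_gt2]).

    There remains the strong type at the equality case n = d with q < p.  There,
    N packets at the flat point, of geometrically growing scales, live on disjoint
    boxes and are large on disjoint time slabs.  Each of them carries the same
    share of both norms, whence N^(1/q) <= C N^(1/p) ([scaling_line_strong]). *)

(** * Random signs *)

Section random_signs.
Variable R : realType.

Fixpoint sign_words (n : nat) : seq bitseq :=
  if n is m.+1 then
    [seq rcons e false | e <- sign_words m] ++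
    [seq rcons e true | e <- sign_words m]
  else [:: [::]].

Lemma size_sign_words n : size (sign_words n) = (2 ^ n)%N.
Proof.
elim: n => [|n IHn] //=.
by rewrite size_cat !size_map IHn expnS mul2n addnn.
Qed.

Lemma size_sign_word n e : e \in sign_words n -> size e = n.
Proof.
elim: n e => [|n IHn] e /=; first by rewrite inE => /eqP ->.
by rewrite mem_cat => /orP[] /mapP[e' /IHn <- ->]; rewrite size_rcons.
Qed.

Lemma sum_sign_words_cst (c : R) n : \sum_(e <- sign_words n) c = 2 ^+ n * c.
Proof.
rewrite big_const_seq count_predT size_sign_words iter_addr addr0.
by rewrite -[LHS]mulr_natl natrX.
Qed.

Definition word_sum (z : nat -> R) (n : nat) (e : bitseq) : R :=
  \sum_(i < n) (-1) ^+ nth false e i * z i.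

Lemma word_sum_rcons z n e b : size e = n ->
  word_sum z n.+1 (rcons e b) = word_sum z n e + (-1) ^+ b * z n.
Proof.
move=> en; rewrite /word_sum big_ord_recr/= nth_rcons en ltnn eqxx.
by congr (_ + _); apply: eq_bigr => i _; rewrite nth_rcons en ltn_ord.
Qed.

Lemma sum_sign_wordsS (phi : R -> R) z n :
  \sum_(e <- sign_words n.+1) phi (word_sum z n.+1 e) =
  \sum_(e <- sign_words n)
     (phi (word_sum z n e + z n) + phi (word_sum z n e - z n)).
Proof.
rewrite /= big_cat/= !big_map big_split/=; congr (_ + _);
  apply: eq_big_seq => e /size_sign_word en; rewrite word_sum_rcons//.
- by rewrite expr0 mul1r.
- by rewrite expr1 mulN1r.
Qed.

Lemma second_moment (z : nat -> R) n :
  \sum_(e <- sign_words n) word_sum z n e ^+ 2 =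
  2 ^+ n * \sum_(i < n) z i ^+ 2.
Proof.
elim: n => [|n IHn].
  by rewrite big_seq1 /word_sum !big_ord0 expr0n/= mulr0.
rewrite (sum_sign_wordsS (fun x => x ^+ 2)) big_ord_recr/=.
rewrite (eq_bigr (fun e => 2 * word_sum z n e ^+ 2 + 2 * z n ^+ 2));
  last by move=> e _; ring.
rewrite big_split/= -mulr_sumr IHn sum_sign_words_cst (exprS 2 n); ring.
Qed.

(** Expanding the fourth power leaves only the terms in which every index
    occurs an even number of times, whence the Gaussian constant 3. *)
Lemma fourth_moment (z : nat -> R) n :
  \sum_(e <- sign_words n) word_sum z n e ^+ 4 <=
  3 * 2 ^+ n * (\sum_(i < n) z i ^+ 2) ^+ 2.
Proof.
elim: n => [|n IHn].
  by rewrite big_seq1 /word_sum !big_ord0 !expr0n/= mulr0.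
rewrite (sum_sign_wordsS (fun x => x ^+ 4)) big_ord_recr/=.
rewrite (eq_bigr (fun e => 2 * word_sum z n e ^+ 4 +
  (12 * z n ^+ 2) * word_sum z n e ^+ 2 + 2 * z n ^+ 4));
  last by move=> e _; ring.
rewrite !big_split/= -[X in X + _ + _]mulr_sumr -[X in _ + X + _]mulr_sumr.
rewrite second_moment sum_sign_words_cst (exprS 2 n).
set s := \sum_(i < n) _ in IHn *; set m := \sum_(i <- _) _ in IHn *.
have p0 : 0 <= 2 ^+ n :> R by apply: exprn_ge0.
apply: (@le_trans _ _ (2 * (3 * 2 ^+ n * s ^+ 2) +
   12 * z n ^+ 2 * (2 ^+ n * s) + 2 ^+ n * (2 * z n ^+ 4))).
  by rewrite !lerD2r ler_pM2l.
rewrite -subr_ge0 (_ : _ - _ = 4 * 2 ^+ n * z n ^+ 2 * z n ^+ 2); last by ring.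
by apply: mulr_ge0; [apply: mulr_ge0; [exact: mulr_ge0|exact: sqr_ge0]|exact: sqr_ge0].
Qed.

Lemma normr_ge_quartic (u s : R) : 0 < s ->
  u ^+ 2 / s - 4 / 27 * u ^+ 4 / s ^+ 3 <= `|u|.
Proof.
move=> s0; wlog u0 : u / 0 <= u => [H|].
  case: (leP 0 u) => [/H //|/ltW u0].
  have u4 : (- u) ^+ 4 = u ^+ 4 by ring.
  by have := H (- u); rewrite normrN oppr_ge0 sqrrN u4; exact.
rewrite ger0_norm// -subr_ge0.
pose v := u / s; have -> : u = v * s by rewrite /v divfK// gt_eqF.
have v0 : 0 <= v by rewrite divr_ge0// ltW.
rewrite (_ : _ - _ = s * v * ((4 * (v - 3 / 2) ^+ 2 * (v + 3)) / 27)).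
  apply: mulr_ge0; first by rewrite mulr_ge0// ltW.
  apply: divr_ge0 => //; apply: mulr_ge0; last by rewrite addr_ge0.
  by apply: mulr_ge0 => //; exact: sqr_ge0.
by field; rewrite gt_eqF.
Qed.

(** Khintchine's inequality in L^1.  The lower bound on the mean of |S| comes
    from the second and fourth moments, through a polynomial minorant of |u|. *)
Lemma khintchine_words (z : nat -> R) n :
  2 ^+ n * (5 / 9) * Num.sqrt (\sum_(i < n) z i ^+ 2) <=
  \sum_(e <- sign_words n) `|word_sum z n e|.
Proof.
set v := \sum_(i < n) _.
have v0 : 0 <= v by apply: sumr_ge0 => i _; exact: sqr_ge0.
have [->|vn0] := eqVneq v 0.
  by rewrite sqrtr0 mulr0; apply: sumr_ge0.
set s := Num.sqrt v.
have s0 : 0 < s by rewrite sqrtr_gt0 lt0r vn0.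
have vE : v = s ^+ 2 by rewrite sqr_sqrtr.
apply: (@le_trans _ _ (\sum_(e <- sign_words n)
    (word_sum z n e ^+ 2 / s - 4 / 27 * word_sum z n e ^+ 4 / s ^+ 3))); last first.
  by apply: ler_sum => e _; exact: normr_ge_quartic.
rewrite sumrB -!mulr_suml -mulr_sumr second_moment -/v vE.
have h4 := fourth_moment z n; rewrite -/v vE in h4.
have sN0 : s != 0 by rewrite gt_eqF.
rewrite -[leLHS](_ : 2 ^+ n * s ^+ 2 / s -
  4 / 27 * (3 * 2 ^+ n * (s ^+ 2) ^+ 2) / s ^+ 3 = _); last by field.
rewrite lerD2l lerN2; apply: ler_wpM2r.
  by rewrite invr_ge0 exprn_ge0// ltW.
by rewrite ler_wpM2l// divr_ge0.
Qed.

(** The family of all sign choices on [I], in the form needed below: some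
    choice does at least as well as the average. *)
Lemma khintchine (I : finType) : exists signs : seq {ffun I -> bool},
  (0 < size signs)%N /\ forall z : I -> R,
    (size signs)%:R * (5 / 9) * Num.sqrt (\sum_i z i ^+ 2) <=
    \sum_(e <- signs) `|\sum_i (-1) ^+ e i * z i|.
Proof.
exists [seq [ffun i => nth false e (enum_rank i)] | e <- sign_words #|I|].
rewrite size_map size_sign_words; split; first by rewrite expn_gt0.
move=> z; rewrite big_map natrX.
pose y k := oapp z 0 (nth None [seq Some i | i <- enum I] k).
have yE (i : I) : y (enum_rank i) = z i.
  rewrite /y (nth_map i) ?nth_enum_rank//.
  by rewrite -cardE; exact: ltn_ord.
have sumE (F : I -> R) : \sum_i F i = \sum_(k < #|I|) F (enum_val k).
  by rewrite -big_enum_val; apply: eq_bigl.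
have -> : \sum_i z i ^+ 2 = \sum_(k < #|I|) y k ^+ 2.
  by rewrite sumE; apply: eq_bigr => k _; rewrite -yE enum_valK.
apply: le_trans (khintchine_words y #|I|) _.
rewrite le_eqVlt; apply/orP; left; apply/eqP; apply: eq_bigr => e _.
rewrite /word_sum sumE; congr `| _ |; apply: eq_bigr => k _.
by rewrite ffunE enum_valK -[in RHS]yE enum_valK.
Qed.

End random_signs.

(** * Boxes and sheared boxes *)

Section boxes.
Variables (R : realType) (d : nat).
Local Notation RR := (measurableTypeR R).
Local Notation X := (Rn R d).
Local Notation Y := (RR * Rn R d)%type.
Local Notation mu := (lebesgueRn R d).
Local Notation nu := (lebesgue_measure \x lebesgueRn R d)%E.

Definition box (a l : 'I_d -> R) : set X :=
  [set xi | forall j, a j < (tnth xi j : R) < a j + l j].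

Lemma measurable_coord_rect (A : 'I_d -> set RR) :
  (forall j, measurable (A j)) ->
  measurable [set x : X | forall j, A j (tnth x j)].
Proof.
move=> mA; rewrite (_ : [set x | _] =
    \bigcap_(j in [set: 'I_d]) ((fun x : X => tnth x j) @^-1` A j)).
  apply: fin_bigcap_measurable => // j _.
  by rewrite -[X in measurable X]setTI; exact: measurable_tnth.
by apply/seteqP; split => [x /= Ax j _|x /= Ax j]; apply: Ax.
Qed.

Lemma boxE a l : box a l =
  [set x : X | forall j, `]a j, a j + l j[%classic (tnth x j)].
Proof.
by apply/seteqP; split => x /= Ax j; have := Ax j; rewrite /= in_itv.
Qed.

Lemma measurable_box a l : measurable (box a l).
Proof.
rewrite boxE.
apply: (@measurable_coord_rect (fun j => `]a j, a j + l j[%classic)) => j.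
exact: measurable_itv.
Qed.

Lemma mu_box a l : (forall j, 0 <= l j) -> mu (box a l) = (\prod_j l j)%:E.
Proof.
move=> l0; rewrite boxE (lebesgueRn_rect (A := fun j => `]a j, a j + l j[%classic));
  last by move=> j; exact: measurable_itv.
rewrite -prodEFin; apply: eq_bigr => j _.
rewrite lebesgue_measure_itv/= lte_fin ltrDl.
case: ltP => [_|lj0]; first by rewrite -EFinD addrAC subrr add0r.
by congr EFin; apply/eqP; rewrite eq_le l0.
Qed.

(** The region where a packet centred at [c] at time 0 and travelling with
    velocity [- v] is found between the times [t0] and [t1]. *)
Definition tube (t0 t1 : R) (c v r : 'I_d -> R) : set Y :=
  [set y | t0 <= (y.1 : R) <= t1 /\
    forall j, `|(tnth y.2 j : R) - (c j - (y.1 : R) * v j)| <= r j].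

Lemma measurable_tube t0 t1 c v r : measurable (tube t0 t1 c v r).
Proof.
rewrite (_ : tube _ _ _ _ _ = ((fun y : Y => y.1 : R) @^-1` `[t0, t1]%classic) `&`
  \bigcap_(j in [set: 'I_d])
    ((fun y : Y => (tnth y.2 j : R) - (c j - (y.1 : R) * v j)) @^-1`
       `[- r j, r j]%classic)).
  have m1 : measurable_fun [set: Y] (fun y : Y => y.1 : R) by exact: measurable_fst.
  apply: measurableI.
    by rewrite -[X in measurable X]setTI; apply: m1.
  apply: fin_bigcap_measurable => // j _.
  rewrite -[X in measurable X]setTI.
  suff mf : measurable_fun [set: Y]
      (fun y : Y => (tnth y.2 j : R) - (c j - (y.1 : R) * v j)).
    by apply: mf.
  apply: measurable_funB; first by
    apply: (measurableT_comp (measurable_tnth j)); exact: measurable_snd.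
  by apply: measurable_funB => //; exact: measurable_funM.
apply/seteqP; split => y /= [y1 yj].
  split; first by rewrite in_itv.
  by move=> j _ /=; rewrite in_itv/= -ler_norml; exact: yj.
split; first by move: y1; rewrite in_itv.
by move=> j; have := yj j I; rewrite /= in_itv/= -ler_norml.
Qed.

Lemma nu_tube t0 t1 c v r : t0 <= t1 -> (forall j, 0 <= r j) ->
  nu (tube t0 t1 c v r) = ((t1 - t0) * \prod_j (2 * r j))%:E.
Proof.
move=> t01 r0; rewrite /= /product_measure1 /=.
transitivity (\int[lebesgue_measure]_x
   (\1_(`[t0, t1]%classic) (x : RR) * \prod_j (2 * r j))%:E)%E.
  apply: eq_integral => x _; rewrite /=.
  have [xt|xt] := boolP (x \in `[t0, t1]%classic).
    rewrite indicE xt mul1r.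
    rewrite (_ : xsection _ _ = [set u : X | forall j,
       `[c j - x * v j - r j, c j - x * v j + r j]%classic (tnth u j)]).
      rewrite (lebesgueRn_rect (A := fun j =>
        `[c j - x * v j - r j, c j - x * v j + r j]%classic));
        last by move=> j; exact: measurable_itv.
      rewrite -prodEFin; apply: eq_bigr => j _.
      rewrite lebesgue_measure_itv/= lte_fin; case: ltP => [_|rj].
        by rewrite -EFinD; congr EFin; ring.
      by congr EFin; have := r0 j; lra.
    apply/seteqP; split => u; rewrite /xsection/= inE.
      by move=> [/= _ uj] j; have := uj j; rewrite in_itv/= ler_distl.
    move=> uj; split => /=; first by move: xt; rewrite inE/= in_itv.
    by move=> j; have := uj j; rewrite in_itv/= ler_distl.
  rewrite indicE (negbTE xt) mul0r (_ : xsection _ _ = set0) ?measure0//.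
  rewrite -subset0 => u; rewrite /xsection/= inE => -[/= xt' _].
  by move: xt; rewrite notin_setE/= in_itv/= xt'.
under eq_integral do rewrite EFinM.
have p0 : 0 <= \prod_j (2 * r j) by apply: prodr_ge0 => j _; rewrite mulr_ge0.
rewrite ge0_integralZr//; last first.
  by apply/measurable_EFinP; exact: measurable_indic.
rewrite integral_indic//.
rewrite setIT [X in (X * _)%E]lebesgue_measure_itv/= lte_fin EFinM.
by case: ltP => // t10; congr (_ * _)%E; congr EFin; lra.
Qed.

End boxes.

(** * The extension operator on bounded functions *)

Section modulus.
Variable R : realType.
Local Notation C := R[i].
Implicit Types z w : C.

Definition cis (u : R) : C := Complex (cos u) (sin u).

Lemma ReM z w : complex.Re (z * w) =
  complex.Re z * complex.Re w - complex.Im z * complex.Im w.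
Proof. by case: z => a b; case: w. Qed.

Lemma ImM z w : complex.Im (z * w) =
  complex.Re z * complex.Im w + complex.Im z * complex.Re w.
Proof. by case: z => a b; case: w. Qed.

Lemma cmodE z : cmod z = Num.sqrt (complex.Re z ^+ 2 + complex.Im z ^+ 2).
Proof. by case: z. Qed.

Lemma sqr_cmod z : cmod z ^+ 2 = complex.Re z ^+ 2 + complex.Im z ^+ 2.
Proof. by rewrite cmodE sqr_sqrtr// addr_ge0// sqr_ge0. Qed.

Lemma cmod_ge0 z : 0 <= cmod z.
Proof. by rewrite cmodE sqrtr_ge0. Qed.

Lemma Re_le_cmod z : `|complex.Re z| <= cmod z.
Proof. by rewrite cmodE -sqrtr_sqr ler_wsqrtr// lerDl sqr_ge0. Qed.

Lemma Im_le_cmod z : `|complex.Im z| <= cmod z.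
Proof. by rewrite cmodE -sqrtr_sqr ler_wsqrtr// lerDr sqr_ge0. Qed.

Lemma cmod_le_ReIm z : cmod z <= `|complex.Re z| + `|complex.Im z|.
Proof.
rewrite -(ler_pXn2r (n := 2))// ?nnegrE ?cmod_ge0 ?addr_ge0//.
rewrite sqr_cmod sqrrD !real_normK ?num_real// lerD2r lerDl.
by rewrite mulrn_wge0// mulr_ge0.
Qed.

Lemma cmodM z w : cmod (z * w) = cmod z * cmod w.
Proof. exact: ComplexField.Normc.normcM. Qed.

Lemma cmod0 : cmod (0 : C) = 0.
Proof. exact: ComplexField.Normc.normc0. Qed.

Lemma cmodD z w : cmod (z + w) <= cmod z + cmod w.
Proof. exact: le_normcD. Qed.

Lemma cmod_sum (I : Type) (s : seq I) (F : I -> C) :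
  cmod (\sum_(i <- s) F i) <= \sum_(i <- s) cmod (F i).
Proof.
elim: s => [|i s IHs]; first by rewrite !big_nil cmod0.
by rewrite !big_cons (le_trans (cmodD _ _))// lerD2l.
Qed.

Lemma cmod_cis u : cmod (cis u) = 1.
Proof. by rewrite /cis cmodE/= cos2Dsin2 sqrtr1. Qed.

Lemma cmod_real (a : R) : cmod (Complex a 0) = `|a|.
Proof. by rewrite cmodE/= expr0n/= addr0 sqrtr_sqr. Qed.

Lemma cmod_sign (b : bool) z : cmod ((-1) ^+ b * z) = cmod z.
Proof.
by case: b; rewrite ?expr1 ?expr0 ?mul1r// mulN1r; case: z => a c; rewrite !cmodE/= !sqrrN.
Qed.

Lemma sin_le (x : R) : `|sin x| <= `|x|.
Proof.
wlog x0 : x / 0 <= x => [H|].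
  case: (leP 0 x) => [/H //|/ltW x0].
  by have := H (- x); rewrite sinN !normrN oppr_ge0; exact.
have [c _] := MVT_segment x0 (fun x _ => is_derive_sin x)
  (continuous_subspaceT (@continuous_sin R)).
rewrite sin0 !subr0 => ->; rewrite normrM ler_piMl//.
exact: cos_max.
Qed.

Lemma cos_ge_half (x : R) : `|x| <= 1 -> 2^-1 <= cos x.
Proof.
move=> x1; have -> : x = (x / 2) *+ 2 by rewrite -mulr_natr divfK.
rewrite cos_mulr2n -[cos _ ^+ 2](addrK (sin (x / 2) ^+ 2)) cos2Dsin2.
have h : sin (x / 2) ^+ 2 <= 4^-1.
  rewrite -real_normK ?num_real// (_ : 4^-1 = 2^-1 ^+ 2); last by field.
  rewrite ler_pXn2r ?nnegrE ?invr_ge0//.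
  rewrite (le_trans (sin_le _))// normrM normfV (ger0_norm (x := 2))//.
  by rewrite ler_piMl ?invr_ge0.
by rewrite -(mulr_natr (1 - _)); lra.
Qed.

Lemma Re_sign_sum (I : finType) (e : I -> bool) (F : I -> C) :
  complex.Re (\sum_i (-1) ^+ e i * F i) = \sum_i (-1) ^+ e i * complex.Re (F i).
Proof.
apply: (big_ind2 (fun z a => complex.Re z = a)) => //.
  by move=> [a b] _ [c d] _ /= <- <-.
by move=> i _; case: (e i); rewrite ?expr1 ?expr0 ?mul1r// !mulN1r; case: (F i).
Qed.

Lemma Im_sign_sum (I : finType) (e : I -> bool) (F : I -> C) :
  complex.Im (\sum_i (-1) ^+ e i * F i) = \sum_i (-1) ^+ e i * complex.Im (F i).
Proof.
apply: (big_ind2 (fun z a => complex.Im z = a)) => //.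
  by move=> [a b] _ [c d] _ /= <- <-.
by move=> i _; case: (e i); rewrite ?expr1 ?expr0 ?mul1r// !mulN1r; case: (F i).
Qed.

End modulus.

Section bounded_functions.
Variables (R : realType) (d : nat) (beta : 'I_d -> R).
Local Notation C := R[i].
Local Notation RR := (measurableTypeR R).
Local Notation X := (Rn R d).
Local Notation Y := (RR * Rn R d)%type.
Local Notation mu := (lebesgueRn R d).
Local Notation nu := (lebesgue_measure \x lebesgueRn R d)%E.
Local Notation ext := (extension beta).
Local Notation cube := (@Defs.cube R d).

Definition bounded_meas (f : X -> C) :=
  cmeasurable_fun setT f /\ exists M : R, forall x, cmod (f x) <= M.

Lemma cubeE : cube = box (fun=> -1) (fun=> 2).
Proof.
apply/seteqP; split => x /= xj j; have := xj j;
  by rewrite (_ : -1 + 2 = 1 :> R)//; ring.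
Qed.

Lemma measurable_cube : measurable cube.
Proof. by rewrite cubeE; exact: measurable_box. Qed.

Lemma mu_cube : mu cube = (2 ^+ d)%:E.
Proof. by rewrite cubeE mu_box// prodr_const card_ord. Qed.

Lemma mu_cube_lty : (mu cube < +oo)%E.
Proof. by rewrite mu_cube ltry. Qed.

Lemma measurable_phase :
  measurable_fun [set: Y * X] (fun z => phase beta z.1 z.2).
Proof.
have mt : measurable_fun [set: Y * X] (fun z => z.1.1 : R).
  by apply: measurableT_comp; [exact: measurable_fst|exact: measurable_fst].
have mx j : measurable_fun [set: Y * X] (fun z => tnth z.1.2 j : R).
  apply: (measurableT_comp (measurable_tnth j)).
  by apply: measurableT_comp; [exact: measurable_snd|exact: measurable_fst].
have mxi j : measurable_fun [set: Y * X] (fun z => tnth z.2 j : R).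
  by apply: (measurableT_comp (measurable_tnth j)); exact: measurable_snd.
apply: measurable_funD.
  apply: measurable_funM => //; apply: measurable_sum => j.
  apply: (measurableT_comp (@measurable_powR R (beta j))).
  by apply: measurableT_comp => //; exact: mxi.
by apply: measurable_sum => j; apply: measurable_funM.
Qed.

Lemma measurable_cos : measurable_fun [set: R] (@cos R).
Proof. by apply: continuous_measurable_fun; exact: continuous_cos. Qed.

Lemma measurable_sin : measurable_fun [set: R] (@sin R).
Proof. by apply: continuous_measurable_fun; exact: continuous_sin. Qed.

Lemma measurable_sqrt : measurable_fun [set: R] (@Num.sqrt R).
Proof. by apply: continuous_measurable_fun; exact: sqrt_continuous. Qed.

Lemma cmeasurable_cmod dT (T : measurableType dT) (D : set T) (f : T -> C) :
  cmeasurable_fun D f -> measurable_fun D (fun x => cmod (f x)).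
Proof.
move=> [mr mi].
under eq_fun do rewrite cmodE.
apply: (measurableT_comp measurable_sqrt).
by apply: measurable_funD; apply: measurable_funX.
Qed.

Definition kernel (f : X -> C) (y : Y) (xi : X) : C := cis (phase beta y xi) * f xi.

Lemma cmod_kernel f y xi : cmod (kernel f y xi) = cmod (f xi).
Proof. by rewrite cmodM cmod_cis mul1r. Qed.

Lemma measurable_kernel f : cmeasurable_fun setT f ->
  cmeasurable_fun [set: Y * X] (fun z => kernel f z.1 z.2).
Proof.
move=> [mr mi].
have mfr : measurable_fun [set: Y * X] (fun z => complex.Re (f z.2)).
  by apply: (measurableT_comp mr); exact: measurable_snd.
have mfi : measurable_fun [set: Y * X] (fun z => complex.Im (f z.2)).
  by apply: (measurableT_comp mi); exact: measurable_snd.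
have mc : measurable_fun [set: Y * X] (fun z => cos (phase beta z.1 z.2)).
  by apply: (measurableT_comp measurable_cos); exact: measurable_phase.
have ms : measurable_fun [set: Y * X] (fun z => sin (phase beta z.1 z.2)).
  by apply: (measurableT_comp measurable_sin); exact: measurable_phase.
split.
  under eq_fun do rewrite ReM/=.
  by apply: measurable_funB; apply: measurable_funM.
under eq_fun do rewrite ImM/=.
by apply: measurable_funD; apply: measurable_funM.
Qed.

Lemma integrable_bounded (h : X -> R) (M : R) : measurable_fun setT h ->
  (forall x, `|h x| <= M) -> mu.-integrable cube (EFin \o h).
Proof.
move=> mh hM; apply: measurable_bounded_integrable => //.
- exact: measurable_cube.
- exact: mu_cube_lty.
- exact: measurable_funTS.
exists M; split; first exact: num_real.
by move=> N MN x _ /=; rewrite (le_trans (hM x))// ltW.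
Qed.

Lemma integrable_Re_kernel f y : bounded_meas f ->
  mu.-integrable cube (EFin \o (fun xi => complex.Re (kernel f y xi))).
Proof.
move=> [/measurable_kernel[mk _] [M fM]]; apply: (@integrable_bounded _ M).
  exact: measurable_fun_pair2 mk.
by move=> x; rewrite (le_trans (Re_le_cmod _))// cmod_kernel.
Qed.

Lemma integrable_Im_kernel f y : bounded_meas f ->
  mu.-integrable cube (EFin \o (fun xi => complex.Im (kernel f y xi))).
Proof.
move=> [/measurable_kernel[_ mk] [M fM]]; apply: (@integrable_bounded _ M).
  exact: measurable_fun_pair2 mk.
by move=> x; rewrite (le_trans (Im_le_cmod _))// cmod_kernel.
Qed.

Lemma extension_sign_sum (I : finType) (e : I -> bool) (f : I -> X -> C) y :
  (forall i, bounded_meas (f i)) ->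
  ext (fun xi => \sum_i (-1) ^+ e i * f i xi) y =
  \sum_i (-1) ^+ e i * ext (f i) y.
Proof.
move=> bf.
have kE xi : kernel (fun xi => \sum_i (-1) ^+ e i * f i xi) y xi =
    \sum_i (-1) ^+ e i * kernel (f i) y xi.
  rewrite /kernel mulr_sumr; apply: eq_bigr => i _.
  by rewrite mulrCA.
have RsumE (h : I -> X -> R) :
    (forall i, mu.-integrable cube (EFin \o h i)) ->
    (\int[mu]_(x in cube) \sum_i (-1) ^+ e i * h i x)%R =
    \sum_i (-1) ^+ e i * (\int[mu]_(x in cube) h i x)%R.
  move=> ih.
  have isg i : mu.-integrable cube (fun x => ((-1) ^+ e i * h i x)%:E).
    exact: (integrableZl measurable_cube ((-1) ^+ e i) (ih i)).
  rewrite [LHS]/Rintegral -[RHS]/(fine (_%:E)); congr fine.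
  under eq_integral do rewrite -sumEFin.
  rewrite (@integral_sum _ _ _ _ _ measurable_cube _
    (fun i x => ((-1) ^+ e i * h i x)%:E))// -sumEFin.
  apply: eq_bigr => i _; rewrite EFinM fineK.
    by rewrite -(integralZl measurable_cube (ih i)).
  exact: (integrable_fin_num measurable_cube (ih i)).
apply/eqP; rewrite eq_complex Re_sign_sum Im_sign_sum; apply/andP; split; apply/eqP.
  rewrite -RsumE; last by move=> i; exact: integrable_Re_kernel.
  by apply: eq_Rintegral => xi _; rewrite -Re_sign_sum -kE.
rewrite -RsumE; last by move=> i; exact: integrable_Im_kernel.
by apply: eq_Rintegral => xi _; rewrite -Im_sign_sum -kE.
Qed.

(** The real and imaginary parts of [ext f] are parametric integrals; adding a
    constant makes the integrand nonnegative, so that Tonelli's theorem gives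
    measurability in the parameter. *)
Lemma measurable_parametric (h : Y * X -> R) (M : R) :
  measurable_fun setT h -> (forall z, `|h z| <= M) ->
  measurable_fun setT (fun y => \int[mu]_(xi in cube) h (y, xi))%R.
Proof.
move=> mh hM.
pose g (z : Y * X) := (\1_cube z.2 * (h z + M))%:E.
have mc : measurable_fun [set: Y * X] (fun z => \1_cube z.2 : R).
  apply: (measurableT_comp (measurable_indic measurable_cube)).
  exact: measurable_snd.
have mg : measurable_fun [set: Y * X] g.
  apply/measurable_EFinP; apply: measurable_funM => //.
  exact: measurable_funD.
have hM0 z : 0 <= h z + M by have := hM z; rewrite ler_norml; lra.
have g0 z : (0 <= g z)%E by rewrite lee_fin mulr_ge0.
rewrite (_ : (fun y => _) = (fun y => fine (fubini_F mu g y) - M * 2 ^+ d)).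
  apply: measurable_funB => //.
  apply: measurableT_comp; first exact: fine_measurable.
  exact: measurable_fun_fubini_tonelli_F.
apply/funext => y; rewrite /fubini_F.
have ih : mu.-integrable cube (EFin \o (fun xi => h (y, xi))).
  by apply: (@integrable_bounded _ M) => //; exact: measurable_fun_pair2 mh.
have iM : mu.-integrable cube (EFin \o (fun=> M)).
  by apply: (@integrable_bounded _ `|M|).
transitivity ((\int[mu]_(xi in cube) (h (y, xi) + M))%R - M * 2 ^+ d).
  rewrite RintegralD//; last exact: measurable_cube.
  by rewrite (Rintegral_cst mu measurable_cube) [X in fine X]mu_cube addrK.
congr (_ - _); congr fine; rewrite integral_mkcond.
apply: eq_integral => xi _; rewrite /g patchE indicE/=.
by case: ifP => _; rewrite ?mul1r// mul0r.
Qed.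

Lemma measurable_extension f : bounded_meas f -> cmeasurable_fun setT (ext f).
Proof.
move=> [/measurable_kernel[mr mi] [M fM]]; split.
  apply: (@measurable_parametric (fun z => complex.Re (kernel f z.1 z.2)) M) => //.
  by move=> z; rewrite (le_trans (Re_le_cmod _))// cmod_kernel.
apply: (@measurable_parametric (fun z => complex.Im (kernel f z.1 z.2)) M) => //.
by move=> z; rewrite (le_trans (Im_le_cmod _))// cmod_kernel.
Qed.

Lemma cmod_extension_le f (M : R) y : cmeasurable_fun setT f ->
  (forall x, cmod (f x) <= M) -> cmod (ext f y) <= 2 * (M * 2 ^+ d).
Proof.
move=> mf fM; have bf : bounded_meas f by split; last exists M.
have bnd (h : X -> R) : mu.-integrable cube (EFin \o h) ->
    (forall x, `|h x| <= M) -> `|\int[mu]_(x in cube) h x| <= M * 2 ^+ d.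
  move=> ih hM; apply: (le_trans (le_normr_Rintegral measurable_cube ih)).
  apply: (@le_trans _ _ (\int[mu]_(x in cube) M)).
    apply: le_Rintegral => //; first exact: measurable_cube.
      by apply: integrable_norm.
    by apply: (@integrable_bounded _ `|M|).
  by rewrite (Rintegral_cst mu measurable_cube) [X in fine X]mu_cube.
rewrite (le_trans (cmod_le_ReIm _))// mulr_natl mulr2n lerD//; apply: bnd.
- exact: integrable_Re_kernel.
- by move=> x; rewrite (le_trans (Re_le_cmod _))// cmod_kernel.
- exact: integrable_Im_kernel.
- by move=> x; rewrite (le_trans (Im_le_cmod _))// cmod_kernel.
Qed.

End bounded_functions.

(** * From operator bounds to inequalities for indicator functions *)

Section weighted_indicator.
Context dT (T : measurableType dT) (R : realType).
Variable m : {measure set T -> \bar R}.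

Lemma integral_scale_indic (c : R) (A : set T) : 0 <= c -> measurable A ->
  (\int[m]_x (c * \1_A x)%:E = c%:E * m A)%E.
Proof.
move=> c0 mA; under eq_integral do rewrite EFinM.
rewrite ge0_integralZl//.
  by rewrite integral_indic// setIT.
by apply/measurable_EFinP; exact: measurable_indic.
Qed.

End weighted_indicator.

Section operator_bounds.
Variables (R : realType) (d : nat) (beta : 'I_d -> R).
Local Notation C := R[i].
Local Notation RR := (measurableTypeR R).
Local Notation X := (Rn R d).
Local Notation Y := (RR * Rn R d)%type.
Local Notation mu := (lebesgueRn R d).
Local Notation nu := (lebesgue_measure \x lebesgueRn R d)%E.
Local Notation ext := (extension beta).
Local Notation cube := (@Defs.cube R d).

(** The restricted weak type inequality with real exponents [P] = 1/p and
    [s] = 1/q, where the dual function has been optimized away. *)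
Definition indicator_bound (K P s : R) : Prop :=
  forall (E : set X) (F : set Y) (f : X -> C),
    measurable E -> E `<=` cube -> 0 < fine (mu E) ->
    measurable F -> (nu F < +oo)%E -> 0 < fine (nu F) ->
    cmeasurable_fun setT f -> (forall x, cmod (f x) <= \1_E x) ->
    (\int[nu]_y (\1_F y * cmod (ext f y))%:E <=
     (K * fine (mu E) `^ P * fine (nu F) `^ (1 - s))%:E)%E.

Lemma bounded_meas_indic (E : set X) (f : X -> C) :
  cmeasurable_fun setT f -> (forall x, cmod (f x) <= \1_E x) -> bounded_meas f.
Proof.
move=> mf fE; split => //; exists 1 => x.
by rewrite (le_trans (fE x))// indicE.
Qed.

Lemma mu_subcube_fin (E : set X) : measurable E -> E `<=` cube ->
  mu E \is a fin_num.
Proof.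
move=> mE Ec; rewrite ge0_fin_numE//.
apply: le_lt_trans (@mu_cube_lty R d).
by apply: le_measure; rewrite ?inE//; exact: measurable_cube.
Qed.

Lemma measurable_indic_cmod_ext (F : set Y) f : measurable F -> bounded_meas f ->
  measurable_fun setT (fun y => (\1_F y * cmod (ext f y))%:E).
Proof.
move=> mF bf; apply/measurable_EFinP; apply: measurable_funM.
  exact: measurable_indic.
by apply: cmeasurable_cmod; exact: measurable_extension.
Qed.

(** Testing against the sign of one component of [ext f] over [F].  Both
    components are reached by rotating [ext f] by a unit [c]. *)
Lemma component_bound (p q : \bar R) (K : R) (c : C) (E : set X) (F : set Y)
    (f : X -> C) :
  (forall (E : set X) (F : set Y) (f : X -> C) (g : Y -> C),
    measurable E -> E `<=` cube -> (mu E < +oo)%E ->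
    measurable F -> (nu F < +oo)%E ->
    cmeasurable_fun setT f -> (forall x, cmod (f x) <= \1_E x) ->
    cmeasurable_fun setT g -> (forall y, cmod (g y) <= \1_F y) ->
    ((cmod (cintegral nu setT (fun y => ext f y * (g y)^*%C)))%:E <=
     K%:E * mu E `^ fine (p^-1) * nu F `^ fine ((hoelder_conjugate q)^-1))%E) ->
  cmod c = 1 ->
  measurable E -> E `<=` cube -> measurable F -> (nu F < +oo)%E ->
  cmeasurable_fun setT f -> (forall x, cmod (f x) <= \1_E x) ->
  (\int[nu]_y (\1_F y * `|complex.Re (ext f y * c)|)%:E <=
   (`|K| * fine (mu E) `^ fine (p^-1) *
      fine (nu F) `^ fine ((hoelder_conjugate q)^-1))%:E)%E.
Proof.
move=> HK c1 mE Ec mF Foo mf fE.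
have bf := bounded_meas_indic mf fE.
have muE := mu_subcube_fin mE Ec.
have nuF : nu F \is a fin_num by rewrite ge0_fin_numE.
pose h y := complex.Re (ext f y * c).
have [mr mi] := measurable_extension beta bf.
have mh : measurable_fun setT h.
  rewrite /h; under eq_fun do rewrite ReM.
  by apply: measurable_funB; apply: measurable_funM.
pose sg y : R := (if 0 <= h y then 1 else -1) * \1_F y.
have msg : measurable_fun setT sg.
  apply: measurable_funM; last exact: measurable_indic.
  by apply: measurable_fun_ifT => //; apply: measurable_fun_ler.
have sgF y : `|sg y| <= \1_F y.
  by rewrite normrM (ger0_norm (_ : 0 <= \1_F y))//; case: ifP => _;
    rewrite ?normrN normr1 mul1r.
pose g y : C := (c * Complex (sg y) 0)^*%C.
have gE y : (g y)^*%C = c * Complex (sg y) 0.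
  by rewrite /g; case: (c * _) => a b /=; rewrite opprK.
have cmodJ (z : C) : cmod (z^*%C) = cmod z.
  by case: z => a b; rewrite !cmodE/= sqrrN.
have mg : cmeasurable_fun setT g.
  rewrite /g; split.
    rewrite (_ : (fun y => _) = (fun y => complex.Re c * sg y)).
      exact: measurable_funM.
    by apply/funext => y; case: (c) => a b /=; rewrite mulr0 subr0.
  rewrite (_ : (fun y => _) = (fun y => - complex.Im c * sg y)).
    exact: measurable_funM.
  by apply/funext => y; case: (c) => a b /=; rewrite mulr0 add0r mulNr.
have gF y : cmod (g y) <= \1_F y.
  by rewrite /g cmodJ cmodM c1 mul1r cmod_real.
have := HK E F f g mE Ec.
rewrite -ge0_fin_numE// => /(_ muE mF Foo mf fE mg gF).
rewrite -{1}(fineK muE) -{1}(fineK nuF) !poweR_EFin -!EFinM => HKb.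
have hE y : complex.Re (ext f y * (g y)^*%C) = \1_F y * `|h y|.
  rewrite gE mulrA ReM/= mulr0 subr0 -/(h y) /sg.
  by case: (leP 0 (h y)) => h0; [rewrite ger0_norm//|rewrite ltr0_norm//]; ring.
have [M [M0 hM]] : exists M, 0 <= M /\ forall y, `|h y| <= M.
  have [_ [M fM]] := bf; exists (2 * (`|M| * 2 ^+ d)); split.
    by rewrite !mulr_ge0// exprn_ge0.
  move=> y; rewrite (le_trans (Re_le_cmod _))// cmodM c1 mulr1.
  apply: cmod_extension_le => // x.
  by rewrite (le_trans (fM x))// ler_norm.
have int_fin : (\int[nu]_y (\1_F y * `|h y|)%:E)%E \is a fin_num.
  rewrite ge0_fin_numE; last by apply: integral_ge0 => y _; rewrite lee_fin mulr_ge0.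
  apply: (@le_lt_trans _ _ (\int[nu]_y (M * \1_F y)%:E)%E).
    apply: ge0_le_integral => //.
    - apply/measurable_EFinP; apply: measurable_funM; first exact: measurable_indic.
      exact: measurableT_comp.
    - by apply/measurable_EFinP; apply: measurable_funM => //; exact: measurable_indic.
    - by move=> y _; rewrite lee_fin mulrC ler_wpM2r.
  by rewrite integral_scale_indic// lte_mul_pinfty.
rewrite -(fineK int_fin) lee_fin.
apply: (@le_trans _ _ (K * fine (mu E) `^ fine p^-1 *
    fine (nu F) `^ fine (hoelder_conjugate q)^-1)); last first.
  by rewrite ler_wpM2r ?powR_ge0// ler_wpM2r ?powR_ge0// ler_norm.
rewrite -lee_fin; apply: le_trans HKb; rewrite lee_fin.
apply: le_trans (Re_le_cmod _); rewrite /cintegral/= /Rintegral.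
under [in leRHS]eq_integral do rewrite hE.
exact: ler_norm.
Qed.

Lemma indicator_bound_of_restricted (p q : \bar R) :
  extension_restricted_weak_type beta p q ->
  exists2 K : R, 0 <= K &
    indicator_bound K (fine p^-1) (1 - fine (hoelder_conjugate q)^-1).
Proof.
move=> [K HK]; exists (`|K| + `|K|); first by rewrite addr_ge0.
move=> E F f mE Ec _ mF Foo _ mf fE.
have bf := bounded_meas_indic mf fE.
have [mr mi] := measurable_extension beta bf.
have H1 := component_bound (c := 1) HK.
have H2 := component_bound (c := Complex 0 (-1)) HK.
have c1 : cmod (1 : C) = 1 by rewrite cmodE/= expr0n/= addr0 expr1n sqrtr1.
have c2 : cmod (Complex 0 (-1) : C) = 1.
  by rewrite cmodE/= expr0n/= add0r sqrrN expr1n sqrtr1.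
move/(_ E F f c1 mE Ec mF Foo mf fE) : H1.
move/(_ E F f c2 mE Ec mF Foo mf fE) : H2.
under eq_integral do rewrite ReM/= mulr0 sub0r mulrN1 opprK.
move=> H2.
under eq_integral do rewrite mulr1.
move=> H1.
have mRe : measurable_fun setT (fun y => (\1_F y * `|complex.Re (ext f y)|)%:E).
  apply/measurable_EFinP; apply: measurable_funM; first exact: measurable_indic.
  exact: measurableT_comp.
have mIm : measurable_fun setT (fun y => (\1_F y * `|complex.Im (ext f y)|)%:E).
  apply/measurable_EFinP; apply: measurable_funM; first exact: measurable_indic.
  exact: measurableT_comp.
rewrite subKr mulrDl mulrDl EFinD; apply: le_trans (leeD H1 H2).
rewrite -ge0_integralD//.
apply: ge0_le_integral => //.
- by move=> y _; rewrite lee_fin mulr_ge0// cmod_ge0.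
- exact: measurable_indic_cmod_ext.
- exact: emeasurable_funD.
- by move=> y _; rewrite -EFinD lee_fin -mulrDr ler_wpM2l// cmod_le_ReIm.
Qed.

Lemma cLnorm_le (p : \bar R) (f : X -> C) (A : R) :
  (1 <= p)%E -> 0 <= A -> bounded_meas f ->
  (forall r, p = r%:E -> (\int[mu]_(x in cube) (cmod (f x) `^ r)%:E <= A%:E)%E) ->
  (p = +oo%E -> forall x, cmod (f x) <= 1) ->
  (cLnorm mu cube p f <= (A `^ fine p^-1)%:E)%E.
Proof.
move=> p1 A0 [mf _] Hfin Hinf; rewrite /cLnorm unlock /Lnorm.
move: p p1 Hfin Hinf => [r||//] p1 Hfin Hinf.
- have r0 : 0 < r by rewrite (lt_le_trans ltr01).
  rewrite inver gt_eqF//= -poweR_EFin; apply: gt0_ler_poweR => //.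
  + by rewrite invr_ge0 ltW.
  + by rewrite in_itv/= leey andbT integral_ge0// => x _; exact: poweR_ge0.
  + by rewrite in_itv/= lee_fin A0 leey.
  apply: le_trans (Hfin r erefl).
  rewrite [in leRHS]integral_mkcond le_eqVlt; apply/orP; left; apply/eqP.
  apply: eq_integral => x _; rewrite !patchE; case: ifP => _.
    by rewrite gee0_abs ?lee_fin ?cmod_ge0// poweR_EFin.
  by rewrite abse0 poweR0r// gt_eqF.
rewrite invey/= powRr0; case: ifPn => // _.
apply/ess_supP/nearW => x /=; rewrite patchE; case: ifP => _.
  by rewrite gee0_abs lee_fin ?cmod_ge0// Hinf.
by rewrite abse0.
Qed.

(** For a bounded function, a strong type bound controls the integral of the
    [r]-th power of [ext f] itself, since the extended operator agrees with
    [ext] on bounded functions. *)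
Lemma strong_bound (p : \bar R) (r : R) : (1 <= p)%E -> 1 <= r ->
  extension_strong_type beta p r%:E ->
  exists2 K : R, 0 < K & forall f (S : R), bounded_meas f -> 0 <= S ->
    (cLnorm mu cube p f <= S%:E)%E ->
    (\int[nu]_y (cmod (ext f y) `^ r)%:E <= ((K * S) `^ r)%:E)%E.
Proof.
move=> p1 r1 [T [K [_ HT HTe]]]; exists (`|K| + 1); first by rewrite ltr_wpDl.
move=> f S bf S0 fS.
have r0 : 0 < r by rewrite (lt_le_trans ltr01).
have [mf [M fM]] := bf.
have mfc : cmeasurable_fun cube f.
  by case: mf => mr mi; split; apply: measurable_funTS.
have fp : inLp mu cube p f by split => //; rewrite (le_lt_trans fS)// ltry.
have f1 : inLp mu cube 1%E f.
  split => //.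
  apply: (@le_lt_trans _ _ ((`|M| * 2 ^+ d) `^ fine 1^-1)%:E); last exact: ltry.
  apply: cLnorm_le => //.
  move=> r' [<-].
  apply: (@le_trans _ _ (\int[mu]_(x in cube) `|M|%:E)%E).
    apply: ge0_le_integral => //.
    - exact: measurable_cube.
    - by move=> x _; rewrite lee_fin powR_ge0.
    - apply/measurable_EFinP; apply: (measurableT_comp (measurable_powR _)).
      exact: cmeasurable_cmod.
    - move=> x _; rewrite powRr1 ?cmod_ge0// lee_fin.
      by rewrite (le_trans (fM x))// ler_norm.
  rewrite integral_cst; last exact: measurable_cube.
  by rewrite [X in (_ * X)%E]mu_cube -EFinM.
have [mT nT] := HT f fp; have ae := HTe f f1 fp.
rewrite (@ae_eq_integral _ _ _ _ _ (fun y => (cmod (T f y) `^ r)%:E))//; last 3 first.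
- apply/measurable_EFinP; apply: (measurableT_comp (measurable_powR _)).
  exact/cmeasurable_cmod/measurable_extension.
- apply/measurable_EFinP; apply: (measurableT_comp (measurable_powR _)).
  exact: cmeasurable_cmod.
- by apply: filterS ae => y <-.
have -> : (\int[nu]_y (cmod (T f y) `^ r)%:E)%E =
    (cLnorm nu setT r%:E (T f) `^ r)%E.
  rewrite /cLnorm poweR_Lnorm ?gt_eqF//; apply: eq_integral => y _.
  by rewrite patchT ?inE// gee0_abs ?lee_fin ?cmod_ge0// poweR_EFin.
rewrite -poweR_EFin; apply: gt0_ler_poweR; first exact: ltW.
- by rewrite in_itv/= Lnorm_ge0 leey.
- by rewrite in_itv/= lee_fin mulr_ge0 ?addr_ge0// leey.
apply: (le_trans nT); apply: (@le_trans _ _ (`|K|%:E * S%:E)%E).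
  apply: (@le_trans _ _ (`|K|%:E * cLnorm mu cube p f)%E).
    by rewrite lee_wpmul2r ?Lnorm_ge0// lee_fin ler_norm.
  by rewrite lee_wpmul2l// lee_fin.
by rewrite -EFinM lee_fin ler_wpM2r// lerDl.
Qed.

(** Integrated over a set of finite measure and optimized in [L], this plays the
    part of Hoelder's inequality, up to the constant 2: above the level [L] the
    power [w ^ r] dominates. *)
Lemma level_split (r L w : R) : 1 <= r -> 0 < L -> 0 <= w ->
  w <= L + L `^ (1 - r) * w `^ r.
Proof.
move=> r1 L0 w0; case: (leP w L) => [wL|Lw].
  by rewrite (le_trans wL)// lerDl mulr_ge0// powR_ge0.
have {}w0 : 0 < w by rewrite (lt_trans L0).
apply: (@le_trans _ _ (L `^ (1 - r) * w `^ r)); last by rewrite lerDr ltW.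
apply: (@le_trans _ _ (w `^ (1 - r) * w `^ r)).
  rewrite -powRD ?subrK ?powRr1//; first exact: ltW.
  by rewrite oner_eq0.
rewrite ler_wpM2r ?powR_ge0// -(opprB r) !powRN lef_pV2 ?posrE ?powR_gt0//.
by rewrite ge0_ler_powR ?nnegrE ?subr_ge0// ltW.
Qed.

Lemma indicator_bound_of_strong (p : \bar R) (r : R) : (1 <= p)%E -> 1 <= r ->
  extension_strong_type beta p r%:E ->
  exists2 K : R, 0 <= K & indicator_bound K (fine p^-1) r^-1.
Proof.
move=> p1 r1 /(strong_bound p1 r1)[K K0 HK]; exists (K + K).
  by rewrite addr_ge0// ltW.
move=> E F f mE Ec E0 mF Foo F0 mf fE.
have bf := bounded_meas_indic mf fE.
have muE := mu_subcube_fin mE Ec.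
have nuF : nu F \is a fin_num by rewrite ge0_fin_numE.
have r0 : 0 < r by rewrite (lt_le_trans ltr01).
set P := fine p^-1; set phi := fine (nu F) in F0 *.
set S := fine (mu E) `^ P.
have S0 : 0 < S by rewrite powR_gt0.
have fS : (cLnorm mu cube p f <= S%:E)%E.
  apply: cLnorm_le => //; first exact: ltW.
    move=> r' pr'; rewrite (fineK muE) -[E]setIT -integral_indic//.
    apply: (@le_trans _ _ (\int[mu]_(x in cube) (\1_E x)%:E)%E).
      apply: ge0_le_integral => //.
      - exact: measurable_cube.
      - by move=> x _; rewrite lee_fin powR_ge0.
      - apply/measurable_EFinP; apply: (measurableT_comp (measurable_powR _)).
        by apply: measurable_funTS; exact: cmeasurable_cmod.
      - by apply/measurable_EFinP; exact: measurable_indic.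
      move=> x _; rewrite lee_fin.
      have : 0 < r' by move: p1; rewrite pr' lee_fin; apply: lt_le_trans.
      move=> r'0; have := fE x; rewrite indicE; case: (x \in E) => /= fx.
        apply: (@le_trans _ _ (1 `^ r')); last by rewrite powR1.
        by rewrite ge0_ler_powR ?nnegrE ?cmod_ge0// ltW.
      have -> : cmod (f x) = 0 by apply/eqP; rewrite eq_le fx cmod_ge0.
      by rewrite powR0// gt_eqF.
    rewrite !integral_indic//; last exact: measurable_cube.
    by rewrite setIT; apply: le_measure; rewrite ?inE//;
      apply: measurableI => //; exact: measurable_cube.
  by move=> _ x; rewrite (le_trans (fE x))// indicE; case: (x \in E).
have := HK f S bf (ltW S0) fS; set I := (\int[nu]_y _)%E => IX.
(* This level balances the two terms of [level_split] after integration. *)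
pose L := K * S * phi `^ (- r^-1).
have L0 : 0 < L by rewrite !mulr_gt0// powR_gt0.
have m1 : measurable_fun setT (fun y => (L * \1_F y)%:E).
  by apply/measurable_EFinP; apply: measurable_funM => //; exact: measurable_indic.
have m2 : measurable_fun setT (fun y => (cmod (ext f y) `^ r)%:E).
  apply/measurable_EFinP; apply: (measurableT_comp (measurable_powR _)).
  exact/cmeasurable_cmod/measurable_extension.
have m3 := measurable_funeM (L `^ (1 - r))%:E m2.
apply: (@le_trans _ _ (\int[nu]_y ((L * \1_F y)%:E +
    (L `^ (1 - r))%:E * (cmod (ext f y) `^ r)%:E))%E).
  apply: ge0_le_integral => //.
  - by move=> y _; rewrite lee_fin mulr_ge0// cmod_ge0.
  - exact: measurable_indic_cmod_ext.
  - exact: emeasurable_funD.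
  - move=> y _; rewrite -EFinM -EFinD lee_fin indicE; case: (y \in F) => /=.
      by rewrite mul1r mulr1 level_split// cmod_ge0.
    by rewrite mul0r mulr0 add0r mulr_ge0 ?powR_ge0.
rewrite ge0_integralD//; last 2 first.
- by move=> y _; rewrite lee_fin mulr_ge0// ltW.
- by move=> y _; rewrite -EFinM lee_fin mulr_ge0 ?powR_ge0.
rewrite (integral_scale_indic _ (ltW L0) mF) [X in (_ * X + _)%E](esym (fineK nuF)).
have w0 y : setT y -> (0 <= (cmod (ext f y) `^ r)%:E)%E.
  by rewrite lee_fin powR_ge0.
have L1 : (0 <= (L `^ (1 - r))%:E)%E by rewrite lee_fin powR_ge0.
rewrite (ge0_integralZl nu measurableT m2 w0 L1).
apply: (@le_trans _ _ (L * phi + L `^ (1 - r) * (K * S) `^ r)%:E).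
  rewrite EFinD (EFinM L) (EFinM (L `^ _)).
  by apply: leeD2l; exact: lee_wpmul2l L1 _ _ IX.
rewrite lee_fin -/P -/S.
have phiN0 : phi != 0 by rewrite gt_eqF.
have LN0 : L != 0 by rewrite gt_eqF.
have Lphi : L * phi = K * S * phi `^ (1 - r^-1).
  rewrite /L -[LHS]mulrA addrC powRD ?phiN0 ?implybT//.
  by rewrite (powRr1 (ltW F0)).
have -> : L `^ (1 - r) * (K * S) `^ r = L * phi.
  have KS : K * S = L * phi `^ r^-1.
    by rewrite /L -[RHS]mulrA -powRD ?phiN0 ?implybT// addNr powRr0 mulr1.
  rewrite KS (powRM _ (ltW L0) (powR_ge0 _ _)) -powRrM mulVf ?gt_eqF//.
  rewrite (powRr1 (ltW F0)) mulrA -powRD ?LN0 ?implybT//.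
  by rewrite subrK (powRr1 (ltW L0)).
by rewrite Lphi -!mulrDl.
Qed.

End operator_bounds.
(** * Averaging over signs, and wave packets *)

Section packets.
Variables (R : realType) (d : nat) (beta : 'I_d -> R).
Local Notation C := R[i].
Local Notation RR := (measurableTypeR R).
Local Notation X := (Rn R d).
Local Notation Y := (RR * Rn R d)%type.
Local Notation mu := (lebesgueRn R d).
Local Notation nu := (lebesgue_measure \x lebesgueRn R d)%E.
Local Notation ext := (extension beta).
Local Notation cube := (@Defs.cube R d).

Definition square_function (I : finType) (z : I -> C) : R :=
  Num.sqrt (\sum_i cmod (z i) ^+ 2).

Lemma khintchine_complex (I : finType) : exists signs : seq {ffun I -> bool},
  (0 < size signs)%N /\ forall z : I -> C,
    (size signs)%:R * (5 / 18 * square_function z) <=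
    \sum_(e <- signs) cmod (\sum_i (-1) ^+ e i * z i).
Proof.
have [ss [ss0 H]] := khintchine R I; exists ss; split => // z.
have HR := H (fun i => complex.Re (z i)).
have HI := H (fun i => complex.Im (z i)).
set vR := \sum_i _ in HR; set vI := \sum_i _ in HI.
have vR0 : 0 <= vR by apply: sumr_ge0 => i _; exact: sqr_ge0.
have vI0 : 0 <= vI by apply: sumr_ge0 => i _; exact: sqr_ge0.
have sq : square_function z <= Num.sqrt vR + Num.sqrt vI.
  rewrite /square_function (_ : \sum_i _ = vR + vI); last first.
    by rewrite -big_split/=; apply: eq_bigr => i _; rewrite sqr_cmod.
  rewrite -(ler_pXn2r (n := 2))// ?nnegrE ?addr_ge0 ?sqrtr_ge0//.
  rewrite sqr_sqrtr ?addr_ge0// sqrrD !sqr_sqrtr// lerD2r lerDl.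
  by rewrite mulrn_wge0// mulr_ge0 ?sqrtr_ge0.
have sR : \sum_(e <- ss) `|\sum_i (-1) ^+ e i * complex.Re (z i)| <=
    \sum_(e <- ss) cmod (\sum_i (-1) ^+ e i * z i).
  by apply: ler_sum => e _; rewrite -Re_sign_sum Re_le_cmod.
have sI : \sum_(e <- ss) `|\sum_i (-1) ^+ e i * complex.Im (z i)| <=
    \sum_(e <- ss) cmod (\sum_i (-1) ^+ e i * z i).
  by apply: ler_sum => e _; rewrite -Im_sign_sum Im_le_cmod.
have := le_trans HR sR; have := le_trans HI sI.
set S := \sum_(e <- ss) _; set n := (size ss)%:R => h1 h2.
have : n * (5 / 18 * square_function z) <=
    n * (5 / 18 * (Num.sqrt vR + Num.sqrt vI)).
  by rewrite ler_wpM2l// ler_wpM2l// divr_ge0.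
by move=> /le_trans; apply; lra.
Qed.

(** Some choice of signs does at least as well as the average, so a bound that
    is uniform in the signs passes to the square function. *)
Lemma square_function_bound (I : finType) (f : I -> X -> C) (W : Y -> R) (B : R) :
  (forall i, bounded_meas (f i)) -> measurable_fun setT W -> (forall y, 0 <= W y) ->
  (forall e : {ffun I -> bool},
    (\int[nu]_y (W y * cmod (ext (fun xi => \sum_i (-1) ^+ e i * f i xi)%R y))%:E
      <= B%:E)%E) ->
  (\int[nu]_y (W y * (5 / 18 * square_function (fun i => ext (f i) y)))%:E
    <= B%:E)%E.
Proof.
move=> bf mW W0 HB; have [ss [ss0 H]] := khintchine_complex I.
have mext i := measurable_extension beta (bf i).
have msq : measurable_fun setT
    (fun y => (W y * (5 / 18 * square_function (fun i => ext (f i) y)))%:E).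
  apply/measurable_EFinP; apply: measurable_funM => //.
  apply: measurable_funM => //; apply: (measurableT_comp (@measurable_sqrt R)).
  by apply: measurable_sum => i; apply: measurable_funX; exact: cmeasurable_cmod.
have msum (e : {ffun I -> bool}) : measurable_fun setT
    (fun y => (W y * cmod (\sum_i (-1) ^+ e i * ext (f i) y))%:E).
  apply/measurable_EFinP; apply: measurable_funM => //; apply: cmeasurable_cmod.
  split.
    under eq_fun do rewrite Re_sign_sum.
    apply: measurable_sum => i; apply: measurable_funM => //.
    by case: (mext i).
  under eq_fun do rewrite Im_sign_sum.
  apply: measurable_sum => i; apply: measurable_funM => //.
  by case: (mext i).
set n : R := (size ss)%:R.
have n0 : 0 < n by rewrite ltr0n.
rewrite -(@lee_pmul2l _ n%:E)// ?lte_fin//.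
rewrite -ge0_integralZl//; last 2 first.
- by move=> y _; rewrite lee_fin mulr_ge0// mulr_ge0// sqrtr_ge0.
- by rewrite lee_fin ltW.
apply: (@le_trans _ _ (\sum_(e <- ss)
   \int[nu]_y (W y * cmod (\sum_i (-1) ^+ e i * ext (f i) y))%:E)%E).
  rewrite -ge0_integral_sum//; last first.
    by move=> e y _; rewrite lee_fin mulr_ge0// cmod_ge0.
  apply: ge0_le_integral => //.
  - move=> y _; rewrite -EFinM lee_fin; apply: mulr_ge0; first exact: ltW.
    by rewrite mulr_ge0// mulr_ge0// sqrtr_ge0.
  - exact: measurable_funeM.
  - exact: emeasurable_sum.
  - by move=> y _; rewrite sumEFin -EFinM lee_fin -mulr_sumr mulrCA ler_wpM2l.
rewrite -EFinM (_ : n * B = \sum_(e <- ss) B); last first.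
  by rewrite big_const_seq count_predT iter_addr addr0 -[RHS]mulr_natl.
rewrite -sumEFin; apply: lee_sum => e _.
under eq_integral => y _ do rewrite -extension_sign_sum//.
exact: HB.
Qed.

(** Functions with essentially disjoint supports inside [E] may be given
    arbitrary signs; where their extensions have square function at least [A],
    the indicator inequality is tested with the full strength of [A]. *)
Lemma indicator_bound_level (K P s : R) (I : finType) (f : I -> X -> C)
    (E : set X) (F : set Y) (A : R) :
  0 <= K -> 0 < s -> 0 <= A -> indicator_bound beta K P s ->
  (forall i, cmeasurable_fun setT (f i)) ->
  measurable E -> E `<=` cube -> 0 < fine (mu E) ->
  (forall x, \sum_i cmod (f i x) <= \1_E x) ->
  measurable F -> (nu F < +oo)%E ->
  (forall y, F y -> A <= square_function (fun i => ext (f i) y)) ->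
  5 / 18 * A * fine (nu F) `^ s <= K * fine (mu E) `^ P.
Proof.
move=> K0 s0 A0 HK mf mE Ec E0 fE mF Foo FA.
have nuF : nu F \is a fin_num by rewrite ge0_fin_numE.
set phi := fine (nu F).
have phi_ge0 : 0 <= phi by exact: fine_ge0.
have [phi0|phi0] : phi = 0 \/ 0 < phi.
  by move: phi_ge0; rewrite le_eqVlt => /orP[/eqP|]; [left|right].
  by rewrite phi0 powR0 ?gt_eqF// mulr0 mulr_ge0// powR_ge0.
have fiE i x : cmod (f i x) <= \1_E x.
  apply: le_trans (fE x); rewrite (bigD1 i)//= lerDl.
  by apply: sumr_ge0 => j _; exact: cmod_ge0.
have bf i : bounded_meas (f i) := bounded_meas_indic (mf i) (fiE i).
have := @square_function_bound _ f (\1_F)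
  (K * fine (mu E) `^ P * phi `^ (1 - s)) bf (measurable_indic mF).
move=> /(_ (fun y => ltac:(by rewrite indicE))) H.
have {}H : (\int[nu]_y (\1_F y * (5 / 18 *
    square_function (fun i => ext (f i) y)))%:E
    <= (K * fine (mu E) `^ P * phi `^ (1 - s))%:E)%E.
  apply: H => e; apply: HK => //.
    split.
      under eq_fun do rewrite Re_sign_sum.
      by apply: measurable_sum => i; apply: measurable_funM => //; case: (mf i).
    under eq_fun do rewrite Im_sign_sum.
    by apply: measurable_sum => i; apply: measurable_funM => //; case: (mf i).
  move=> x; apply: le_trans (fE x); apply: le_trans (cmod_sum _ _) _.
  by apply: ler_sum => i _; rewrite cmod_sign.
have {}H : (\int[nu]_y (5 / 18 * A * \1_F y)%:E
    <= (K * fine (mu E) `^ P * phi `^ (1 - s))%:E)%E.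
  apply: le_trans H; apply: ge0_le_integral => //.
  - by move=> y _; rewrite lee_fin !mulr_ge0.
  - by apply/measurable_EFinP; apply: measurable_funM => //; exact: measurable_indic.
  - apply/measurable_EFinP; apply: measurable_funM; first exact: measurable_indic.
    apply: measurable_funM => //; apply: (measurableT_comp (@measurable_sqrt R)).
    apply: measurable_sum => i; apply: measurable_funX.
    by apply: cmeasurable_cmod; exact: measurable_extension.
  - move=> y _; rewrite lee_fin [leLHS]mulrC indicE.
    case: (boolP (y \in F)) => [yF|_]; last by rewrite !mul0r.
    by rewrite !mul1r ler_wpM2l//; apply: FA; rewrite inE in yF.
have c0 : 0 <= 5 / 18 * A by rewrite mulr_ge0.
move: H; rewrite (integral_scale_indic _ c0 mF) [X in (_ * X)%E](esym (fineK nuF)).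
rewrite -EFinM lee_fin -/phi => H.
rewrite -(ler_pM2r (powR_gt0 (1 - s) phi0)) -[leLHS]mulrA -powRD; last first.
  by rewrite (gt_eqF phi0) implybT.
by rewrite subrKC powRr1// ltW.
Qed.

End packets.

Section wave_packets.
Variables (R : realType) (d : nat) (beta : 'I_d -> R).
Local Notation C := R[i].
Local Notation RR := (measurableTypeR R).
Local Notation X := (Rn R d).
Local Notation Y := (RR * Rn R d)%type.
Local Notation mu := (lebesgueRn R d).
Local Notation ext := (extension beta).
Local Notation cube := (@Defs.cube R d).

(** Modulating by [c] translates the extension, so that it concentrates near the
    position [c] at time 0. *)
Definition packet (a l c : 'I_d -> R) (xi : X) : C :=
  Complex (\1_(box a l) xi) 0 * cis (- \sum_j c j * (tnth xi j : R)).

Lemma cmod_packet a l c xi : cmod (packet a l c xi) = \1_(box a l) xi.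
Proof. by rewrite cmodM cmod_cis mulr1 cmod_real ger0_norm. Qed.

Lemma cmeasurable_packet a l c : cmeasurable_fun setT (packet a l c).
Proof.
have mi : measurable_fun setT (\1_(box a l) : X -> R).
  by apply: measurable_indic; exact: measurable_box.
have mp : measurable_fun setT (fun xi : X => - \sum_j c j * (tnth xi j : R)).
  apply: measurable_funN; apply: measurable_sum => j.
  by apply: measurable_funM => //; exact: measurable_tnth.
split.
  under eq_fun do rewrite /packet ReM/= mul0r subr0.
  by apply: measurable_funM => //; apply: (measurableT_comp (@measurable_cos R)).
under eq_fun do rewrite /packet ImM/= mul0r addr0.
by apply: measurable_funM => //; apply: (measurableT_comp (@measurable_sin R)).
Qed.

Lemma bounded_meas_packet a l c : bounded_meas (packet a l c).
Proof.
split; first exact: cmeasurable_packet.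
by exists 1 => xi; rewrite cmod_packet indicE; case: (_ \in _).
Qed.

Lemma cisD (u v : R) : cis (u + v) = cis u * cis v :> C.
Proof.
apply/eqP; rewrite eq_complex ReM ImM /= cosD sinD eqxx /=.
by rewrite [X in X == _]addrC.
Qed.

Lemma box_sub_cube a l : (forall j, 0 <= a j) -> (forall j, a j + l j <= 1) ->
  box a l `<=` cube.
Proof.
move=> a0 al xi /= xij j; have /andP[h1 h2] := xij j.
have := a0 j; have := al j => h3 h4; apply/andP; split; lra.
Qed.

Lemma Re_extension_rotate f y (u : R) : bounded_meas f ->
  complex.Re (ext f y * cis u) =
  (\int[mu]_(xi in cube) complex.Re (kernel beta f y xi * cis u))%R.
Proof.
move=> bf; have mc := @measurable_cube R d.
have iR := integrable_Re_kernel beta y bf; have iI := integrable_Im_kernel beta y bf.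
rewrite ReM /cis /=.
transitivity ((\int[mu]_(xi in cube) (complex.Re (kernel beta f y xi) * cos u))%R -
  (\int[mu]_(xi in cube) (complex.Im (kernel beta f y xi) * sin u))%R).
  by rewrite !RintegralZr.
rewrite -RintegralB//.
- by apply: eq_Rintegral => xi _; rewrite [RHS]ReM.
- exact: (integrableZr mc _ iR).
- exact: (integrableZr mc _ iI).
Qed.

(** On its box the modulated phase stays within 1 of its value at the corner
    [a], so after rotation the integrand has real part at least 1/2. *)
Lemma packet_lower_bound (a l c : 'I_d -> R) (y : Y) :
  (forall j, 0 <= a j) -> (forall j, 0 <= l j) -> (forall j, a j + l j <= 1) ->
  (forall j u, a j < u < a j + l j ->
     d%:R * `|(y.1 : R) * (u `^ beta j - a j `^ beta j) +
       ((tnth y.2 j : R) - c j) * (u - a j)| <= 1) ->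
  (\prod_j l j) / 2 <= cmod (ext (packet a l c) y).
Proof.
move=> a0 l0 al Hy; have bf := bounded_meas_packet a l c.
pose th := (y.1 : R) * (\sum_j a j `^ beta j) + \sum_j ((tnth y.2 j : R) - c j) * a j.
have -> : cmod (ext (packet a l c) y) = cmod (ext (packet a l c) y * cis (- th)).
  by rewrite cmodM cmod_cis mulr1.
apply: le_trans (le_trans (ler_norm _) (Re_le_cmod _)).
rewrite Re_extension_rotate//.
have mb := measurable_box a l; have mc := @measurable_cube R d.
have kE xi : complex.Re (kernel beta (packet a l c) y xi * cis (- th)) =
    \1_(box a l) xi * cos (phase beta y xi - \sum_j c j * (tnth xi j : R) - th).
  rewrite /kernel /packet mulrCA -mulrA -mulrA -!cisD ReM/= mul0r subr0.
  by rewrite addrA.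
have imb : mu.-integrable cube (EFin \o (fun xi => \1_(box a l) xi / 2)).
  apply: (@integrable_bounded _ _ _ 1) => [|x].
    by apply: measurable_funM => //; exact: measurable_indic.
  rewrite indicE; case: (x \in _); rewrite ?mul0r ?normr0// mul1r ger0_norm//.
  by rewrite invf_le1// ler1n.
have <- : (\int[mu]_(xi in cube) (\1_(box a l) xi / 2))%R = (\prod_j l j) / 2.
  rewrite RintegralZr//; last first.
    apply: (@integrable_bounded _ _ _ 1) => [|x]; first exact: measurable_indic.
    by rewrite indicE; case: (x \in _); rewrite ?normr0 ?normr1.
  congr (_ / 2); rewrite /Rintegral integral_indic// setIidl; last first.
    exact: box_sub_cube.
  by rewrite [X in fine X]mu_box.
apply: le_Rintegral => //.
  apply: (@integrable_bounded _ _ _ 1) => [|x]; last first.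
    rewrite (le_trans (Re_le_cmod _))// cmodM cmod_cis mulr1 cmod_kernel.
    by rewrite cmod_packet indicE; case: (_ \in _).
  have [mr mi] := measurable_kernel beta (cmeasurable_packet a l c).
  under eq_fun do rewrite ReM/=.
  by apply: measurable_funB; apply: measurable_funM => //;
    [exact: measurable_fun_pair2 mr|exact: measurable_fun_pair2 mi].
move=> xi _; rewrite kE indicE; case: (boolP (xi \in box a l)); last by rewrite !mul0r.
rewrite inE => xib; rewrite !mul1r; apply: cos_ge_half.
rewrite /phase /g_beta /th.
rewrite (_ : _ - _ = \sum_j ((y.1 : R) * ((tnth xi j : R) `^ beta j - a j `^ beta j) +
       ((tnth y.2 j : R) - c j) * ((tnth xi j : R) - a j))); last first.
  rewrite big_split/= -mulr_sumr sumrB.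
  rewrite [X in _ = _ + X](_ : _ = \sum_j (tnth y.2 j : R) * (tnth xi j : R) -
    \sum_j c j * (tnth xi j : R) - \sum_j ((tnth y.2 j : R) - c j) * a j); last first.
    by rewrite -!sumrB; apply: eq_bigr => j _; ring.
  rewrite (eq_bigr (fun j => (tnth xi j : R) `^ beta j)); last first.
    move=> j _; rewrite ger0_norm//; have /andP[h _] := xib j.
    by rewrite (le_trans (a0 j))// ltW.
  ring.
have [d0|d0] := posnP d.
  rewrite big1 ?normr0// => j _; exfalso.
  by have := ltn_ord j; rewrite {2}d0.
apply: le_trans (ler_norm_sum _ _ _) _.
rewrite -(ler_pM2l (_ : 0 < d%:R :> R)) ?ltr0n// mulr1 mulr_sumr.
apply: (@le_trans _ _ (\sum_(j < d) 1)); first by apply: ler_sum => j _; exact: Hy.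
by rewrite sumr_const card_ord.
Qed.

End wave_packets.

(** * Phase estimates in one variable *)

Section phase_estimates.
Variable R : realType.
Implicit Types a b u t x c z k : R.

Lemma powR_mvt a u b : 0 < a -> a < u ->
  exists2 w, a < w < u & u `^ b - a `^ b = b * w `^ (b - 1) * (u - a).
Proof.
move=> a0 au.
have df x : x \in `]a, u[ -> is_derive x 1 (fun x => x `^ b) (b * x `^ (b - 1)).
  rewrite in_itv/= => /andP[ax _].
  by apply: is_derive1_powR; exact: lt_trans ax.
have cf : {within `[a, u], continuous (fun x : R => x `^ b)}.
  apply: derivable_within_continuous => x; rewrite in_itv/= => /andP[ax _].
  by apply: derivable_powR; rewrite in_itv/= andbT (lt_le_trans a0).
have [w + ->] := MVT au df cf.
by rewrite in_itv/= => waw; exists w.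
Qed.

Definition speed b a := b * a `^ (b - 1).

Lemma speed_lipschitz b a u : 1 < b -> 2^-1 <= a -> a <= u -> u <= 1 ->
  0 <= speed b u - speed b a <= 2 * b ^+ 2 * (u - a).
Proof.
move=> b1 a2 au u1; rewrite /speed -mulrBr.
have a0 : 0 < a by rewrite (lt_le_trans _ a2)// invr_gt0.
have b0 : 0 < b by rewrite (lt_trans ltr01).
move: au; rewrite le_eqVlt => /orP[/eqP <-|au]; first by rewrite !subrr !mulr0 lexx.
have [w /andP[aw wu] ->] := powR_mvt (b - 1) a0 au.
have w0 : 0 < w by rewrite (lt_trans a0).
have w1 : w <= 1 by rewrite ltW// (lt_le_trans wu).
have hw : w `^ (b - 1 - 1) <= 2.
  have -> : w `^ (b - 1 - 1) = w `^ (b - 1) / w.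
    by rewrite powRB ?(gt_eqF w0) ?implybT// (powRr1 (ltW w0)).
  rewrite ler_pdivrMr//.
  apply: (@le_trans _ _ (w `^ 0)).
    by apply: ger_powR; rewrite ?w0//= subr_ge0 ltW.
  rewrite powRr0; have : 2^-1 < w by rewrite (le_lt_trans a2).
  lra.
have p0 := powR_ge0 w (b - 1 - 1).
have ua : 0 < u - a by rewrite subr_gt0.
apply/andP; split.
  apply: mulr_ge0; first exact: ltW.
  apply: mulr_ge0; last exact: ltW.
  by apply: mulr_ge0 => //; rewrite subr_ge0 ltW.
rewrite mulrA ler_pM2r// expr2 (_ : 2 * (b * b) = b * (b * 2)); last by ring.
rewrite ler_pM2l//; apply: ler_pM => //; first by rewrite subr_ge0 ltW.
by rewrite gerBl.
Qed.

Lemma powR_taylor b a u : 1 < b -> 2^-1 <= a -> a <= u -> u <= 1 ->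
  `|u `^ b - a `^ b - speed b a * (u - a)| <= 2 * b ^+ 2 * (u - a) ^+ 2.
Proof.
move=> b1 a2 au u1.
have a0 : 0 < a by rewrite (lt_le_trans _ a2)// invr_gt0.
move: au; rewrite le_eqVlt => /orP[/eqP <-|au].
  by rewrite !subrr mulr0 subr0 normr0 expr0n mulr0.
have [w /andP[aw wu] ->] := powR_mvt b a0 au.
rewrite -/(speed b w) -mulrBl.
have w1 : w <= 1 by rewrite ltW// (lt_le_trans wu).
have /andP[h1 h2] := speed_lipschitz b1 a2 (ltW aw) w1.
have ua : 0 < u - a by rewrite subr_gt0.
rewrite normrM (gtr0_norm ua) ger0_norm// (expr2 (u - a)) [leRHS]mulrA ler_pM2r//.
apply: (le_trans h2); apply: ler_wpM2l; last by rewrite lerD2r ltW.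
by rewrite mulr_ge0// sqr_ge0.
Qed.

Lemma short_phase b k z t x c u : 1 < b -> 0 < k -> 2 * k <= 1 -> 0 < z ->
  0 <= t <= z -> `|x - c| <= z `^ b^-1 ->
  k * z `^ (- b^-1) < u < k * z `^ (- b^-1) + k * z `^ (- b^-1) ->
  `|t * (u `^ b - (k * z `^ (- b^-1)) `^ b) +
    (x - c) * (u - k * z `^ (- b^-1))| <= 3 * k.
Proof.
move=> b1 k0 k2 z0 /andP[t0 tz] xc; set a := k * _ => /andP[au ua].
have b0 : 0 < b by rewrite (lt_trans ltr01).
have p0 : 0 < z `^ (- b^-1) by rewrite powR_gt0.
have a0 : 0 < a by rewrite mulr_gt0.
have u0 : 0 < u by rewrite (lt_trans a0).
apply: (le_trans (ler_normD _ _)); rewrite (_ : 3 * k = 2 * k + k); last by ring.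
have hu : u `^ b <= 2 * k * z^-1.
  apply: (@le_trans _ _ ((2 * k * z `^ (- b^-1)) `^ b)).
    apply: ge0_ler_powR; rewrite ?nnegrE; [exact: ltW|exact: ltW| |].
      by rewrite mulr_ge0// ?mulr_ge0// ltW.
    by apply: ltW; rewrite (lt_le_trans ua)// /a; lra.
  rewrite (powRM _ (_ : 0 <= 2 * k) (ltW p0)); last by rewrite mulr_ge0// ltW.
  rewrite -powRrM mulNr mulVf ?gt_eqF// (powR_inv1 (ltW z0)) ler_pM2r ?invr_gt0//.
  by apply: ge1r_powR; rewrite ?k2 ?mulr_gt0// ltW.
have hd : 0 <= u `^ b - a `^ b <= 2 * k * z^-1.
  apply/andP; split.
    by rewrite subr_ge0; apply: ge0_ler_powR; rewrite ?nnegrE; exact: ltW.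
  by rewrite (le_trans _ hu)// gerBl powR_ge0.
move/andP: hd => [d0 d1]; apply: lerD.
  rewrite normrM !ger0_norm//.
  apply: (@le_trans _ _ (z * (2 * k * z^-1))); first exact: ler_pM.
  by rewrite mulrCA divff ?gt_eqF// mulr1.
rewrite normrM (gtr0_norm (_ : 0 < u - a)) ?subr_gt0//.
apply: (@le_trans _ _ (z `^ b^-1 * a)).
  apply: ler_pM => //; first by rewrite subr_ge0 ltW.
  by rewrite lerBlDr ltW.
by rewrite /a mulrCA -powRD ?(gt_eqF z0) ?implybT// subrr powRr0 mulr1.
Qed.

Lemma curved_phase b k z t x c a u : 1 < b -> 0 < k -> k <= 1 -> 0 < z ->
  2^-1 <= a -> a + k * z `^ (- 2^-1) <= 1 ->
  0 <= t <= z -> `|x - (c - t * speed b a)| <= z `^ 2^-1 ->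
  a < u < a + k * z `^ (- 2^-1) ->
  `|t * (u `^ b - a `^ b) + (x - c) * (u - a)| <= (2 * b ^+ 2 + 1) * k.
Proof.
move=> b1 k0 k1 z0 a2 a1 /andP[t0 tz] xc /andP[au ua].
have p0 : 0 < z `^ (- 2^-1) by rewrite powR_gt0.
have u1 : u <= 1 by rewrite (le_trans (ltW ua)).
have uak : 0 <= u - a <= k * z `^ (- 2^-1).
  by rewrite subr_ge0 ltW//= lerBlDl ltW.
move/andP: uak => [ua0 uak].
rewrite (_ : _ + _ = t * (u `^ b - a `^ b - speed b a * (u - a)) +
  (x - (c - t * speed b a)) * (u - a)); last by ring.
apply: (le_trans (ler_normD _ _)); rewrite [leRHS]mulrDl mul1r; apply: lerD.
  rewrite normrM (ger0_norm t0).
  apply: (@le_trans _ _ (z * (2 * b ^+ 2 * (k * z `^ (- 2^-1)) ^+ 2))).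
    apply: ler_pM => //; apply: le_trans (powR_taylor b1 a2 (ltW au) u1) _.
    apply: ler_wpM2l; first by rewrite mulr_ge0// sqr_ge0.
    rewrite ler_pXn2r ?nnegrE//.
    by apply: mulr_ge0; exact: ltW.
  have zz : (z `^ (- 2^-1)) ^+ 2 = z^-1.
    rewrite -(powR_mulrn 2 (ltW p0)) -powRrM (_ : - 2^-1 * 2%:R = -1); last by field.
    by rewrite (powR_inv1 (ltW z0)).
  rewrite exprMn zz (_ : z * _ = 2 * b ^+ 2 * k ^+ 2 * (z / z)); last by ring.
  rewrite divff ?gt_eqF// mulr1.
  apply: ler_wpM2l; first by rewrite mulr_ge0// sqr_ge0.
  by rewrite expr2 ler_piMl// ltW.
rewrite normrM (ger0_norm ua0).
apply: (@le_trans _ _ (z `^ 2^-1 * (k * z `^ (- 2^-1)))); first exact: ler_pM.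
by rewrite mulrCA -powRD ?(gt_eqF z0) ?implybT// subrr powRr0 mulr1.
Qed.

End phase_estimates.

(** * Packets adapted to the phase, and the Knapp example *)

Section adapted_packets.
Variables (R : realType) (d : nat) (beta : 'I_d -> R).
Hypothesis beta_gt1 : forall j, 1 < beta j.
Local Notation C := R[i].
Local Notation RR := (measurableTypeR R).
Local Notation X := (Rn R d).
Local Notation Y := (RR * Rn R d)%type.
Local Notation mu := (lebesgueRn R d).
Local Notation nu := (lebesgue_measure \x lebesgueRn R d)%E.
Local Notation ext := (extension beta).
Local Notation cube := (@Defs.cube R d).

(** A box with sides [z ^ - weight n j] is the largest on which the phase at
    time [z] stays essentially linear: the first [n] coordinates sit near the
    flat point 0, the others where the second derivative is of order one. *)
Definition weight (n : nat) (j : 'I_d) : R := if (j < n)%N then (beta j)^-1 else 2^-1.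

Definition side (k z : R) (n : nat) (j : 'I_d) : R := k * z `^ (- weight n j).

Definition radius (z : R) (n : nat) (j : 'I_d) : R := z `^ weight n j.

Definition total_weight (n : nat) : R := \sum_j weight n j.

Lemma sum_half n : (n <= d)%N ->
  \sum_(j < d | ~~ (j < n)%N) (2^-1 : R) = (d - n)%:R / 2.
Proof.
move=> nd; rewrite -(big_mkord (fun j => ~~ (j < n)%N) (fun=> 2^-1)).
rewrite (@big_cat_nat _ _ _ n)//=.
rewrite big_nat_cond big1 ?add0r; last by move=> i; lia.
rewrite big_nat_cond (eq_bigl (fun i => (n <= i < d)%N && true)); last first.
  by move=> i; rewrite -leqNgt; case: (n <= i)%N; rewrite ?andbT.
by rewrite -big_nat_cond sumr_const_nat -[LHS]mulr_natl.
Qed.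

Lemma total_weightE n : (n <= d)%N ->
  total_weight n = J beta n + (d - n)%:R / 2.
Proof.
move=> nd; rewrite /total_weight /J (bigID (fun j : 'I_d => (j < n)%N))/=.
congr (_ + _); first by apply: eq_bigr => j jn; rewrite /weight jn.
by rewrite -sum_half//; apply: eq_bigr => j /negbTE jn; rewrite /weight jn.
Qed.

Lemma weight_gt0 n j : 0 < weight n j.
Proof.
by rewrite /weight; case: ifP => _; rewrite invr_gt0// (lt_trans ltr01).
Qed.

Lemma side_gt0 k z n j : 0 < k -> 0 < z -> 0 < side k z n j.
Proof. by move=> k0 z0; rewrite mulr_gt0// powR_gt0. Qed.

Lemma radius_ge0 z n j : 0 <= radius z n j.
Proof. exact: powR_ge0. Qed.

Lemma prod_powR (I : finType) (P : pred I) (z : R) (w : I -> R) : 0 < z ->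
  \prod_(j | P j) z `^ w j = z `^ (\sum_(j | P j) w j).
Proof.
move=> z0; apply/esym; apply: (big_morph (fun x => z `^ x)).
  by move=> x y; rewrite powRD// (gt_eqF z0) implybT.
exact: powRr0.
Qed.

Lemma prod_side k z n : 0 < z ->
  \prod_j side k z n j = k ^+ d * z `^ (- total_weight n).
Proof.
move=> z0; rewrite big_split/= prodr_const card_ord prod_powR//.
by rewrite sumrN.
Qed.

Lemma nu_radius_tube t0 t1 z n c v : t0 <= t1 -> 0 < z ->
  nu (tube t0 t1 c v (radius z n)) =
  ((t1 - t0) * (2 ^+ d * z `^ total_weight n))%:E.
Proof.
move=> t01 z0; rewrite nu_tube//; last by move=> j; exact: radius_ge0.
by rewrite big_split/= prodr_const card_ord prod_powR.
Qed.

(** Corners [a] of boxes of sides [side], and the velocities [v] of the packets.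
    In a flat coordinate the box starts at distance [side] from 0, which keeps
    boxes of different scales apart; its velocity is negligible. *)
Definition adapted (k z : R) (n : nat) (a v : 'I_d -> R) : Prop :=
  forall j : 'I_d, if (j < n)%N then a j = side k z n j /\ v j = 0
    else 2^-1 <= a j <= 3 / 4 /\ v j = speed (beta j) (a j).

(** Small multiples of the natural sides keep the total phase error below 1. *)
Definition small_enough (k : R) : Prop :=
  [/\ 0 < k, k <= 4^-1 & forall j, d%:R * (2 * beta j ^+ 2 + 3) * k <= 1].

Lemma exists_bound (I : finType) (F : I -> R) : exists2 M, 0 < M & forall i, F i <= M.
Proof.
exists (1 + \sum_i `|F i|); first by rewrite ltr_pwDl// sumr_ge0.
move=> i; rewrite (bigD1 i)//= addrCA (le_trans (ler_norm _))// lerDl.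
by rewrite addr_ge0// sumr_ge0.
Qed.

Lemma exists_small_enough : exists k, small_enough k.
Proof.
have [M M0 HM] := exists_bound (fun j => d%:R * (2 * beta j ^+ 2 + 3)).
exists (4 + M)^-1; have h : 0 < 4 + M by rewrite addr_gt0.
split; first by rewrite invr_gt0.
  by rewrite lef_pV2 ?posrE// lerDl ltW.
by move=> j; rewrite ler_pdivrMr// mul1r (le_trans (HM j))// lerDr.
Qed.

Section one_packet.
Variables (k z : R) (n : nat) (a v c : 'I_d -> R).
Hypothesis k_small : small_enough k.
Hypothesis z1 : 1 <= z.
Hypothesis av : adapted k z n a v.

Let k0 : 0 < k. Proof. by case: k_small. Qed.
Let k4 : k <= 4^-1. Proof. by case: k_small. Qed.
Let z0 : 0 < z. Proof. exact: lt_le_trans z1. Qed.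

Lemma side_le j : side k z n j <= k.
Proof.
rewrite /side ler_piMr//; first exact: ltW.
apply: (@le_trans _ _ (z `^ 0)); last by rewrite powRr0.
by apply: ler_powR => //; rewrite lerNl oppr0 ltW// weight_gt0.
Qed.

Lemma adapted_ge0 j : 0 <= a j.
Proof.
have := av j; case: ifP => _ [].
  by move=> -> _; rewrite ltW// side_gt0.
by move=> /andP[+ _] _; apply: le_trans; rewrite invr_ge0.
Qed.

Lemma adapted_le1 j : a j + side k z n j <= 1.
Proof.
have := av j; have := side_le j; have := k4; case: ifP => _ h1 h2 [].
  by move=> -> _; lra.
by move=> /andP[_ h3] _; lra.
Qed.

Lemma adapted_box_sub : box a (side k z n) `<=` cube.
Proof. by apply: box_sub_cube; [exact: adapted_ge0|exact: adapted_le1]. Qed.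

Lemma packet_on_tube y : tube 0 z c v (radius z n) y ->
  k ^+ d * z `^ (- total_weight n) / 2 <= cmod (ext (packet a (side k z n) c) y).
Proof.
move=> [y1 yj]; rewrite -prod_side//; apply: packet_lower_bound.
- exact: adapted_ge0.
- by move=> j; rewrite ltW// side_gt0.
- exact: adapted_le1.
move=> j u uj; have [_ _ /(_ j) kj] := k_small.
have := av j; have := yj j; rewrite /radius; have := adapted_le1 j.
move: uj; rewrite /side /weight; case: ifP => jn uj aj xj [].
  move=> aE vE; rewrite aE vE mulr0 subr0 in xj uj *.
  have k2 : 2 * k <= 1 by have := k4; lra.
  have := short_phase (beta_gt1 j) k0 k2 z0 y1 xj uj.
  move=> h; apply: le_trans kj; rewrite -mulrA ler_wpM2l// (le_trans h)//.
  by rewrite ler_pM2r// lerDr mulr_ge0// sqr_ge0.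
move=> /andP[a2 _] vE; rewrite vE in xj.
have k1 : k <= 1 by have := k4; lra.
have := curved_phase (beta_gt1 j) k0 k1 z0 a2 aj y1 xj uj.
move=> h; apply: le_trans kj; rewrite -mulrA ler_wpM2l// (le_trans h)//.
by rewrite ler_pM2r// lerD2l ler1n.
Qed.

End one_packet.

Lemma bounded_powR_le0 (e B : R) :
  (forall z, 1 <= z -> z `^ e <= B) -> e <= 0.
Proof.
move=> H; rewrite leNgt; apply/negP => e0.
have B1 : 1 <= `|B| + 1 by rewrite lerDr.
have := H ((`|B| + 1) `^ e^-1); rewrite -powRrM mulVf ?gt_eqF//.
rewrite powRr1; last by rewrite (le_trans ler01).
move=> h; have : `|B| + 1 <= B.
  apply: h; apply: (@le_trans _ _ ((`|B| + 1) `^ 0)); first by rewrite powRr0.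
  by apply: ler_powR => //; rewrite invr_ge0 ltW.
by have := ler_norm B; lra.
Qed.

(** One packet, tested on its own tube. *)
Lemma knapp (K P s : R) (n : nat) : (0 < d)%N -> 0 <= K -> 0 < s ->
  indicator_bound beta K P s ->
  (1 + total_weight n) * s <= total_weight n * (1 - P).
Proof.
move=> d0 K0 s0 HK; have [k ksm] := exists_small_enough; have [k0 _ _] := ksm.
set A := total_weight n.
pose B := 18 / 5 * 2 * K * (k ^+ d) `^ P / (k ^+ d * (2 ^+ d) `^ s).
rewrite -subr_le0; apply: (@bounded_powR_le0 _ B) => z z1.
have z0 : 0 < z by rewrite (lt_le_trans ltr01).
pose a (j : 'I_d) := if (j < n)%N then side k z n j else 2^-1.
pose v (j : 'I_d) := if (j < n)%N then 0 else speed (beta j) (a j).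
have av : adapted k z n a v.
  by move=> j; rewrite /v /a; case: (j < n)%N; split => //; lra.
pose F := tube 0 z (fun=> 0) v (radius z n).
pose E := box a (side k z n).
have sd j : 0 <= side k z n j by rewrite ltW// side_gt0.
have muE : mu E = (k ^+ d * z `^ (- A))%:E by rewrite mu_box// prod_side.
have nuF : nu F = (2 ^+ d * z `^ (1 + A))%:E.
  rewrite nu_radius_tube ?(ltW z0)// subr0 mulrCA powRD ?(gt_eqF z0) ?implybT//.
  by rewrite (powRr1 (ltW z0)).
have := @indicator_bound_level _ _ beta K P s unit
  (fun=> packet a (side k z n) (fun=> 0)) E F (k ^+ d * z `^ (- A) / 2) K0 s0.
have kd0 : 0 < k ^+ d by rewrite exprn_gt0.
have A0 : 0 <= k ^+ d * z `^ (- A) / 2.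
  by rewrite divr_ge0// mulr_ge0 ?powR_ge0// ltW.
move=> /(_ A0 HK (fun=> cmeasurable_packet _ _ _) (measurable_box _ _)
  (adapted_box_sub ksm z1 av)).
rewrite [X in fine X]muE [X in _ -> _ -> _ -> (X < _)%E -> _]nuF.
rewrite [X in 5 / 18 * _ * fine X `^ s]nuF /=.
have E0 : 0 < k ^+ d * z `^ (- A) by rewrite mulr_gt0// powR_gt0.
move=> /(_ E0).
have fE xi : \sum_(i : unit) cmod (packet a (side k z n) (fun=> 0) xi) <= \1_E xi.
  by rewrite (big_pred1 tt) ?cmod_packet//; case.
move=> /(_ fE (measurable_tube _ _ _ _ _) (ltry _)).
have sq y : F y -> k ^+ d * z `^ (- A) / 2 <=
    square_function (fun _ : unit => ext (packet a (side k z n) (fun=> 0)) y).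
  move=> Fy; rewrite /square_function (big_pred1 tt); last by case.
  by rewrite sqrtr_sqr ger0_norm ?cmod_ge0//; exact: packet_on_tube Fy.
move=> /(_ sq).
set W := z `^ (- A).
rewrite (powRM _ (exprn_ge0 d (ler0n R 2)) (powR_ge0 _ _)) -powRrM.
rewrite (powRM _ (ltW kd0) (powR_ge0 _ _)) -/W -(powRrM z).
set U := z `^ ((1 + A) * s); set V := z `^ (- A * P) => H.
have V0 : 0 < V by rewrite powR_gt0.
have W0 : 0 < W by rewrite powR_gt0.
have -> : z `^ ((1 + A) * s - A * (1 - P)) = W * U / V.
  rewrite /W /U /V -powRD ?(gt_eqF z0) ?implybT// -powRN -powRD.
    by congr (_ `^ _); ring.
  by rewrite (gt_eqF z0) implybT.
rewrite ler_pdivrMr// /B.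
have T0 : 0 < (2 ^+ d : R) `^ s by rewrite powR_gt0// exprn_gt0.
rewrite mulrAC ler_pdivlMr ?mulr_gt0//.
set T := _ `^ s in H T0 *; set Q := _ `^ P in H *.
rewrite (_ : W * U * _ = 36 / 5 * (5 / 18 * (k ^+ d * W / 2) * (T * U))); last by field.
rewrite (_ : _ * V = 36 / 5 * (K * (Q * V))); last by field.
by rewrite ler_pM2l.
Qed.

End adapted_packets.

(** * The endpoint on the scaling line *)

Section scaling_line.
Variables (R : realType) (d : nat) (beta : 'I_d -> R).
Hypothesis beta_gt1 : forall j, 1 < beta j.
Hypothesis d_gt0 : (0 < d)%N.
Local Notation C := R[i].
Local Notation RR := (measurableTypeR R).
Local Notation X := (Rn R d).
Local Notation Y := (RR * Rn R d)%type.
Local Notation mu := (lebesgueRn R d).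
Local Notation nu := (lebesgue_measure \x lebesgueRn R d)%E.
Local Notation ext := (extension beta).
Local Notation cube := (@Defs.cube R d).

Lemma sum_indic_disjoint (T : Type) (I : finType) (A : I -> set T) (x : T) :
  (forall i j, A i x -> A j x -> i = j) ->
  (exists2 i, A i x & forall c : I -> R, \sum_k c k * \1_(A k) x = c i) \/
  (forall c : I -> R, \sum_k c k * \1_(A k) x = 0).
Proof.
move=> dA; have [[i Ai]|nA] := pselect (exists i, A i x).
  left; exists i => // c; rewrite (bigD1 i)//= big1 ?addr0.
    by rewrite indicE mem_set// mulr1.
  move=> j ji; rewrite indicE memNset ?mulr0// => Aj.
  by move: ji; rewrite (dA j i Aj Ai) eqxx.
right => c; apply: big1 => j _; rewrite indicE memNset ?mulr0// => Aj.
by apply: nA; exists j.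
Qed.

Lemma integral_sum_indic dT (T : measurableType dT) (m : {measure set T -> \bar R})
    (I : finType) (A : I -> set T) (c : I -> R) :
  (forall i, 0 <= c i) -> (forall i, measurable (A i)) ->
  (\int[m]_x (\sum_i c i * \1_(A i) x)%:E = \sum_i (c i)%:E * m (A i))%E.
Proof.
move=> c0 mA; under eq_integral do rewrite -sumEFin.
rewrite ge0_integral_sum//.
- by apply: eq_bigr => i _; rewrite integral_scale_indic.
- by move=> i; apply/measurable_EFinP; apply: measurable_funM.
- by move=> i x _; rewrite lee_fin mulr_ge0.
Qed.

Lemma Re_realM (b : R) (w : C) : complex.Re (Complex b 0 * w) = b * complex.Re w.
Proof. by rewrite ReM mul0r subr0. Qed.

Lemma Im_realM (b : R) (w : C) : complex.Im (Complex b 0 * w) = b * complex.Im w.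
Proof. by rewrite ImM mul0r addr0. Qed.

Section construction.
Variables (k P r : R) (N : nat).
Hypothesis k_small : small_enough beta k.
Hypothesis r1 : 1 <= r.

Let j0 : 'I_d := Ordinal d_gt0.
Let k0 : 0 < k. Proof. by case: k_small. Qed.
Let A := total_weight beta d.

(** The ratio is chosen to halve the side of the boxes in the coordinate [j0]. *)
Definition scale (i : nat) : R := (2 `^ beta j0) ^+ i.
Local Notation z := scale.

Lemma ratio_gt2 : 2 < 2 `^ beta j0 :> R.
Proof.
have [w /andP[w1 _]] := powR_mvt (beta j0) ltr01 (ltr1n R 2).
rewrite powR1 (_ : 2 - 1 = 1); last by ring.
move=> h; have : 1 <= w `^ (beta j0 - 1).
  apply: (@le_trans _ _ (w `^ 0)); first by rewrite powRr0.
  by apply: ler_powR; rewrite ?subr_ge0 ltW.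
have := beta_gt1 j0 => b1 w2; rewrite mulr1 in h.
have : beta j0 <= beta j0 * w `^ (beta j0 - 1).
  by rewrite ler_peMr// ltW// (lt_trans ltr01).
lra.
Qed.

Lemma scale_ge1 i : 1 <= z i.
Proof. by rewrite exprn_ege1// ltW// (lt_trans _ ratio_gt2)// ltr1n. Qed.

Lemma scale_gt0 i : 0 < z i.
Proof. exact: lt_le_trans (scale_ge1 i). Qed.

Lemma scale_ltn i i' : (i < i')%N -> z i < z i' / 2.
Proof.
move=> ii'; have : z i.+1 <= z i'.
  by rewrite /z ler_weXn2l// ltW// (lt_trans _ ratio_gt2)// ltr1n.
have := scale_gt0 i; have := ratio_gt2; rewrite /z exprS.
set Q := 2 `^ _; set a := Q ^+ i => Q2 a0.
have : 2 * a < Q * a by rewrite ltr_pM2r.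
lra.
Qed.

Lemma side_scale i : side beta k (z i) d j0 = k * 2 ^- i.
Proof.
rewrite /side /weight ltn_ord; congr (_ * _).
have -> : z i = 2 `^ (beta j0 * i%:R) by rewrite powRrM powR_mulrn// powR_ge0.
rewrite -powRrM (_ : beta j0 * i%:R * - (beta j0)^-1 = - i%:R); first by rewrite powR_invn.
by field; rewrite gt_eqF// (lt_trans ltr01).
Qed.

Definition annular_box (i : nat) : set X :=
  box (side beta k (z i) d) (side beta k (z i) d).

(** Consecutive boxes are disjoint because their first coordinates range over
    consecutive dyadic intervals. *)
Lemma annular_box_disjoint i i' xi :
  annular_box i xi -> annular_box i' xi -> i = i'.
Proof.
wlog ii' : i i' / (i <= i')%N => [H|].
  by case: (leqP i i') => [/H //|/ltnW /H + h1 h2]; move=> ->.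
move=> /(_ j0) + /(_ j0); rewrite !side_scale => /andP[h1 _] /andP[_ h2].
move: ii'; rewrite leq_eqVlt => /orP[/eqP //|ii']; exfalso.
have : k * (2 ^- i') <= k * (2 ^- i.+1).
  by rewrite ler_pM2l// lef_pV2 ?posrE ?exprn_gt0// ler_weXn2l// ler1n.
have : 2 ^- i = 2 * 2 ^- i.+1 :> R.
  by rewrite exprS invfM mulrA divff// mul1r.
move=> e h3; rewrite e in h1; lra.
Qed.

Lemma mu_annular_box i : mu (annular_box i) = (k ^+ d * z i `^ (- A))%:E.
Proof.
rewrite mu_box ?prod_side//; first exact: scale_gt0.
by move=> j; rewrite ltW// side_gt0// scale_gt0.
Qed.

Definition slab (i : nat) : set Y :=
  tube (z i / 2) (z i) (fun=> 0) (fun=> 0) (radius beta (z i) d).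

Lemma slab_disjoint i i' y : slab i y -> slab i' y -> i = i'.
Proof.
wlog ii' : i i' / (i <= i')%N => [H|].
  by case: (leqP i i') => [/H //|/ltnW /H + h1 h2]; move=> ->.
move=> [/andP[_ h1] _] [/andP[h2 _] _].
move: ii'; rewrite leq_eqVlt => /orP[/eqP //|/scale_ltn h3].
by have := lt_le_trans h3 (le_trans h2 h1); rewrite ltxx.
Qed.

Lemma nu_slab i : nu (slab i) = (2 ^+ d / 2 * z i `^ (1 + A))%:E.
Proof.
have z0 := scale_gt0 i.
rewrite nu_radius_tube//; last by lra.
congr EFin; rewrite powRD ?(gt_eqF z0) ?implybT// (powRr1 (ltW z0)) -/A.
by field.
Qed.

(** With these heights all the bumps have comparable L^p norms. *)
Definition height (i : nat) : R := z i `^ (A * P).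

Definition bump (i : nat) (xi : X) : C :=
  Complex (height i) 0 * packet (side beta k (z i) d) (side beta k (z i) d) (fun=> 0) xi.

Lemma cmod_bump i xi : cmod (bump i xi) = height i * \1_(annular_box i) xi.
Proof. by rewrite cmodM cmod_packet cmod_real ger0_norm// powR_ge0. Qed.

Lemma bounded_meas_bump i : bounded_meas (bump i).
Proof.
split.
  have [mr mi] := cmeasurable_packet (side beta k (z i) d) (side beta k (z i) d) (fun=> 0).
  split; rewrite /bump.
    under eq_fun do rewrite Re_realM.
    by apply: measurable_funM.
  under eq_fun do rewrite Im_realM.
  by apply: measurable_funM.
by exists (height i) => xi; rewrite cmod_bump ler_piMr ?powR_ge0.
Qed.

Lemma extension_scale (b : R) f y : bounded_meas f ->
  ext (fun xi => Complex b 0 * f xi) y = Complex b 0 * ext f y.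
Proof.
move=> bf; have mc := @measurable_cube R d.
have iR := integrable_Re_kernel beta y bf; have iI := integrable_Im_kernel beta y bf.
have kE xi : kernel beta (fun xi => Complex b 0 * f xi) y xi =
    Complex b 0 * kernel beta f y xi by rewrite /kernel mulrCA.
apply/eqP; rewrite eq_complex; apply/andP; split; apply/eqP.
  rewrite [RHS]Re_realM -RintegralZl//.
  by apply: eq_Rintegral => xi _; rewrite [LHS](congr1 (@complex.Re R) (kE xi)) Re_realM.
rewrite [RHS]Im_realM -RintegralZl//.
by apply: eq_Rintegral => xi _; rewrite [LHS](congr1 (@complex.Im R) (kE xi)) Im_realM.
Qed.

(** A fixed fraction 5/36 of the size of the extension of [bump i] on [slab i];
    against the constant 5/18 of [square_function_bound] it leaves a factor 2. *)
Definition level (i : nat) : R := 5 / 72 * k ^+ d * z i `^ (- (A * (1 - P))).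

Lemma bump_lower_bound i y : slab i y -> 36 / 5 * level i <= cmod (ext (bump i) y).
Proof.
move=> [/andP[t1 t2] yj]; rewrite extension_scale; last exact: bounded_meas_packet.
rewrite cmodM cmod_real (ger0_norm (powR_ge0 _ _)).
have z0 := scale_gt0 i.
have av : adapted beta k (z i) d (side beta k (z i) d) (fun=> 0).
  by move=> j; rewrite ltn_ord.
have := @packet_on_tube _ _ _ beta_gt1 k (z i) d (side beta k (z i) d) (fun=> 0)
  (fun=> 0) k_small (scale_ge1 i) av y.
have ty : tube 0 (z i) (fun=> 0) (fun=> 0) (radius beta (z i) d) y.
  by split => //; apply/andP; split => //; apply: le_trans t1; rewrite divr_ge0// ltW.
move=> /(_ ty) h; apply: le_trans (ler_wpM2l (powR_ge0 _ _) h).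
rewrite /level -/A.
rewrite (_ : - (A * (1 - P)) = A * P + - A); last by ring.
rewrite powRD ?(gt_eqF z0) ?implybT//.
by rewrite le_eqVlt; apply/orP; left; apply/eqP; rewrite /height; field.
Qed.

Lemma slab_mass i : A * (1 - P) * r = 1 + A ->
  level i `^ r * (2 ^+ d / 2 * z i `^ (1 + A)) =
  (5 / 72 * k ^+ d) `^ r * (2 ^+ d / 2).
Proof.
move=> HA; have z0 := scale_gt0 i.
rewrite /level powRM ?powR_ge0//; last by rewrite mulr_ge0// exprn_ge0// ltW.
rewrite -(powRrM (z i)) mulNr HA powRN.
by field; rewrite gt_eqF// powR_gt0.
Qed.

(** Testing against this weight is dual to the L^r norm of a function of size
    [level i] on each slab. *)
Definition weight_fun (y : Y) : R := \sum_(i < N) level i `^ (r - 1) * \1_(slab i) y.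

Lemma level_gt0 i : 0 < level i.
Proof. by rewrite mulr_gt0 ?powR_gt0 ?scale_gt0// mulr_gt0// exprn_gt0. Qed.

Lemma cLnorm_signed_bumps (p : \bar R) (e : {ffun 'I_N -> bool}) :
  (1 <= p)%E -> P = fine p^-1 ->
  (cLnorm mu cube p (fun xi => \sum_(i < N) (-1) ^+ e i * bump i xi)%R
    <= ((N%:R * k ^+ d) `^ P)%:E)%E /\
  bounded_meas (fun xi => \sum_(i < N) (-1) ^+ e i * bump i xi).
Proof.
move=> p1 PE.
have gle xi : cmod (\sum_(i < N) (-1) ^+ e i * bump i xi) <=
    \sum_(i < N) height i * \1_(annular_box i) xi.
  apply: le_trans (cmod_sum _ _) _; apply: ler_sum => i _.
  by rewrite cmod_sign cmod_bump.
have bg : bounded_meas (fun xi => \sum_(i < N) (-1) ^+ e i * bump i xi).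
  split.
    split.
      under eq_fun do rewrite Re_sign_sum.
      apply: measurable_sum => i; apply: measurable_funM => //.
      by have [[]] := bounded_meas_bump i.
    under eq_fun do rewrite Im_sign_sum.
    apply: measurable_sum => i; apply: measurable_funM => //.
    by have [[]] := bounded_meas_bump i.
  exists (\sum_(i < N) height i) => xi; apply: le_trans (gle xi) _.
  by apply: ler_sum => i _; rewrite ler_piMr ?powR_ge0.
split => //; rewrite PE; apply: cLnorm_le => //.
- by rewrite mulr_ge0// exprn_ge0// ltW.
- move=> r' pr'; have r'0 : 0 < r'.
    by move: p1; rewrite pr' lee_fin; apply: lt_le_trans.
  apply: (@le_trans _ _
    (\int[mu]_x (\sum_(i < N) height i `^ r' * \1_(annular_box i) x)%:E)%E).
    rewrite integral_mkcond; apply: ge0_le_integral => //.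
    + by move=> x _; rewrite patchE; case: ifP => _; rewrite ?lee_fin ?powR_ge0.
    + rewrite -measurable_restrictT; last exact: measurable_cube.
      apply/measurable_EFinP; apply: (measurableT_comp (measurable_powR _)).
      apply: measurable_funTS; apply: cmeasurable_cmod.
      by case: bg.
    + apply/measurable_EFinP; apply: measurable_sum => i.
      by apply: measurable_funM => //; apply: measurable_indic; exact: measurable_box.
    + move=> x _; rewrite patchE.
      apply: (@le_trans _ _ (cmod (\sum_(i < N) (-1) ^+ e i * bump i x) `^ r')%:E).
        by case: ifP => _ //; rewrite lee_fin powR_ge0.
      rewrite lee_fin.
      apply: (@le_trans _ _ ((\sum_(i < N) height i * \1_(annular_box i) x) `^ r')).
        apply: ge0_ler_powR; rewrite ?nnegrE ?cmod_ge0//; first exact: ltW.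
        by apply: sumr_ge0 => i _; rewrite mulr_ge0// powR_ge0.
      have [|[i _ h]|h] := @sum_indic_disjoint _ 'I_N (fun i => annular_box i) x.
      * by move=> i j hi hj; apply: ord_inj; exact: annular_box_disjoint hi hj.
      * by rewrite (h (fun i => height i)) (h (fun i => height i `^ r')).
      * by rewrite (h (fun i => height i)) (h (fun i => height i `^ r')) powR0// gt_eqF.
  rewrite (@integral_sum_indic _ _ mu 'I_N (fun i => annular_box i)
    (fun i => height i `^ r')); last 2 first.
  + by move=> i; exact: powR_ge0.
  + by move=> i; exact: measurable_box.
  rewrite (eq_bigr (fun=> (k ^+ d)%:E)).
    by rewrite sumEFin sumr_const card_ord -[X in (X%:E <= _)%E]mulr_natl.
  move=> i _; rewrite [X in (_ * X)%E]mu_annular_box -EFinM; congr EFin.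
  have z0 := scale_gt0 i.
  rewrite /height -powRrM -(_ : A = A * P * r').
    by rewrite mulrCA -powRD ?(gt_eqF z0) ?implybT// subrr powRr0 mulr1.
  by rewrite PE pr' inver gt_eqF//= -mulrA mulVf ?gt_eqF// mulr1.
- move=> poo x; apply: le_trans (gle x) _.
  have P0 : P = 0 by rewrite PE poo invey.
  have h1 i : height i = 1 by rewrite /height P0 mulr0 powRr0.
  have [|[i _ h]|h] := @sum_indic_disjoint _ 'I_N (fun i => annular_box i) x.
  * by move=> i j hi hj; apply: ord_inj; exact: annular_box_disjoint hi hj.
  * by rewrite (h (fun i => height i)) h1.
  * by rewrite (h (fun i => height i)).
Qed.

(** Each of the [N] scales contributes the same mass to the [r]-th power of the
    [L^r] norm, while the [L^p] norm of the input only grows like [N ^ (1/p)]. *)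
Lemma sum_level_bound (K : R) (p : \bar R) :
  (1 <= p)%E -> P = fine p^-1 -> 0 < K -> A * (1 - P) * r = 1 + A ->
  (forall f (S : R), bounded_meas f -> 0 <= S -> (cLnorm mu cube p f <= S%:E)%E ->
    (\int[nu]_y (cmod (ext f y) `^ r)%:E <= ((K * S) `^ r)%:E)%E) ->
  N%:R * ((5 / 72 * k ^+ d) `^ r * (2 ^+ d / 2)) <=
    (K * (N%:R * k ^+ d) `^ P) `^ r.
Proof.
move=> p1 PE K0 HA HK.
set c1 := _ `^ r * _; set S := _ `^ P.
have r0 : 0 < r by rewrite (lt_le_trans ltr01).
have mslab i : measurable (slab i) by exact: measurable_tube.
have mass (c : R) : 0 <= c ->
    (\int[nu]_y (\sum_(i < N) (c * level i `^ r) * \1_(slab i) y)%:E =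
     (c * (N%:R * c1))%:E)%E.
  move=> c0; rewrite (@integral_sum_indic _ _ nu 'I_N (fun i => slab i)
    (fun i => c * level i `^ r))//; last first.
    by move=> i; rewrite mulr_ge0// powR_ge0.
  rewrite (eq_bigr (fun=> (c * c1)%:E)).
    by rewrite sumEFin sumr_const card_ord -[in LHS]mulr_natl mulrCA.
  move=> i _; rewrite [X in (_ * X)%E]nu_slab -EFinM; congr EFin.
  by rewrite -[LHS]mulrA slab_mass.
have W0 y : 0 <= weight_fun y.
  by apply: sumr_ge0 => i _; rewrite mulr_ge0// powR_ge0.
have mW : measurable_fun setT weight_fun.
  apply: measurable_sum => i; apply: measurable_funM => //; exact: measurable_indic.
have dslab y := @sum_indic_disjoint _ 'I_N (fun i => slab i) y
  (fun i j hi hj => ord_inj (slab_disjoint hi hj)).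
have := @square_function_bound _ _ beta 'I_N (fun i => bump i) weight_fun
  (N%:R * c1 + (K * S) `^ r) (fun i => bounded_meas_bump i) mW W0.
move=> H; have {H} : (\int[nu]_y (weight_fun y * (5 / 18 *
    square_function (fun i : 'I_N => ext (bump i) y)))%:E
    <= (N%:R * c1 + (K * S) `^ r)%:E)%E.
  apply: H => e; have [gS bg] := cLnorm_signed_bumps e p1 PE.
  have HKg := HK _ _ bg (powR_ge0 _ _) gS.
  have mg : measurable_fun setT (fun y => cmod
      (ext (fun xi => \sum_(i < N) (-1) ^+ e i * bump i xi) y)).
    by apply: cmeasurable_cmod; exact: measurable_extension.
  have mgr : measurable_fun setT (fun y => (cmod
      (ext (fun xi => \sum_(i < N) (-1) ^+ e i * bump i xi) y) `^ r)%:E).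
    by apply/measurable_EFinP; apply: (measurableT_comp (measurable_powR _)).
  have ms : measurable_fun setT
      (fun y => (\sum_(i < N) (1 * level i `^ r) * \1_(slab i) y)%:E).
    apply/measurable_EFinP; apply: measurable_sum => i.
    by apply: measurable_funM => //; exact: measurable_indic.
  apply: (@le_trans _ _ (\int[nu]_y
    ((\sum_(i < N) (1 * level i `^ r) * \1_(slab i) y)%:E +
     (cmod (ext (fun xi => \sum_(i < N) (-1) ^+ e i * bump i xi)%R y) `^ r)%:E))%E).
    apply: ge0_le_integral => //.
    - by move=> y _; rewrite lee_fin mulr_ge0// cmod_ge0.
    - by apply/measurable_EFinP; apply: measurable_funM.
    - exact: emeasurable_funD.
    move=> y _; rewrite -EFinD lee_fin /weight_fun.
    set w := cmod _; have w0 : 0 <= w by exact: cmod_ge0.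
    have [[i _ h]|h] := dslab y; last first.
      rewrite (h (fun i => level i `^ (r - 1))) (h (fun i => 1 * level i `^ r)).
      by rewrite mul0r add0r powR_ge0.
    rewrite (h (fun i => level i `^ (r - 1))) (h (fun i => 1 * level i `^ r)) mul1r.
    have l0 := level_gt0 i.
    have lr : level i `^ r = level i `^ (r - 1) * level i.
      by rewrite -[X in _ = _ * X](powRr1 (ltW l0)) -powRD ?(gt_eqF l0) ?implybT// subrK.
    have l1 : level i `^ (r - 1) * level i `^ (1 - r) = 1.
      rewrite -powRD ?(gt_eqF l0) ?implybT//.
      by rewrite (_ : r - 1 + (1 - r) = 0) ?powRr0//; ring.
    apply: le_trans (ler_wpM2l (powR_ge0 _ _) (level_split r1 l0 w0)) _.
    by rewrite mulrDr [X in _ + X <= _]mulrA l1 mul1r -lr.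
  rewrite ge0_integralD//; last 2 first.
  - move=> y _; rewrite lee_fin; apply: sumr_ge0 => i _.
    by rewrite mulr_ge0// mulr_ge0// powR_ge0.
  - by move=> y _; rewrite lee_fin powR_ge0.
  by rewrite mass// mul1r EFinD leeD2l.
move=> H; have {H} : ((2 * (N%:R * c1))%:E <= (N%:R * c1 + (K * S) `^ r)%:E)%E.
  apply: le_trans H; rewrite -mass//; apply: ge0_le_integral => //.
  - move=> y _; rewrite lee_fin; apply: sumr_ge0 => i _.
    by rewrite mulr_ge0// mulr_ge0// powR_ge0.
  - apply/measurable_EFinP; apply: measurable_sum => i.
    by apply: measurable_funM => //; exact: measurable_indic.
  - apply/measurable_EFinP; apply: measurable_funM => //.
    apply: measurable_funM => //; apply: (measurableT_comp (@measurable_sqrt R)).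
    apply: measurable_sum => i; apply: measurable_funX.
    apply: cmeasurable_cmod; apply: measurable_extension; exact: bounded_meas_bump.
  move=> y _; rewrite lee_fin /weight_fun.
  have [[i yi h]|h] := dslab y; last first.
    rewrite (h (fun i => level i `^ (r - 1))) (h (fun i => 2 * level i `^ r)).
    by rewrite mul0r.
  rewrite (h (fun i => level i `^ (r - 1))) (h (fun i => 2 * level i `^ r)).
  have l0 := level_gt0 i.
  have -> : level i `^ r = level i `^ (r - 1) * level i.
    by rewrite -[X in _ = _ * X](powRr1 (ltW l0)) -powRD ?(gt_eqF l0) ?implybT// subrK.
  rewrite mulrCA ler_pM2l ?powR_gt0//.
  have : 36 / 5 * level i <= square_function (fun i : 'I_N => ext (bump i) y).
    apply: le_trans (bump_lower_bound yi) _.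
    rewrite /square_function -[leLHS](ger0_norm (cmod_ge0 _)) -sqrtr_sqr.
    rewrite ler_wsqrtr// (bigD1 i)//= lerDl.
    by apply: sumr_ge0 => j _; exact: sqr_ge0.
  lra.
by rewrite lee_fin; lra.
Qed.

End construction.

(** On the scaling line every scale carries the same share of both norms, so
    superposing many scales violates the strong bound unless [p <= r]. *)
Lemma scaling_line_strong (p : \bar R) (r : R) :
  (1 <= p)%E -> 1 <= r -> fine p^-1 * r < 1 ->
  total_weight beta d * (1 - fine p^-1) * r = 1 + total_weight beta d ->
  ~ extension_strong_type beta p r%:E.
Proof.
move=> p1 r1 Pr HA /(strong_bound p1 r1)[K K0 HK].
have [k ksm] := exists_small_enough beta; have [k0 _ _] := ksm.
set P := fine p^-1 in Pr HA *.
have P0 : 0 <= P.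
  by apply: fine_ge0; rewrite inve_ge0; apply: le_trans p1.
have r0 : 0 < r by rewrite (lt_le_trans ltr01).
have kd0 : 0 < k ^+ d by rewrite exprn_gt0.
set c1 := (5 / 72 * k ^+ d) `^ r * (2 ^+ d / 2).
have c10 : 0 < c1 by rewrite mulr_gt0 ?powR_gt0// ?divr_gt0 ?mulr_gt0 ?exprn_gt0.
pose B := (K * (k ^+ d) `^ P) `^ r / c1.
suff : 1 - P * r <= 0 by lra.
apply: (@bounded_powR_le0 _ _ B) => x x1.
have x0 : 0 <= x by rewrite (le_trans ler01).
pose N := Num.bound x; have xN : x < N%:R by rewrite archi_boundP.
have N0 : 0 < N%:R :> R by rewrite (le_lt_trans x0).
apply: (@le_trans _ _ (N%:R `^ (1 - P * r))).
  apply: ge0_ler_powR; rewrite ?nnegrE// ?subr_ge0 ltW//.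
rewrite /B ler_pdivlMr//.
have := sum_level_bound N ksm r1 p1 erefl K0 HA HK; rewrite -/c1 -/P.
rewrite (powRM _ (ltW N0) (ltW kd0)) [X in _ <= X `^ _]mulrCA.
rewrite (powRM _ (powR_ge0 _ _)); last by rewrite mulr_ge0 ?powR_ge0// ltW.
rewrite -powRrM => h.
rewrite powRB ?(gt_eqF N0) ?implybT// (powRr1 (ltW N0)) mulrAC ler_pdivrMr ?powR_gt0//.
by rewrite [leRHS]mulrC.
Qed.

End scaling_line.

(** * Summing over level sets *)

Section multiplicity.
Context dT (T : measurableType dT) (R : realType).
Variable m : {measure set T -> \bar R}.
Variables (I : finType) (A : I -> set T) (U : set T).
Hypothesis mA : forall i, measurable (A i).
Hypothesis mU : measurable U.
Hypothesis AU : forall i, A i `<=` U.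
Hypothesis U_fin : (m U < +oo)%E.

Definition multiplicity (x : T) : R := \sum_i \1_(A i) x.

Definition level_set (a : R) : set T := [set x | a <= multiplicity x].

Lemma measurable_multiplicity : measurable_fun setT multiplicity.
Proof. by apply: measurable_sum => i; apply: measurable_indic. Qed.

Lemma measurable_level_set a : measurable (level_set a).
Proof.
rewrite (_ : level_set a = multiplicity @^-1` `[a, +oo[%classic).
  rewrite -[X in measurable X]setTI; apply: measurable_multiplicity => //.
by apply/seteqP; split => x /=; rewrite in_itv/= andbT.
Qed.

Lemma multiplicityE x : multiplicity x = #|[set i | x \in A i]%SET|%:R.
Proof.
rewrite /multiplicity -sum1_card natr_sum [RHS]big_mkcond/=.
by apply: eq_bigr => i _; rewrite indicE inE; case: (x \in A i).
Qed.

Lemma level_set_sub a : 0 < a -> level_set a `<=` U.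
Proof.
move=> a0 x /= ax; apply: contrapT => nU.
move: ax; rewrite /level_set/= /multiplicity big1 ?leNgt ?a0// => i _.
by rewrite indicE memNset// => /AU.
Qed.

Lemma fin_num_level_set a : 0 < a -> m (level_set a) \is a fin_num.
Proof.
move=> a0; rewrite ge0_fin_numE//; apply: le_lt_trans U_fin.
apply: le_measure; rewrite ?inE//; first exact: measurable_level_set.
exact: level_set_sub.
Qed.

(** A dyadic layer-cake bound, truncated from below at height [2 ^ L]. *)
Lemma multiplicity_le L x :
  multiplicity x <= 2 ^+ L * \1_U x +
    \sum_(i < #|I|) 2 ^+ (L + i).+1 * \1_(level_set (2 ^+ (L + i))) x.
Proof.
have s0 : 0 <= \sum_(i < #|I|) 2 ^+ (L + i).+1 * \1_(level_set (2 ^+ (L + i))) x :> R.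
  by apply: sumr_ge0 => i _; rewrite mulr_ge0// exprn_ge0.
rewrite multiplicityE; set c := #|_|.
have cI : (c <= #|I|)%N by exact: max_card.
have [->|c0] := posnP c; first by rewrite addr_ge0// mulr_ge0// exprn_ge0.
have Ux : U x.
  apply: (@level_set_sub 1) => //; rewrite /level_set/= multiplicityE -/c.
  by rewrite ler1n.
have [cL|Lc] := leqP c (2 ^ L).
  rewrite indicE mem_set//= mulr1 (@le_trans _ _ (2 ^+ L))//.
    by rewrite -natrX ler_nat.
  by rewrite lerDl.
have /andP[k1 k2] := trunc_log_bounds (isT : (1 < 2)%N) c0.
set k := trunc_log 2 c in k1 k2.
have Lk : (L <= k)%N.
  rewrite leqNgt; apply/negP => kL.
  have : (2 ^ k.+1 <= 2 ^ L)%N by rewrite leq_exp2l.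
  by move=> h; have := leq_trans k2 h; rewrite ltnNge (ltnW Lc).
have kI : (k - L < #|I|)%N.
  apply: leq_ltn_trans (leq_subr _ _) _; apply: leq_trans cI.
  by apply: leq_trans k1; exact: ltn_expl.
rewrite (@le_trans _ _ (2 ^+ k.+1))//.
  by rewrite -natrX ler_nat ltnW.
rewrite (bigD1 (Ordinal kI))//= subnKC//.
rewrite [X in _ <= _ + (X + _)](_ : _ = 2 ^+ k.+1); last first.
  rewrite indicE mem_set ?mulr1//= /level_set/= multiplicityE -/c.
  by rewrite -natrX ler_nat.
rewrite addrCA lerDl; apply: addr_ge0; first by rewrite mulr_ge0// exprn_ge0.
by apply: sumr_ge0 => i _; rewrite mulr_ge0// exprn_ge0.
Qed.

Lemma geometric_sum_le (rho : R) n : 0 <= rho -> rho < 1 ->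
  \sum_(i < n) rho ^+ i <= (1 - rho)^-1.
Proof.
move=> r0 r1; rewrite -[leRHS]mul1r ler_pdivlMr ?subr_gt0// mulrC.
have -> : (1 - rho) * \sum_(i < n) rho ^+ i = 1 - rho ^+ n.
  by rewrite -[RHS]opprB subrX1 -mulNr opprB.
by rewrite gerBl exprn_ge0.
Qed.

(** If the multiplicity obeys a weak-type bound of order [e > 1], then it cannot
    concentrate on a set [U] much smaller than its total mass. *)
Lemma sum_measure_le (B e : R) L : 0 <= B -> 1 < e ->
  (forall a, 1 <= a -> fine (m (level_set a)) <= B * a `^ (- e)) ->
  \sum_i fine (m (A i)) <=
    2 ^+ L * fine (m U) + 2 * B * (2 `^ (1 - e)) ^+ L / (1 - 2 `^ (1 - e)).
Proof.
move=> B0 e1 HB.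
have mUf : m U \is a fin_num by rewrite ge0_fin_numE.
have mAf i : m (A i) \is a fin_num.
  rewrite ge0_fin_numE//; apply: le_lt_trans U_fin.
  by apply: le_measure; rewrite ?inE//; exact: AU.
set rho := 2 `^ (1 - e).
have rho0 : 0 <= rho by exact: powR_ge0.
have rho1 : rho < 1.
  rewrite /rho -(opprB e) powRN invf_lt1 ?powR_gt0//.
  apply: (@le_lt_trans _ _ (1 `^ (e - 1))); first by rewrite powR1.
  by apply: gt0_ltr_powR; rewrite ?nnegrE ?subr_gt0// ltr1n.
pose lev (i : 'I_#|I|) := level_set (2 ^+ (L + i)).
have mlev i : measurable (lev i) by exact: measurable_level_set.
have p0 j : 0 < 2 ^+ j :> R by rewrite exprn_gt0.
have levf i : m (lev i) \is a fin_num by exact: fin_num_level_set.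
have : (\int[m]_x (multiplicity x)%:E <= \int[m]_x ((2 ^+ L * \1_U x)%:E +
    (\sum_(i < #|I|) 2 ^+ (L + i).+1 * \1_(lev i) x)%:E))%E.
  apply: ge0_le_integral => //.
  - by move=> x _; rewrite lee_fin; apply: sumr_ge0 => i _.
  - by apply/measurable_EFinP; exact: measurable_multiplicity.
  - apply: emeasurable_funD; apply/measurable_EFinP.
      by apply: measurable_funM => //; exact: measurable_indic.
    apply: measurable_sum => i.
    by apply: measurable_funM => //; exact: measurable_indic.
  - by move=> x _; rewrite -EFinD lee_fin; exact: multiplicity_le.
have u0 x : setT x -> (0 <= (2 ^+ L * \1_U x : R)%:E)%E.
  by rewrite lee_fin mulr_ge0// ltW.
have mu1 : measurable_fun setT (fun x => (2 ^+ L * \1_U x : R)%:E).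
  by apply/measurable_EFinP; apply: measurable_funM => //; exact: measurable_indic.
have w0 x : setT x -> (0 <= (\sum_(i < #|I|) 2 ^+ (L + i).+1 * \1_(lev i) x : R)%:E)%E.
  by rewrite lee_fin => _; apply: sumr_ge0 => i _; rewrite mulr_ge0// ltW.
have mw : measurable_fun setT
    (fun x => (\sum_(i < #|I|) 2 ^+ (L + i).+1 * \1_(lev i) x : R)%:E).
  apply/measurable_EFinP; apply: measurable_sum => i.
  by apply: measurable_funM => //; exact: measurable_indic.
rewrite (ge0_integralD m measurableT u0 mu1 w0 mw).
rewrite (integral_scale_indic _ (ltW (p0 L)) mU).
rewrite (@integral_sum_indic _ _ _ m _ lev (fun i => 2 ^+ (L + i).+1)
  (fun i => ltW (p0 _)) mlev).
have -> : (\int[m]_x (multiplicity x)%:E = (\sum_i fine (m (A i)))%:E)%E.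
  transitivity (\int[m]_x (\sum_i 1 * \1_(A i) x)%:E)%E.
    by apply: eq_integral => x _; congr EFin; apply: eq_bigr => i _; rewrite mul1r.
  rewrite (@integral_sum_indic _ _ _ m _ A (fun=> 1))// -sumEFin.
  by apply: eq_bigr => i _; rewrite mul1e fineK.
rewrite -(fineK mUf) -EFinM.
rewrite (eq_bigr (fun i : 'I_#|I| => (2 ^+ (L + i).+1 * fine (m (lev i)))%:E)); last first.
  by move=> i _; rewrite EFinM fineK.
rewrite sumEFin -EFinD lee_fin => /le_trans; apply; rewrite lerD2l.
apply: (@le_trans _ _ (\sum_(i < #|I|) (2 * B * rho ^+ L) * rho ^+ i)).
  apply: ler_sum => i _.
  apply: (@le_trans _ _ (2 ^+ (L + i).+1 * (B * (2 ^+ (L + i)) `^ (- e)))).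
    by rewrite ler_pM2l//; apply: HB; rewrite exprn_ege1// ler1n.
  rewrite -mulrA -exprD exprS.
  have -> : rho ^+ (L + i) = 2 ^+ (L + i) * (2 ^+ (L + i)) `^ (- e).
    rewrite /rho -powR_mulrn ?powR_ge0// -powRrM mulrC powRrM powR_mulrn//.
    by rewrite powRD ?(gt_eqF (p0 _)) ?implybT// powRr1// ltW.
  by rewrite le_eqVlt; apply/orP; left; apply/eqP; ring.
rewrite -mulr_sumr; apply: ler_wpM2l; last exact: geometric_sum_le.
by rewrite mulr_ge0 ?exprn_ge0// mulr_ge0.
Qed.

End multiplicity.

(** * A Besicovitch arrangement of lines *)

Section besicovitch.
Variable R : realType.
Implicit Types (N K k m p : nat) (w v z t : R).

(** The first [k] binary digits of the fraction [m / 2 ^ N]. *)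
Definition truncation N k m : R := (m %/ 2 ^ (N - k))%:R / 2 ^+ k.

(** Already divided by the weight: the value of the [k]-th digit is 0 or
    [2 ^- k.+1]. *)
Definition digit N k m : R := truncation N k.+1 m - truncation N k m.

Lemma truncation_prefix N K k m : (k <= K <= N)%N ->
  truncation N k m = truncation K k (m %/ 2 ^ (N - K)).
Proof.
move=> /andP[kK KN]; rewrite /truncation -divnMA -expnD.
by congr ((_ %/ 2 ^ _)%:R / _); lia.
Qed.

Lemma digit_prefix N K k m : (k < K <= N)%N ->
  digit N k m = digit K k (m %/ 2 ^ (N - K)).
Proof.
move=> /andP[kK KN]; rewrite /digit -!truncation_prefix//; last by rewrite kK.
by rewrite (ltnW kK).
Qed.

Lemma digitE N k m : (k < N)%N ->
  digit N k m = ((m %/ 2 ^ (N - k.+1)) %% 2)%:R / 2 ^+ k.+1.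
Proof.
move=> kN; rewrite /digit /truncation.
rewrite (_ : (N - k)%N = (N - k.+1 + 1)%N); last by lia.
rewrite expnD expn1 divnMA; set a := (m %/ _)%N.
rewrite [in LHS](divn_eq a 2) natrD natrM exprS.
rewrite (_ : ((a %/ 2 * 2 + a %% 2) %/ 2 = a %/ 2)%N); last first.
  by rewrite divnMDl// (divn_small (ltn_pmod _ _))// addn0.
by field; rewrite expf_neq0.
Qed.

Lemma digit_bounds N k m : (k < N)%N -> 0 <= digit N k m <= 2 ^- k.+1.
Proof.
move=> kN; rewrite digitE//; apply/andP; split.
  by rewrite divr_ge0// exprn_ge0.
apply: ler_piMl; first by rewrite invr_ge0 exprn_ge0.
by rewrite lern1 -ltnS ltn_pmod.
Qed.

Lemma sum_digits N m : (m < 2 ^ N)%N ->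
  \sum_(k < N) digit N k m = m%:R / 2 ^+ N.
Proof.
move=> mN; rewrite -(big_mkord xpredT (fun k => digit N k m)) telescope_sumr//.
rewrite /truncation subnn subn0 expn0 divn1 divn_small// mul0r subr0//.
Qed.

(** Lines with position and velocity such that, at time [z k / n], the
    contribution of the [k]-th digit to the position cancels.  [K] is the number
    of digits that are retained. *)
Definition line_position w z (n : nat) K m : R :=
  w * \sum_(k < K) digit K k m * (z * k%:R / n%:R).

Definition line_velocity v w K m : R := v + w * \sum_(k < K) digit K k m.

Lemma sum_digits_le1 N m : (m < 2 ^ N)%N -> 0 <= \sum_(k < N) digit N k m <= 1.
Proof.
move=> mN; rewrite sum_digits// divr_ge0 ?exprn_ge0//=.
by rewrite ler_pdivrMr ?exprn_gt0// mul1r -natrX ler_nat ltnW.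
Qed.

Lemma line_velocity_bounds v w N m : 0 <= w -> (m < 2 ^ N)%N ->
  v <= line_velocity v w N m <= v + w.
Proof.
move=> w0 mN; rewrite lerDl lerD2l; have /andP[h1 h2] := sum_digits_le1 mN.
by rewrite mulr_ge0//= ler_piMr.
Qed.

Lemma line_position_bounds w z N m : 0 <= w -> 0 <= z -> (m < 2 ^ N)%N ->
  0 <= line_position w z N N m <= w * z.
Proof.
move=> w0 z0 mN; apply/andP; split.
  apply: mulr_ge0 => //; apply: sumr_ge0 => k _.
  have /andP[h _] := digit_bounds m (ltn_ord k).
  by apply: mulr_ge0 => //; rewrite divr_ge0// mulr_ge0.
apply: ler_wpM2l => //.
have /andP[_ h1] := sum_digits_le1 mN.
apply: (@le_trans _ _ (\sum_(k < N) digit N k m * z)).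
  apply: ler_sum => k _; have /andP[h _] := digit_bounds m (ltn_ord k).
  have N0 : 0 < N%:R :> R by rewrite ltr0n; apply: leq_ltn_trans (ltn_ord k).
  apply: ler_wpM2l => //; rewrite ler_pdivrMr// ler_wpM2l// ler_nat ltnW//.
by rewrite -mulr_suml ler_piMl.
Qed.

Lemma sum_arith_geometric_le n :
  \sum_(i < n) i.+1%:R * 2 ^- i.+1 <= 2 :> R.
Proof.
suff -> : \sum_(i < n) i.+1%:R * 2 ^- i.+1 = 2 - n.+2%:R / 2 ^+ n :> R.
  by rewrite gerBl divr_ge0// exprn_ge0.
elim: n => [|n IHn]; first by rewrite big_ord0 expr0 divr1 subrr.
rewrite big_ord_recr/= IHn -[n.+3]addn3 -[n.+2]addn2 -[n.+1]addn1 !natrD.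
rewrite addn1 exprS.
by field; rewrite expf_neq0.
Qed.

(** During the [K]-th time slab the later digits move the lines apart by no more
    than a [1 / N] fraction of the spacing of the prefixes of length [K]. *)
Lemma line_prefix_close v w z N K m t : 0 <= w -> 0 <= z -> (K < N)%N ->
  (m < 2 ^ N)%N -> z * K%:R / N%:R <= t <= z * K.+1%:R / N%:R ->
  `|(line_position w z N N m - t * line_velocity v w N m) -
    (line_position w z N K (m %/ 2 ^ (N - K)) -
       t * line_velocity v w K (m %/ 2 ^ (N - K)))| <=
  2 * w * 2 ^- K * z / N%:R.
Proof.
move=> w0 z0 KN mN /andP[t1 t2]; set p := (m %/ _)%N.
have N0 : 0 < N%:R :> R by rewrite ltr0n (leq_ltn_trans _ KN).
pose F k := digit N k m * (z * k%:R / N%:R - t).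
have lineE : line_position w z N N m - t * line_velocity v w N m =
    w * \sum_(0 <= k < N) F k - t * v.
  rewrite big_mkord /line_position /line_velocity /F.
  rewrite [in RHS](eq_bigr (fun k : 'I_N => digit N k m * (z * k%:R / N%:R) - t * digit N k m));
    last by move=> k _; ring.
  by rewrite [in RHS]sumrB -[in RHS]mulr_sumr; ring.
have dp k : (k < K)%N -> digit K k p = digit N k m.
  by move=> kK; apply/esym/digit_prefix; rewrite kK ltnW.
clearbody p.
have lineE' : line_position w z N K p - t * line_velocity v w K p =
    w * \sum_(0 <= k < K) F k - t * v.
  rewrite big_mkord /line_position /line_velocity /F.
  rewrite [in RHS](eq_bigr (fun k : 'I_K => digit K k p * (z * k%:R / N%:R) - t * digit K k p));
    last by move=> k _; rewrite dp//; ring.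
  by rewrite [in RHS]sumrB -[in RHS]mulr_sumr; ring.
rewrite lineE lineE' (@big_cat_nat _ _ _ K 0 N)//=; last exact: ltnW.
rewrite (_ : _ - _ = w * \sum_(K <= k < N) F k); last by ring.
rewrite normrM (ger0_norm w0) (_ : 2 * w * _ * z / N%:R =
  w * (2 * (2 ^- K * (z / N%:R)))); last by ring.
apply: ler_wpM2l => //; apply: le_trans (ler_norm_sum _ _ _) _.
rewrite -[K in index_iota K]add0n big_addn big_mkord.
apply: (@le_trans _ _ (\sum_(i < N - K)
  (i.+1%:R * 2 ^- i.+1) * (2 ^- K * (z / N%:R)))).
  apply: ler_sum => i _; have iN : (i + K < N)%N by have := ltn_ord i; lia.
  rewrite /F normrM; have /andP[h1 h2] := digit_bounds m iN.
  rewrite (ger0_norm h1).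
  rewrite (_ : _ * (2 ^- K * _) = 2 ^- (i + K).+1 * (i.+1%:R * (z / N%:R))); last first.
    by rewrite -addSn exprD; field; rewrite !expf_neq0// gt_eqF.
  apply: ler_pM => //.
  rewrite ler_norml natrD -[i.+1]addn1 natrD.
  rewrite -[K.+1]addn1 natrD in t2.
  have q0 : 0 <= z / N%:R by rewrite divr_ge0// ltW.
  have e1 : z * K%:R / N%:R = z / N%:R * K%:R by ring.
  have e2 : z * (K%:R + 1%:R) / N%:R = z / N%:R * K%:R + z / N%:R by ring.
  have e3 : z * (i%:R + K%:R) / N%:R = z / N%:R * K%:R + z / N%:R * i%:R by ring.
  have i0 : 0 <= z / N%:R * i%:R by rewrite mulr_ge0.
  rewrite e3 (_ : (i%:R + 1%:R) * (z / N%:R) = z / N%:R * i%:R + z / N%:R); last by ring.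
  by rewrite e1 in t1; rewrite e2 in t2; apply/andP; split; lra.
rewrite -mulr_suml; apply: ler_wpM2r; last exact: sum_arith_geometric_le.
by apply: mulr_ge0; rewrite ?invr_ge0 ?exprn_ge0// divr_ge0.
Qed.

Lemma exists_slab z N t : 0 < z -> (0 < N)%N -> 0 <= t <= z ->
  exists2 K, (K < N)%N & z * K%:R / N%:R <= t <= z * K.+1%:R / N%:R.
Proof.
move=> z0 N0 /andP[t0 tz].
have NR : 0 < N%:R :> R by rewrite ltr0n.
have ex : exists k, t <= z * k.+1%:R / N%:R.
  by exists N.-1; rewrite prednK// mulfK// gt_eqF.
have KP := ex_minnP ex; case: KP => K tK Kmin; exists K.
  have : (K <= N.-1)%N by apply: Kmin; rewrite prednK// mulfK// gt_eqF.
  by rewrite -ltnS prednK.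
rewrite tK andbT; case: K tK Kmin => [|K] tK Kmin; first by rewrite mulr0 mul0r.
rewrite leNgt; apply/negP => h.
by have := Kmin K (ltW h); rewrite ltnn.
Qed.

End besicovitch.

(** * Packets along a Besicovitch arrangement *)

Section kakeya.
Variables (R : realType) (d : nat) (beta : 'I_d -> R).
Hypothesis beta_gt1 : forall j, 1 < beta j.
Local Notation C := R[i].
Local Notation RR := (measurableTypeR R).
Local Notation X := (Rn R d).
Local Notation Y := (RR * Rn R d)%type.
Local Notation mu := (lebesgueRn R d).
Local Notation nu := (lebesgue_measure \x lebesgueRn R d)%E.
Local Notation ext := (extension beta).
Local Notation cube := (@Defs.cube R d).

Let beta_gt0 j : 0 < beta j. Proof. exact: lt_trans (beta_gt1 j). Qed.

Definition base_speed (j : 'I_d) : R := speed (beta j) 2^-1.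

Definition speed_gap (j : 'I_d) : R := speed (beta j) (3 / 4) - base_speed j.

Lemma base_speed_gt0 j : 0 < base_speed j.
Proof. by rewrite mulr_gt0// powR_gt0// invr_gt0. Qed.

Lemma speed_gap_gt0 j : 0 < speed_gap j.
Proof.
rewrite subr_gt0 ltr_pM2l//; apply: gt0_ltr_powR; rewrite ?nnegrE ?subr_gt0//; lra.
Qed.

Variables (n : nat) (js : 'I_d).
Hypothesis n_js : (n <= js)%N.
Variable k : R.
Hypothesis k_small : small_enough beta k.
Hypothesis k_gap : forall j, k * (2 * beta j ^+ 2) <= speed_gap j.

Let k0 : 0 < k. Proof. by case: k_small. Qed.

Variable N : nat.
Hypothesis N_gt0 : (0 < N)%N.

(** With this time scale a curved coordinate has packets of width [2 ^ -N] and
    tubes of width [2 ^ N], as many as there are words of [N] binary digits. *)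
Definition horizon : R := 4 ^+ N.
Local Notation z := horizon.

Lemma horizon_ge1 : 1 <= z.
Proof. by rewrite exprn_ege1// ler1n. Qed.

Let z0 : 0 < z. Proof. exact: lt_le_trans horizon_ge1. Qed.
Let NR : 0 < N%:R :> R. Proof. by rewrite ltr0n. Qed.

Lemma horizonE : z = 2 ^+ N * 2 ^+ N.
Proof. by rewrite /horizon -exprMn; congr (_ ^+ _); ring. Qed.

Lemma horizon_half : z `^ 2^-1 = 2 ^+ N.
Proof.
by rewrite powR12_sqrt ?ltW// horizonE -expr2 sqrtr_sqr ger0_norm// exprn_ge0.
Qed.

Definition packet_velocity (j : 'I_d) (m : nat) : R :=
  line_velocity (base_speed j) (speed_gap j) N m.

(** The point of [1/2, 3/4] whose speed is [packet_velocity j m]. *)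
Definition corner (j : 'I_d) (m : nat) : R :=
  (packet_velocity j m / beta j) `^ (beta j - 1)^-1.

Lemma packet_velocity_bounds j m : (m < 2 ^ N)%N ->
  base_speed j <= packet_velocity j m <= speed (beta j) (3 / 4).
Proof.
move=> mN; have := line_velocity_bounds (base_speed j) (ltW (speed_gap_gt0 j)) mN.
by rewrite /speed_gap subrKC.
Qed.

Lemma speed_corner j m : (m < 2 ^ N)%N ->
  speed (beta j) (corner j m) = packet_velocity j m.
Proof.
move=> mN; have /andP[h _] := packet_velocity_bounds j mN.
have v0 : 0 < packet_velocity j m := lt_le_trans (base_speed_gt0 j) h.
rewrite /speed /corner -powRrM mulVf; last by rewrite subr_eq0 gt_eqF.
by rewrite powRr1 ?ltW ?divr_gt0// mulrC divfK// gt_eqF.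
Qed.

Lemma speed_inv_le j (a : R) v : 0 <= a -> 0 <= v -> v <= speed (beta j) a ->
  (v / beta j) `^ (beta j - 1)^-1 <= a.
Proof.
move=> a0 v0 va; have b1 : 0 < beta j - 1 by rewrite subr_gt0.
apply: (@le_trans _ _ ((a `^ (beta j - 1)) `^ (beta j - 1)^-1)).
  apply: ge0_ler_powR.
  - by rewrite invr_ge0 ltW.
  - by rewrite nnegrE divr_ge0// ltW.
  - by rewrite nnegrE powR_ge0.
  - by rewrite ler_pdivrMr// mulrC.
by rewrite -powRrM divff ?powRr1// gt_eqF.
Qed.

Lemma speed_inv_ge j (a : R) v : 0 <= a -> 0 <= v -> speed (beta j) a <= v ->
  a <= (v / beta j) `^ (beta j - 1)^-1.
Proof.
move=> a0 v0 va; have b1 : 0 < beta j - 1 by rewrite subr_gt0.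
apply: (@le_trans _ _ ((a `^ (beta j - 1)) `^ (beta j - 1)^-1)).
  by rewrite -powRrM divff ?powRr1// gt_eqF.
apply: ge0_ler_powR.
- by rewrite invr_ge0 ltW.
- by rewrite nnegrE powR_ge0.
- by rewrite nnegrE divr_ge0// ltW.
- by rewrite ler_pdivlMr// mulrC.
Qed.

Lemma corner_bounds j m : (m < 2 ^ N)%N -> 2^-1 <= corner j m <= 3 / 4.
Proof.
move=> mN; have /andP[h1 h2] := packet_velocity_bounds j mN.
have v0 : 0 <= packet_velocity j m := le_trans (ltW (base_speed_gt0 j)) h1.
by rewrite speed_inv_ge ?speed_inv_le ?invr_ge0 ?divr_ge0.
Qed.

(** Equally spaced velocities come from corners spaced at least like the sides,
    because the speed is Lipschitz. *)
Lemma corner_separated j m m' : (m < m')%N -> (m' < 2 ^ N)%N ->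
  k * 2 ^- N <= corner j m' - corner j m.
Proof.
move=> mm' m'N; have mN := ltn_trans mm' m'N.
have /andP[a1 a2] := corner_bounds j mN; have /andP[a1' a2'] := corner_bounds j m'N.
have p0 : 0 < 2 ^+ N :> R by rewrite exprn_gt0.
have vd : speed_gap j * 2 ^- N <= packet_velocity j m' - packet_velocity j m.
  rewrite /packet_velocity /line_velocity !sum_digits// opprD addrACA subrr add0r.
  rewrite -mulrBr ler_pM2l ?speed_gap_gt0// -mulrBl.
  apply: ler_peMl; first by rewrite invr_ge0 ltW.
  by rewrite lerBrDr nat1r ler_nat.
have vd0 : 0 < packet_velocity j m' - packet_velocity j m.
  by apply: lt_le_trans vd; rewrite mulr_gt0 ?speed_gap_gt0// invr_gt0.
have cc : corner j m <= corner j m'.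
  rewrite /corner; apply: ge0_ler_powR; rewrite ?nnegrE.
  - by rewrite invr_ge0 subr_ge0 ltW.
  - rewrite divr_ge0 ?(ltW (beta_gt0 j))//.
    have /andP[h _] := packet_velocity_bounds j mN.
    by rewrite (le_trans _ h)// ltW// base_speed_gt0.
  - rewrite divr_ge0 ?(ltW (beta_gt0 j))//.
    have /andP[h _] := packet_velocity_bounds j m'N.
    by rewrite (le_trans _ h)// ltW// base_speed_gt0.
  by rewrite ler_pM2r ?invr_gt0// -subr_ge0 ltW.
have c1 : corner j m' <= 1 by lra.
have /andP[_] := speed_lipschitz (beta_gt1 j) a1 cc c1.
rewrite !speed_corner// => lip.
have b0 : 0 < 2 * beta j ^+ 2 by rewrite mulr_gt0// exprn_gt0.
rewrite -(ler_pM2l b0); apply: le_trans lip; apply: le_trans vd.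
by rewrite mulrA [X in X * _]mulrC ler_pM2r ?invr_gt0.
Qed.

Definition curved_coord : finType := {j : 'I_d | (n <= j)%N}.

Definition word_index : finType := {ffun curved_coord -> 'I_(2 ^ N)}.

Definition word (i : word_index) (j : 'I_d) : nat :=
  oapp (fun j' : curved_coord => i j' : nat) 0%N (insub j).

Lemma word_lt i j : (word i j < 2 ^ N)%N.
Proof. by rewrite /word; case: insub => //=; rewrite expn_gt0. Qed.

Definition packet_corner (i : word_index) (j : 'I_d) : R :=
  if (j < n)%N then side beta k z n j else corner j (word i j).

Definition tube_velocity (i : word_index) (j : 'I_d) : R :=
  if (j < n)%N then 0 else packet_velocity j (word i j).

Definition tube_position (i : word_index) (j : 'I_d) : R :=
  if (j < n)%N then 0 else line_position (speed_gap j) z N N (word i j).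

Lemma packet_adapted i : adapted beta k z n (packet_corner i) (tube_velocity i).
Proof.
move=> j; rewrite /packet_corner /tube_velocity; case: (j < n)%N => //.
by rewrite corner_bounds ?speed_corner ?word_lt.
Qed.

Definition packet_box (i : word_index) : set X := box (packet_corner i) (side beta k z n).

Lemma side_curved (j : 'I_d) : (n <= j)%N -> side beta k z n j = k * 2 ^- N.
Proof.
by move=> nj; rewrite /side /weight ltnNge nj/= powRN horizon_half.
Qed.

Lemma packet_box_disjoint i i' xi : packet_box i xi -> packet_box i' xi -> i = i'.
Proof.
move=> hi hi'; apply/ffunP => j'; apply: ord_inj.
have nj : (n <= val j')%N := valP j'.
have wE (h : word_index) : word h (val j') = h j' :> nat by rewrite /word valK.
have := hi (val j'); have := hi' (val j').
rewrite /packet_corner ltnNge nj/= side_curved// -!wE => /andP[h1 h2] /andP[h3 h4].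
case: (ltngtP (word i (val j')) (word i' (val j'))) => // lt; exfalso.
  by have := corner_separated (val j') lt (word_lt _ _); lra.
by have := corner_separated (val j') lt (word_lt _ _); lra.
Qed.

Definition packet_tube (i : word_index) : set Y :=
  tube 0 z (tube_position i) (tube_velocity i) (radius beta z n).

Definition prefix_index : finType := {K : 'I_N & 'I_(2 ^ K)}.

Definition cover_weight (j : 'I_d) : R := if (j < n)%N then (beta j)^-1 else 1.

Variable M : R.
Hypothesis M_ge1 : 1 <= M.
Hypothesis M_large : forall j, 2 * speed_gap j + base_speed j + 1 <= M.

(** A slab of the Besicovitch set: tubes sharing a prefix of length [K] stay
    together in the coordinate [js]; the remaining coordinates are just bounded. *)
Definition cover_tube (q : prefix_index) : set Y :=
  let K := tag q in
  tube (z * K%:R / N%:R) (z * K.+1%:R / N%:R)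
    (fun j => if j == js then line_position (speed_gap js) z N K (tagged q) else 0)
    (fun j => if j == js then line_velocity (base_speed js) (speed_gap js) K (tagged q) else 0)
    (fun j => if j == js then 2 * speed_gap js * 2 ^- K * z / N%:R + 2 ^+ N
              else M * z `^ cover_weight j).

Definition besicovitch_set : set Y := [set y | exists q, cover_tube q y].

Lemma measurable_besicovitch_set : measurable besicovitch_set.
Proof.
rewrite (_ : besicovitch_set = \bigcup_(q in [set: prefix_index]) cover_tube q).
  by apply: fin_bigcup_measurable => // q _; exact: measurable_tube.
by apply/seteqP; split => [y [q qy]|y [q _ qy]]; exists q.
Qed.

Lemma packet_tube_sub i : packet_tube i `<=` besicovitch_set.
Proof.
move=> y [y1 yj]; have [K KN yK] := exists_slab z0 N_gt0 y1.
have /andP[t0 tz] := y1.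
have pK : (word i js %/ 2 ^ (N - K) < 2 ^ K)%N.
  rewrite ltn_divLR ?expn_gt0// -expnD subnKC; last exact: ltnW.
  exact: word_lt.
exists (Tagged (fun K : 'I_N => 'I_(2 ^ K)) (Ordinal pK : 'I_(2 ^ Ordinal KN))).
split => // j /=; have := yj j; rewrite /tube_position /tube_velocity.
case: eqP => [->|_].
  rewrite ltnNge n_js/= /radius /weight ltnNge n_js/= horizon_half => h.
  have := line_prefix_close (base_speed js) (ltW (speed_gap_gt0 js)) (ltW z0) KN
    (word_lt i js) yK.
  set c' := line_position _ _ N K _ - _ => h'; rewrite -/(packet_velocity _ _) in h'.
  set c := line_position _ _ N N _ - _ in h h'.
  rewrite (_ : tnth y.2 js - c' = (tnth y.2 js - c) + (c - c')); last by ring.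
  by apply: (le_trans (ler_normD _ _)); rewrite addrC lerD.
rewrite mulr0 !subr0 /cover_weight /radius /weight.
case: (ltnP j n) => [jn|nj].
  by rewrite mulr0 !subr0 => h; apply: (le_trans h); rewrite ler_peMl// powR_ge0.
rewrite horizon_half (powRr1 (ltW z0)) => h.
have /andP[p1 p2] := line_position_bounds (ltW (speed_gap_gt0 j)) (ltW z0) (word_lt i j).
have /andP[v1 v2] := packet_velocity_bounds j (word_lt i j).
have vv : `|(y.1 : R) * packet_velocity j (word i j)| <= z * (base_speed j + speed_gap j).
  have v0 : 0 <= packet_velocity j (word i j).
    by rewrite (le_trans _ v1)// ltW// base_speed_gt0.
  rewrite ger0_norm ?mulr_ge0//; apply: ler_pM => //.
  by rewrite /speed_gap subrKC.
have pp : `|line_position (speed_gap j) z N N (word i j)| <= z * speed_gap j.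
  by rewrite ger0_norm// mulrC.
have z2 : 2 ^+ N <= z.
  by rewrite horizonE ler_peMr ?exprn_ge0// exprn_ege1// ler1n.
rewrite -[tnth _ _](subrK (line_position (speed_gap j) z N N (word i j) -
  (y.1 : R) * packet_velocity j (word i j))).
apply: le_trans (ler_normD _ _) _.
apply: (@le_trans _ _ (z + (z * speed_gap j + z * (base_speed j + speed_gap j)))).
  apply: lerD; first exact: le_trans h z2.
  by apply: le_trans (ler_normB _ _) _; exact: lerD.
apply: (@le_trans _ _ ((2 * speed_gap j + base_speed j + 1) * z)); last by rewrite ler_pM2r.
by rewrite le_eqVlt; apply/orP; left; apply/eqP; ring.
Qed.

Definition cover_dim : R := \sum_j cover_weight j.

Lemma nu_cover_tube q : nu (cover_tube q) =
  (z / N%:R * ((2 * (2 * speed_gap js * 2 ^- tag q * z / N%:R + 2 ^+ N)) *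
     ((2 * M) ^+ d.-1 * z `^ (cover_dim - 1))))%:E.
Proof.
have M0 : 0 < M by rewrite (lt_le_trans ltr01).
have sg := speed_gap_gt0 js.
rewrite nu_tube.
- congr EFin; congr (_ * _).
    by rewrite -[(tag q).+1]addn1 natrD; field; rewrite gt_eqF.
  rewrite (bigD1 js)//= eqxx; congr (_ * _).
  rewrite (eq_bigr (fun j => (2 * M) * z `^ cover_weight j)); last first.
    by move=> j /negbTE ->; rewrite mulrA.
  rewrite big_split/= prod_powR// prodr_const.
  congr (_ ^+ _ * _ `^ _).
    by have := cardC1 js; rewrite card_ord => <-; apply: eq_card => j.
  rewrite /cover_dim [in RHS](bigD1 js)//= [X in _ = X + _ - 1]/cover_weight.
  by rewrite ltnNge n_js/= addrAC subrr add0r.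
- rewrite ler_pM2r ?invr_gt0// ler_pM2l// ler_nat//.
- move=> j; case: eqP => _; last by rewrite mulr_ge0 ?powR_ge0// ltW.
  rewrite addr_ge0 ?exprn_ge0// divr_ge0// mulr_ge0 ?(ltW z0)//.
  by rewrite mulr_ge0 ?invr_ge0 ?exprn_ge0// mulr_ge0// ltW.
Qed.

Lemma sum_pow2_le L : \sum_(i < L) 2 ^+ i <= 2 ^+ L :> R.
Proof.
elim: L => [|L IHL]; first by rewrite big_ord0.
by rewrite big_ord_recr/= exprS; lra.
Qed.

(** In the K-th time slab there are 2 ^ K prefixes, each of width about
    2 ^ -K z / N, so all the time slabs have comparable measure and each gains the
    factor 1 / N.  The tubes' own width 2 ^ N adds a geometric series in K. *)
Lemma nu_besicovitch_set :
  (nu besicovitch_set <= ((2 * M) ^+ d.-1 * (2 * (2 * speed_gap js + 1)) *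
     (z `^ (1 + cover_dim) / N%:R))%:E)%E.
Proof.
have M0 : 0 < M by rewrite (lt_le_trans ltr01).
have mc q : measurable (cover_tube q) by exact: measurable_tube.
have sg := speed_gap_gt0 js.
set Q := (2 * M) ^+ d.-1.
have Q0 : 0 <= Q by rewrite exprn_ge0// mulr_ge0// ltW.
apply: (@le_trans _ _ (\sum_q nu (cover_tube q))%E).
  rewrite -[X in (X <= _)%E]mul1e -(integral_scale_indic _ ler01 measurable_besicovitch_set).
  rewrite (eq_bigr (fun q => (1%:E * nu (cover_tube q))%E)); last by move=> q _; rewrite mul1e.
  rewrite -(@integral_sum_indic _ _ _ nu prefix_index cover_tube (fun=> 1))//.
  apply: ge0_le_integral => //.
  - apply/measurable_EFinP; apply: measurable_funM => //.
    by apply: measurable_indic; exact: measurable_besicovitch_set.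
  - apply/measurable_EFinP; apply: measurable_sum => q.
    by apply: measurable_funM => //; exact: measurable_indic.
  move=> y _; rewrite lee_fin mul1r [leLHS]indicE.
  case: (boolP (y \in besicovitch_set)) => [|_]; last first.
    by apply: sumr_ge0 => q _; rewrite mul1r.
  rewrite inE => -[q qy]; rewrite (bigD1 q)//= indicE mem_set// mul1r lerDl.
  by apply: sumr_ge0 => q' _; rewrite mul1r.
under eq_bigr do rewrite nu_cover_tube.
rewrite sumEFin lee_fin.
pose F (K : nat) := z / N%:R * (2 * (2 * speed_gap js * 2 ^- K * z / N%:R + 2 ^+ N) *
     (Q * z `^ (cover_dim - 1))).
rewrite -(sig_big_dep xpredT (fun K : 'I_N => xpredT) (fun (K : 'I_N) (p : 'I_(2 ^ K)) => F K))/=.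
under eq_bigr do rewrite sumr_const card_ord -mulr_natl natrX.
set D := z / N%:R * 2 * (Q * z `^ (cover_dim - 1)).
have D0 : 0 <= D.
  apply: mulr_ge0; last by rewrite mulr_ge0 ?powR_ge0.
  by rewrite mulr_ge0// divr_ge0// ltW.
have FE K : 2 ^+ K * F K = D * (2 * speed_gap js * (z / N%:R) + 2 ^+ N * 2 ^+ K).
  by rewrite /F /D; field; rewrite expf_neq0// gt_eqF.
rewrite (eq_bigr _ (fun (K : 'I_N) _ => FE K)) -mulr_sumr big_split/=.
rewrite sumr_const card_ord -[X in X + _]mulr_natl -mulr_sumr.
apply: (@le_trans _ _ (D * (2 * speed_gap js * z + 2 ^+ N * 2 ^+ N))).
  apply: ler_wpM2l => //; apply: lerD; last first.
    by apply: ler_wpM2l; [exact: exprn_ge0|exact: sum_pow2_le].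
  by rewrite le_eqVlt; apply/orP; left; apply/eqP; field; rewrite gt_eqF.
rewrite -horizonE /D.
have -> : z `^ (1 + cover_dim) = z * z * z `^ (cover_dim - 1).
  rewrite -{2 3}(powRr1 (ltW z0)) -!powRD ?(gt_eqF z0) ?implybT//.
  by congr (_ `^ _); ring.
by rewrite le_eqVlt; apply/orP; left; apply/eqP; ring.
Qed.

End kakeya.

Section kakeya_necessity.
Variables (R : realType) (d : nat) (beta : 'I_d -> R).
Hypothesis beta_gt1 : forall j, 1 < beta j.
Local Notation C := R[i].
Local Notation RR := (measurableTypeR R).
Local Notation X := (Rn R d).
Local Notation Y := (RR * Rn R d)%type.
Local Notation mu := (lebesgueRn R d).
Local Notation nu := (lebesgue_measure \x lebesgueRn R d)%E.
Local Notation ext := (extension beta).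
Local Notation cube := (@Defs.cube R d).

Lemma sum_cover_weight n : (n <= d)%N ->
  cover_dim beta n = J beta n + (d - n)%:R.
Proof.
move=> nd; rewrite /cover_dim /J (bigID (fun j : 'I_d => (j < n)%N))/=.
congr (_ + _); first by apply: eq_bigr => j jn; rewrite /cover_weight jn.
rewrite [RHS](_ : _ = ((d - n)%:R / 2) * 2); last by rewrite divfK.
rewrite -sum_half// mulr_suml.
by apply: eq_bigr => j /negbTE jn; rewrite /cover_weight jn mulVf.
Qed.

Lemma card_curved_coord n : (n <= d)%N -> #|curved_coord d n| = (d - n)%N.
Proof.
move=> nd; rewrite card_sig.
have := sum_half R nd; rewrite big_const iter_addr addr0 -[LHS]mulr_natl => h.
have h2 : (2^-1 : R) != 0 by rewrite invr_eq0.
move/(mulIf h2) : h => /eqP; rewrite eqr_nat => /eqP <-.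
by apply: eq_card => j; rewrite !inE [RHS]unfold_in -leqNgt.
Qed.

Section scale.
Variables (n : nat) (js : 'I_d).
Hypothesis n_js : (n <= js)%N.
Variable k : R.
Hypothesis k_small : small_enough beta k.
Hypothesis k_gap : forall j, k * (2 * beta j ^+ 2) <= speed_gap beta j.
Variable N : nat.
Hypothesis N_gt0 : (0 < N)%N.

Local Notation z := (horizon R N).
Let k0 : 0 < k. Proof. by case: k_small. Qed.
Let z1 : 1 <= z. Proof. exact: horizon_ge1. Qed.
Let z0 : 0 < z. Proof. exact: lt_le_trans z1. Qed.
Let nd : (n <= d)%N. Proof. by rewrite ltnW// (leq_ltn_trans n_js). Qed.
Local Notation index := (word_index d n N).
Local Notation ptube := (@packet_tube R d beta n N).

(** The support of all the packets: near 0 in the flat coordinates, the whole of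
    (1/2, 1) in the curved ones. *)
Definition slice_corner (j : 'I_d) : R := if (j < n)%N then side beta k z n j else 2^-1.

Definition slice : set X := box slice_corner slice_corner.

Lemma slice_corner_bounds j : 0 < slice_corner j <= 2^-1.
Proof.
have [_ k4 _] := k_small; rewrite /slice_corner; case: ifP => _; last first.
  by rewrite invr_gt0 lexx ltr0n.
by rewrite side_gt0//= (le_trans (side_le beta_gt1 n k_small z1 j))//; lra.
Qed.

Lemma slice_sub : slice `<=` cube.
Proof.
by apply: box_sub_cube => j; have /andP[h1 h2] := slice_corner_bounds j; lra.
Qed.

Lemma packet_box_sub (i : index) : packet_box beta k i `<=` slice.
Proof.
move=> xi h j; have := h j; have [_ k4 _] := k_small.
rewrite /packet_corner /slice_corner; case: ifP => // _ /andP[h1 h2].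
have /andP[c1 c2] := corner_bounds beta_gt1 j (word_lt i j).
have := side_le beta_gt1 n k_small z1 j => h3.
by apply/andP; split; lra.
Qed.

Lemma mu_slice : exists2 e : R, mu slice = e%:E & 0 < e <= z `^ (- J beta n).
Proof.
exists (\prod_j slice_corner j).
  by rewrite mu_box// => j; have /andP[h _] := slice_corner_bounds j; exact: ltW.
apply/andP; split.
  by apply: prodr_gt0 => j _; have /andP[h _] := slice_corner_bounds j.
rewrite (bigID (fun j : 'I_d => (j < n)%N))/=.
rewrite -[leRHS]mulr1; apply: ler_pM.
- by apply: prodr_ge0 => j _; have /andP[h _] := slice_corner_bounds j; exact: ltW.
- by apply: prodr_ge0 => j _; have /andP[h _] := slice_corner_bounds j; exact: ltW.
- rewrite /J -sumrN -prod_powR//; apply: ler_prod => j jn.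
  rewrite /slice_corner jn /side /weight jn mulr_ge0 ?powR_ge0 ?(ltW k0)//=.
  by have [_ k4 _] := k_small; rewrite ler_piMl ?powR_ge0//; lra.
- apply: prodr_ile1 => j _; have /andP[h1 h2] := slice_corner_bounds j.
  by rewrite ltW//=; lra.
Qed.

Definition modulated_packet (i : index) : X -> C :=
  packet (packet_corner beta k i) (side beta k z n) (tube_position beta i).

Lemma sum_modulated_packet xi : \sum_i cmod (modulated_packet i xi) <= \1_slice xi.
Proof.
rewrite (eq_bigr (fun i => 1 * \1_(packet_box beta k i) xi)); last first.
  by move=> i _; rewrite cmod_packet mul1r.
have [|[i hi h]|h] := @sum_indic_disjoint R _ index (fun i => packet_box beta k i) xi.
- by move=> i j; exact: (packet_box_disjoint beta_gt1 k_gap).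
- by rewrite (h (fun=> 1)) indicE mem_set//; exact: packet_box_sub hi.
- by rewrite (h (fun=> 1)).
Qed.

Let W := total_weight beta n.

Lemma square_function_multiplicity y :
  k ^+ d * z `^ (- W) / 2 * Num.sqrt (multiplicity R ptube y) <=
  square_function (fun i => ext (modulated_packet i) y).
Proof.
set A := _ / 2; have A0 : 0 <= A.
  by rewrite divr_ge0// mulr_ge0 ?powR_ge0// exprn_ge0// ltW.
rewrite -[A](ger0_norm A0) -sqrtr_sqr -sqrtrM ?sqr_ge0// ler_wsqrtr//.
rewrite /multiplicity mulr_sumr; apply: ler_sum => i _.
rewrite indicE; case: (boolP (y \in ptube i)) => [|_]; last by rewrite mulr0 sqr_ge0.
rewrite inE mulr1 => yi; rewrite ler_pXn2r ?nnegrE ?cmod_ge0//.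
exact: (packet_on_tube beta_gt1 k_small z1 (packet_adapted beta_gt1 k i) yi).
Qed.

Lemma sum_nu_packet_tube :
  \sum_i fine (nu (ptube i)) = 2 ^+ d * z `^ (1 + cover_dim beta n).
Proof.
rewrite (eq_bigr (fun=> z * (2 ^+ d * z `^ W))); last first.
  by move=> i _; rewrite nu_radius_tube ?(ltW z0)//= subr0.
rewrite sumr_const -[LHS]mulr_natl card_ffun card_ord card_curved_coord//.
rewrite natrX natrX -horizon_half -powR_mulrn ?powR_ge0// -powRrM.
rewrite mulrC -!mulrA mulrCA; congr (_ * _).
rewrite -{1}(powRr1 (ltW z0)) -!powRD ?(gt_eqF z0) ?implybT//.
by congr (_ `^ _); rewrite /W total_weightE// sum_cover_weight//; field.
Qed.

Variables (K P s : R).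
Hypothesis K_ge0 : 0 <= K.
Hypothesis P_ge0 : 0 <= P.
Hypothesis s_gt0 : 0 < s.
Hypothesis HK : indicator_bound beta K P s.
Hypothesis critical : W - J beta n * P <= (1 + cover_dim beta n) * s.

Hypothesis s_lt_half : s < 2^-1.
Variable M : R.
Hypothesis M_ge1 : 1 <= M.
Hypothesis M_large : forall j, 2 * speed_gap beta j + base_speed beta j + 1 <= M.
Local Notation U := (besicovitch_set beta n js N M).

Let mU : measurable U. Proof. exact: measurable_besicovitch_set. Qed.
Let mT (i : index) : measurable (ptube i). Proof. exact: measurable_tube. Qed.
Let TU (i : index) : ptube i `<=` U.
Proof. exact: (packet_tube_sub beta_gt1 n_js N_gt0 M_ge1 M_large). Qed.
Let U_fin : (nu U < +oo)%E.
Proof. exact: le_lt_trans (nu_besicovitch_set beta_gt1 n_js N_gt0 M_ge1) (ltry _). Qed.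

Definition level_constant : R := (36 / 5 * K / k ^+ d) `^ s^-1.

Lemma nu_level_set_le (a : R) : 1 <= a ->
  fine (nu (level_set ptube a)) <=
  level_constant * z `^ (1 + cover_dim beta n) * a `^ (- (2 * s)^-1).
Proof.
move=> a1; have a0 : 0 < a by rewrite (lt_le_trans ltr01).
have [e muE /andP[e0 ez]] := mu_slice.
set F := level_set _ a; set A := k ^+ d * z `^ (- W) / 2.
have kd0 : 0 < k ^+ d by rewrite exprn_gt0.
have A0 : 0 < A by rewrite divr_gt0// mulr_gt0// powR_gt0.
have mF : measurable F by exact: measurable_level_set.
have Ff : nu F \is a fin_num by exact: (fin_num_level_set mT mU TU U_fin a0).
have Foo : (nu F < +oo)%E by rewrite -ge0_fin_numE.
have sq y : F y -> A * Num.sqrt a <= square_function (fun i => ext (modulated_packet i) y).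
  move=> Fy; apply: le_trans (square_function_multiplicity y).
  by rewrite ler_pM2l// ler_wsqrtr.
have Aa0 : 0 <= A * Num.sqrt a by rewrite mulr_ge0 ?sqrtr_ge0// ltW.
have muE0 : 0 < fine (mu slice) by rewrite [X in fine X]muE.
have := indicator_bound_level K_ge0 s_gt0 Aa0 HK
  (fun i => cmeasurable_packet _ _ _) (measurable_box _ _) slice_sub muE0
  sum_modulated_packet mF Foo sq.
rewrite [X in _ <= K * fine X `^ P]muE /=.
set phi := fine _ => H.
have phi0 : 0 <= phi by exact: fine_ge0.
set c0 := 36 / 5 * K / k ^+ d.
have c00 : 0 <= c0 by rewrite divr_ge0 ?mulr_ge0// ltW.
set G := 1 + cover_dim beta n.
have h1 : phi `^ s <= c0 * (z `^ (G * s)) * a `^ (- 2^-1).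
  have aN : 0 < a `^ 2^-1 by rewrite powR_gt0.
  rewrite powRN ler_pdivlMr//.
  have eP : K * e `^ P <= K * z `^ (- J beta n * P).
    rewrite ler_wpM2l// powRrM; apply: ge0_ler_powR; rewrite ?nnegrE ?powR_ge0//.
    exact: ltW.
  have zc : z `^ (W - J beta n * P) <= z `^ (G * s) by exact: ler_powR.
  apply: (@le_trans _ _ (c0 * z `^ (W - J beta n * P))); last by rewrite ler_wpM2l.
  have -> : z `^ (W - J beta n * P) = z `^ (- J beta n * P) / z `^ (- W).
    rewrite -powRN opprK -powRD ?(gt_eqF z0) ?implybT//; congr (_ `^ _); ring.
  have zW : 0 < z `^ (- W) by rewrite powR_gt0.
  have := le_trans H eP; rewrite -(powR12_sqrt (ltW a0)) /A => H'.
  rewrite [leRHS]mulrA ler_pdivlMr// /c0.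
  rewrite -(ler_pM2r kd0) (_ : 36 / 5 * K / k ^+ d * _ * _ =
    36 / 5 * (K * z `^ (- J beta n * P))); last by field; rewrite gt_eqF.
  rewrite [leLHS](_ : _ = 36 / 5 * (5 / 18 *
    (k ^+ d * z `^ (- W) / 2 * a `^ 2^-1) * phi `^ s)); last by field.
  by rewrite ler_pM2l.
have -> : phi = (phi `^ s) `^ s^-1 by rewrite -powRrM divff ?powRr1// gt_eqF.
apply: le_trans (ge0_ler_powR _ _ _ h1) _; rewrite ?nnegrE ?powR_ge0//.
- by rewrite invr_ge0 ltW.
- by apply: mulr_ge0; [apply: mulr_ge0 => //|]; exact: powR_ge0.
rewrite (powRM _ (mulr_ge0 c00 (powR_ge0 _ _)) (powR_ge0 _ _)).
rewrite (powRM _ c00 (powR_ge0 _ _)) -!powRrM.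
rewrite mulfK ?gt_eqF// (_ : - 2^-1 / s = - (2 * s)^-1)//.
by field; rewrite gt_eqF.
Qed.

(** The tubes have total mass of order [z ^ (1 + cover_dim)] but their union is
    smaller by the factor [1 / N]; the level set bounds forbid this for large [N]. *)
Lemma mass_le (L : nat) (rho := 2 `^ (1 - (2 * s)^-1) : R) :
  2 ^+ d <= 2 ^+ L * ((2 * M) ^+ d.-1 * (2 * (2 * speed_gap beta js + 1))) / N%:R +
    2 * level_constant / (1 - rho) * rho ^+ L.
Proof.
set G := 1 + cover_dim beta n.
have zG : 0 < z `^ G by rewrite powR_gt0.
have B0 : 0 <= level_constant * z `^ G by rewrite mulr_ge0 ?powR_ge0.
have e1 : 1 < (2 * s)^-1.
  by rewrite invf_gt1 ?mulr_gt0//; have := s_lt_half; lra.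
have := sum_measure_le mT mU TU U_fin L B0 e1 nu_level_set_le.
rewrite sum_nu_packet_tube -/G -/rho => H.
have nuU : fine (nu U) <= (2 * M) ^+ d.-1 * (2 * (2 * speed_gap beta js + 1)) *
     (z `^ G / N%:R).
  rewrite -lee_fin fineK; last by rewrite ge0_fin_numE.
  exact: nu_besicovitch_set.
rewrite -(ler_pM2r zG); apply: (le_trans H); rewrite [leRHS]mulrDl; apply: lerD.
  apply: (@le_trans _ _ (2 ^+ L * ((2 * M) ^+ d.-1 * (2 * (2 * speed_gap beta js + 1)) *
     (z `^ G / N%:R)))); first by rewrite ler_wpM2l// exprn_ge0.
  by rewrite le_eqVlt; apply/orP; left; apply/eqP; ring.
by rewrite le_eqVlt; apply/orP; left; apply/eqP; ring.
Qed.

End scale.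

Lemma le0_of_harmonic (x c : R) : (forall N, (0 < N)%N -> x <= c / N%:R) -> x <= 0.
Proof.
move=> H; rewrite leNgt; apply/negP => x0.
have c0 : 0 <= c.
  by have := H 1%N isT; rewrite divr1; apply: le_trans; exact: ltW.
pose N := Num.bound (c / x); have cN : c / x < N%:R by rewrite archi_boundP// divr_ge0// ltW.
have N0 : 0 < N%:R :> R by rewrite (le_lt_trans _ cN)// divr_ge0// ltW.
have := H N; rewrite -(ltr0n R) => /(_ N0); rewrite ler_pdivlMr// leNgt => /negP; apply.
by rewrite mulrC -ltr_pdivrMr.
Qed.

Lemma le0_of_geometric (x c rho : R) : 0 <= rho -> rho < 1 ->
  (forall L, x <= c * rho ^+ L) -> x <= 0.
Proof.
move=> r0 r1 H.
have cv : (c * rho ^+ L) @[L --> \oo] --> c * 0.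
  apply: cvgM; first exact: cvg_cst.
  by apply: cvg_expr; rewrite ger0_norm.
rewrite mulr0 in cv; rewrite -(cvg_lim (@Rhausdorff R) cv).
apply: limr_ge; first by apply/cvg_ex; exists 0.
by apply: nearW.
Qed.

(** Disjoint tubes would only exclude the exponents beyond the critical line.  For
    [s < 1/2], compressing the tubes by a factor [m] gains [m ^ (1/2 - s)], and a
    Besicovitch arrangement has arbitrarily large compression. *)
Lemma kakeya_necessity (K P s : R) (n : nat) : (n < d)%N ->
  0 <= K -> 0 <= P -> 0 < s -> s < 2^-1 -> indicator_bound beta K P s ->
  (1 + J beta n + (d - n)%:R) * s < J beta n * (1 - P) + (d - n)%:R / 2.
Proof.
move=> nd K0 P0 s0 s2 HK; rewrite ltNge; apply/negP => crit.
pose js := Ordinal nd; have njs : (n <= js)%N by [].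
have [k1 ksm1] := exists_small_enough beta.
have [M1 M10 HM1] := exists_bound (fun j => 2 * beta j ^+ 2 / speed_gap beta j).
have [k1_0 k1_4 k1_b] := ksm1.
pose k := Num.min k1 M1^-1.
have k0 : 0 < k by rewrite lt_min k1_0 invr_gt0.
have kk1 : k <= k1 by rewrite ge_min lexx.
have ksm : small_enough beta k.
  split => //; first exact: le_trans kk1 k1_4.
  move=> j; apply: le_trans (k1_b j); rewrite ler_wpM2l// mulr_ge0//.
  by rewrite addr_ge0// mulr_ge0// sqr_ge0.
have kgap j : k * (2 * beta j ^+ 2) <= speed_gap beta j.
  have g0 := speed_gap_gt0 beta_gt1 j.
  apply: (@le_trans _ _ (M1^-1 * (2 * beta j ^+ 2))).
    apply: ler_wpM2r; first by rewrite mulr_ge0// sqr_ge0.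
    by rewrite ge_min lexx orbT.
  by rewrite ler_pdivrMl// -ler_pdivrMr.
have [M2 M20 HM2] := exists_bound (fun j => 2 * speed_gap beta j + base_speed beta j + 1).
pose M := 1 + M2; have M_ge1 : 1 <= M by rewrite lerDl ltW.
have M_large j : 2 * speed_gap beta j + base_speed beta j + 1 <= M.
  by rewrite (le_trans (HM2 j))// lerDr.
have crit' : total_weight beta n - J beta n * P <= (1 + cover_dim beta n) * s.
  rewrite total_weightE ?(ltnW nd)// sum_cover_weight ?(ltnW nd)// addrA.
  by apply: le_trans crit; rewrite le_eqVlt; apply/orP; left; apply/eqP; ring.
have mass N (N0 : (0 < N)%N) L :=
  mass_le njs ksm kgap N0 K0 P0 s0 HK crit' s2 M_ge1 M_large L.
set rho := 2 `^ (1 - (2 * s)^-1) in mass.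
have rho0 : 0 <= rho by exact: powR_ge0.
have rho1 : rho < 1.
  rewrite /rho; have e1 : 1 < (2 * s)^-1 by rewrite invf_gt1 ?mulr_gt0//; lra.
  rewrite -(opprB _ 1) powRN invf_lt1 ?powR_gt0//.
  apply: (@le_lt_trans _ _ (1 `^ ((2 * s)^-1 - 1))); first by rewrite powR1.
  by apply: gt0_ltr_powR; rewrite ?nnegrE ?subr_gt0// ltr1n.
have : 2 ^+ d <= 0 :> R.
  suff H L : 2 ^+ d <= 2 * level_constant k K s / (1 - rho) * rho ^+ L.
    exact: le0_of_geometric rho0 rho1 H.
  rewrite -subr_le0; apply: le0_of_harmonic => N N0.
  by rewrite lerBlDr; exact: mass.
by rewrite leNgt exprn_gt0.
Qed.

End kakeya_necessity.

(** * Necessity of the exponent conditions *)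

Section necessity.
Variables (R : realType) (d : nat) (beta : 'I_d -> R).
Hypothesis d_gt0 : (0 < d)%N.
Hypothesis beta_gt1 : forall j, 1 < beta j.
Local Notation mu := (lebesgueRn R d).
Local Notation nu := (lebesgue_measure \x lebesgueRn R d)%E.
Local Notation ext := (extension beta).
Local Notation cube := (@Defs.cube R d).

(** Interpolation with the trivial bound of [ext f] in the supremum norm. *)
Lemma indicator_bound_lower (K P s s' : R) :
  0 <= K -> 0 <= P -> 0 <= s' -> s' <= s -> indicator_bound beta K P s ->
  exists2 K', 0 <= K' & indicator_bound beta K' 0 s'.
Proof.
move=> K0 P0 s'0 s's HK; exists (K * (2 ^+ d) `^ P + 2 * 2 ^+ d).
  by rewrite addr_ge0// mulr_ge0 ?powR_ge0// exprn_ge0.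
move=> E F f mE Ec E0 mF Foo F0 mf fE.
have bf := bounded_meas_indic mf fE.
have nuF : nu F \is a fin_num by rewrite ge0_fin_numE.
set phi := fine (nu F) in F0 *.
have f1 x : cmod (f x) <= 1 by rewrite (le_trans (fE x))// indicE; case: (_ \in _).
rewrite powRr0 mulr1; have [F1|F1] := leP 1 phi.
  apply: le_trans (HK E F f mE Ec E0 mF Foo F0 mf fE) _.
  rewrite lee_fin; apply: ler_pM => //.
  - by rewrite mulr_ge0// powR_ge0.
  - exact: powR_ge0.
  - rewrite -[leLHS]addr0; apply: lerD; last by rewrite mulr_ge0// exprn_ge0.
    apply: ler_wpM2l => //; apply: ge0_ler_powR; rewrite ?nnegrE ?exprn_ge0//.
      exact: ltW.
    rewrite -lee_fin fineK; last exact: mu_subcube_fin.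
    rewrite -(mu_cube R d); apply: le_measure; rewrite ?inE//; exact: measurable_cube.
  - by apply: ler_powR => //; rewrite lerD2l lerN2.
apply: (@le_trans _ _ (\int[nu]_y (2 * 2 ^+ d * \1_F y)%:E)%E).
  apply: ge0_le_integral => //.
  - by move=> y _; rewrite lee_fin mulr_ge0// cmod_ge0.
  - exact: measurable_indic_cmod_ext.
  - by apply/measurable_EFinP; apply: measurable_funM => //; exact: measurable_indic.
  - move=> y _; rewrite lee_fin mulrC ler_wpM2r//.
    by have := cmod_extension_le beta y mf f1; rewrite mul1r.
have c0 : 0 <= 2 * 2 ^+ d :> R by rewrite mulr_ge0// exprn_ge0.
rewrite (integral_scale_indic _ c0 mF) [X in (_ * X <= _)%E](esym (fineK nuF)).
rewrite -EFinM lee_fin -/phi; apply: ler_pM => //; first exact: ltW.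
  by rewrite lerDr mulr_ge0// powR_ge0.
rewrite -[leLHS](powRr1 (ltW F0)); apply: ger_powR; first by rewrite F0 ltW.
by rewrite gerBl.
Qed.

(** A bound with [s >= 1/2] would descend to the smaller value d / (2 (d + 1)),
    which lies on the critical line of the case n = 0. *)
Lemma indicator_bound_gt2 (K P s : R) : 0 <= K -> 0 <= P ->
  indicator_bound beta K P s -> s < 2^-1.
Proof.
move=> K0 P0 HK; rewrite ltNge; apply/negP => s2.
have dR : 0 < d%:R :> R by rewrite ltr0n.
pose s' : R := d%:R / (2 * (1 + d%:R)).
have d1 : 0 < 1 + d%:R :> R by rewrite addr_gt0.
have s'0 : 0 < s' by rewrite divr_gt0// mulr_gt0.
have s'2 : s' < 2^-1.
  rewrite ltr_pdivrMr ?mulr_gt0//; lra.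
have [K' K'0 HK'] := indicator_bound_lower K0 P0 (ltW s'0) (le_trans (ltW s'2) s2) HK.
have := kakeya_necessity beta_gt1 d_gt0 K'0 (lexx 0) s'0 s'2 HK'.
have -> : J beta 0 = 0 by rewrite /J big_pred0.
rewrite subn0 addr0 mul0r add0r (_ : (1 + d%:R) * s' = d%:R / 2) ?ltxx//.
by rewrite /s'; field; rewrite gt_eqF.
Qed.

Lemma indicator_bound_necessity (K P s : R) : 0 <= K -> 0 <= P -> 0 < s ->
  indicator_bound beta K P s ->
  (forall n, (n <= d)%N -> let a := J beta n + (d - n)%:R / 2 in
    (1 + a) * s <= a * (1 - P)) /\
  (forall n, (n < d)%N ->
    (1 + J beta n + (d - n)%:R) * s < J beta n * (1 - P) + (d - n)%:R / 2).
Proof.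
move=> K0 P0 s0 HK; split => n nd.
  by rewrite /= -total_weightE//; exact: knapp K0 s0 HK.
exact: (kakeya_necessity beta_gt1 nd K0 P0 s0 (indicator_bound_gt2 K0 P0 HK) HK).
Qed.

Lemma critical_weight_gt0 n : (n <= d)%N -> 0 < J beta n + (d - n)%:R / 2.
Proof.
move=> nd; rewrite -total_weightE// /total_weight (bigD1 (Ordinal d_gt0))//=.
rewrite ltr_pwDl ?weight_gt0//; apply: sumr_ge0 => j _; rewrite ltW//.
exact: weight_gt0.
Qed.

Lemma fine_conjugate (p : \bar R) : (1 <= p)%E ->
  fine ((hoelder_conjugate p)^-1)%E = 1 - fine (p^-1)%E.
Proof.
move=> p1; have pE : (p^-1)%E \is a fin_num.
  case: p p1 => [r||]//; rewrite lee_fin => r1.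
  by rewrite inver gt_eqF// (lt_le_trans ltr01).
have pNy : (-oo < p)%E by rewrite (lt_le_trans _ p1)// ltNyr.
have p0 : p != 0%E by rewrite gt_eqF// (lt_le_trans _ p1)// lte01.
have := hoelder_conjugate_eq1 pNy p0.
case: (p^-1)%E pE => [u| |]// _; case: ((hoelder_conjugate p)^-1)%E => [v| |]//=.
by rewrite -EFinD => -[]; lra.
Qed.

Section exponents.
Variables p q : \bar R.
Hypothesis p1 : (1 <= p)%E.
Hypothesis q1 : (1 <= q)%E.

Let P := fine (p^-1)%E.
Let P0 : 0 <= P. Proof. by apply: fine_ge0; rewrite inve_ge0; apply: le_trans p1. Qed.

(** At [q = oo] the operator is bounded, so the conditions have to hold. *)
Lemma cond_q_infinite : q = +oo%E -> cond_i beta p q \/ cond_ii beta p q.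
Proof.
move=> ->; have [->|pN] := eqVneq p +oo%E; last first.
  by left; split; [rewrite lt_neqAle pN leey|move=> n _; rewrite leey].
right; split => // n nd; rewrite /scaling_ineq invey/= mulr0.
rewrite hoelder_conjugatey inve1/= mulr1; exact: critical_weight_gt0.
Qed.

Lemma cond_i_of_knapp (r : R) : q = r%:E -> (p < q)%E ->
  (forall n, (n <= d)%N -> let a := J beta n + (d - n)%:R / 2 in
    (1 + a) * r^-1 <= a * (1 - P)) -> cond_i beta p q.
Proof.
move=> qr pq H; split => // n nd; have := H n nd; rewrite /=.
set a := J beta n + _; have a0 : 0 < a := critical_weight_gt0 nd.
have r0 : 0 < r by move: q1; rewrite qr lee_fin; apply: lt_le_trans.
move: p pq p1 @P P0 H => [p'||]; rewrite ?qr// => pq p'1 Q Q0 _ h.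
have p'0 : 0 < p' by move: p'1; rewrite lee_fin; apply: lt_le_trans.
have QE : Q = p'^-1 by rewrite /Q inver gt_eqF.
have h0 : 0 < a * (1 - Q).
  by apply: lt_le_trans h; rewrite mulr_gt0 ?invr_gt0// addr_gt0.
rewrite pmulr_rgt0// in h0.
have Q1 : p'^-1 < 1 by rewrite -QE; lra.
have p'1' : 1 < p' by rewrite -invf_lt1.
have p'10 : 0 < p' - 1 by rewrite subr_gt0.
rewrite /hoelder_conjugate/= eqe gt_eqF//= -EFinB inver gt_eqF// -!EFinM lee_fin.
have aN : a != 0 by rewrite gt_eqF.
rewrite (_ : _ * _ = (1 + a) * p' / (a * (p' - 1))); last first.
  by field; rewrite aN gt_eqF.
rewrite ler_pdivrMr ?mulr_gt0//.
have := ler_wpM2r (ltW (mulr_gt0 r0 p'0)) h.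
rewrite QE (_ : (1 + a) / r * _ = (1 + a) * p'); last by field; rewrite gt_eqF.
rewrite (_ : a * _ * _ = r * (a * (p' - 1)))//.
by field; rewrite gt_eqF.
Qed.

Lemma cond_of_necessity (K r : R) : q = r%:E -> 0 <= K ->
  indicator_bound beta K P r^-1 ->
  [\/ cond_i beta p q, cond_ii beta p q |
    [/\ (q <= p)%E, scaling_line beta p q &
      forall n, (n < d)%N -> scaling_ineq beta p q n]].
Proof.
move=> qr K0 HK.
have r0 : 0 < r by move: q1; rewrite qr lee_fin; apply: lt_le_trans.
have ri0 : 0 < r^-1 by rewrite invr_gt0.
have [H1 H2] := indicator_bound_necessity K0 P0 ri0 HK.
have [pq|qp] := ltP p q; first by apply: Or31; exact: cond_i_of_knapp qr pq H1.
have qE : fine (q^-1)%E = r^-1 by rewrite qr inver gt_eqF.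
have strict n : (n < d)%N -> scaling_ineq beta p q n.
  by move=> nd; rewrite /scaling_ineq qE fine_conjugate//; exact: H2.
have := H1 d (leqnn d); rewrite /= subnn mul0r addr0 le_eqVlt => /orP[/eqP e|lt].
  by apply: Or33; split => //; rewrite /scaling_line qE fine_conjugate.
apply: Or32; split => // n nd; have [nd'|dn] := ltnP n d; first exact: strict.
have -> : n = d by apply/eqP; rewrite eqn_leq nd dn.
by rewrite /scaling_ineq subnn mul0r !addr0 qE fine_conjugate.
Qed.

End exponents.
End necessity.

Theorem proposition1p8 (R : realType) (d : nat) (beta : 'I_d -> R)
    (p q : \bar R) :
  (0 < d)%N ->
  (forall j, 1 < beta j)%R ->
  (forall i j : 'I_d, (i <= j)%N -> beta j <= beta i)%R ->
  (1 <= p)%E -> (1 <= q)%E ->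
  (~ (cond_i beta p q \/ cond_ii beta p q \/ cond_iii beta p q) ->
     ~ extension_strong_type beta p q) /\
  (~ (cond_i beta p q \/ cond_ii beta p q \/ cond_iii beta p q \/
      cond_iv beta p q) ->
     ~ extension_restricted_weak_type beta p q).
Proof.
move=> d0 beta1 _ p1 q1; split => Hno Hop; apply: Hno.
  case: q q1 Hop => [r||//] q1 Hop; last first.
    by have [] := cond_q_infinite d0 beta1 p erefl; [left|right; left].
  have [K K0 HK] := indicator_bound_of_strong p1 q1 Hop.
  have [ci|cii|[qp line strict]] := cond_of_necessity d0 beta1 p1 q1 erefl K0 HK.
  - by left.
  - by right; left.
  right; right; split => //; apply/eqP; rewrite eq_le qp /=.
  rewrite leNgt; apply/negP => rp.
  have r0 : 0 < r by move: q1; rewrite lee_fin; apply: lt_le_trans.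
  apply: (scaling_line_strong beta1 d0 p1 q1 _ _ Hop).
    move: p p1 rp {Hop HK qp line strict} => [p'||]//= p1.
      rewrite lte_fin => rp; rewrite inver gt_eqF/= ?(lt_trans r0)//.
      by rewrite mulrC ltr_pdivrMr ?mul1r// (lt_trans r0).
    by rewrite ?invey/= mul0r.
  move: line; rewrite /scaling_line fine_conjugate// inver gt_eqF//= => line.
  rewrite total_weightE// subnn mul0r addr0 -line.
  by rewrite divfK// gt_eqF.
case: q q1 Hop => [r||//] q1 Hop; last first.
  by have [] := cond_q_infinite d0 beta1 p erefl; [left|right; left].
have [K K0] := indicator_bound_of_restricted Hop.
rewrite fine_conjugate// subKr => HK.
have r0 : 0 < r by move: q1; rewrite lee_fin; apply: lt_le_trans.
rewrite inver gt_eqF//= in HK.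
have [ci|cii|[qp line strict]] := cond_of_necessity d0 beta1 p1 q1 erefl K0 HK.
- by left.
- by right; left.
- by right; right; right; split => //; rewrite qp leey.
Qed.
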